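(* Let $\mu$ be a finite positive Borel measure on $[0,1)$ and let $\alpha>1$. Then the following statements are equivalent. (1) The measure $\mu$ is an $\alpha$-Carleson measure, i.e. there is a constant $C>0$ such that $\mu([t,1))\le C(1-t)^\alpha$ for all $t\in[0,1)$. (2) The operator $\mathcal{H}_\mu$ is bounded from $\mathcal{B}^\alpha$ into $\mathcal{B}$. (3) The operator $\mathcal{H}_\mu$ is bounded from $\mathcal{B}^\alpha$ into $BMOA$.
   Context: $\mathbb{D}=\{z\in\mathbb{C}:|z|<1\}$ and $H(\mathbb{D})$ is the space of analytic functions on $\mathbb{D}$. For $0<\alpha<\infty$, the Bloch type space $\mathcal{B}^\alpha$ consists of all $f\in H(\mathbb{D})$ with $\|f\|_{\mathcal{B}^\alpha}=\sup_{z\in\mathbb{D}}|f'(z)|(1-|z|^2)^\alpha<\infty$; it is a Banach space with the norm $|f(0)|+\|f\|_{\mathcal{B}^\alpha}$. The Bloch space is $\mathcal{B}=\mathcal{B}^1$. $BMOA$ is the Banach space of all $f\in H(\mathbb{D})$ with $\|f\|_{BMOA}=|f(0)|+\sup_{a\in\mathbb{D}}\|f\circ\varphi_a-f(a)\|_{H^2}<\infty$, where $\varphi_a(z)=\frac{a-z}{1-\bar a z}$ and $H^2$ is the Hardy space. For a finite positive Borel measure $\mu$ on $[0,1)$ put $\mu_n=\int_{[0,1)}t^n\,d\mu(t)$, $n\ge 0$. The operator $\mathcal{H}_\mu$ acts on $f(z)=\sum_{k=0}^\infty a_kz^k\in H(\mathbb{D})$ by $$\mathcal{H}_\mu(f)(z)=\sum_{n=0}^\infty\Big(\sum_{k=0}^\infty\mu_{n+k}a_k\Big)z^n,$$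 whenever the right-hand side makes sense (the inner series converge) and defines an analytic function in $\mathbb{D}$. Saying that $\mathcal{H}_\mu$ is bounded from $X$ into $Y$ means that $\mathcal{H}_\mu(f)$ is well defined and belongs to $Y$ for every $f\in X$, and the resulting linear operator $X\to Y$ is bounded. *)

(* Defs.v *)
From HB Require Import structures.
From mathcomp Require Import all_boot all_order all_algebra.
From mathcomp Require Import complex.
From mathcomp Require Import all_classical all_reals all_analysis.

Set Implicit Arguments.
Unset Strict Implicit.
Unset Printing Implicit Defensive.

Import Order.TTheory GRing.Theory Num.Theory.
Import numFieldNormedType.Exports.

Local Open Scope classical_set_scope.
Local Open Scope complex_scope.
Local Open Scope ring_scope.

(* The topology and normed space structure of [R[i]] over itself given by its
   modulus, as for any [numFieldType]. *)
HB.instance Definition _ (R : rcfType) := NormedModule.copy R[i] R[i]^o.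

Section spaces.
Context {R : realType}.
Local Notation C := R[i].

(* [`|z|] lives in [R[i]]; [cabs z] is the same modulus as an element of [R]. *)
Definition cabs (z : C) : R := complex.Re `|z|.

Definition udisc : set C := [set z | cabs z < 1].

(* Functions on the disc are represented by total functions on [R[i]] whose
   values outside [udisc] play no role; since the scalar field is [R[i]],
   [derivable f z 1] is complex differentiability at [z]. *)
Definition analytic (f : C -> C) : Prop :=
  forall z, udisc z -> derivable f z 1.

(* In the suprema below all elements are nonnegative and the index sets are
   nonempty; an analytic function belongs to a space when its norm is finite. *)
Definition bloch_seminorm (alpha : R) (f : C -> C) : \bar R :=
  ereal_sup [set (cabs (derive1 f z) * (1 - cabs z ^+ 2) `^ alpha)%:E
            | z in udisc].

Definition bloch_norm (alpha : R) (f : C -> C) : \bar R :=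
  ((cabs (f 0))%:E + bloch_seminorm alpha f)%E.

Definition circle_point (r theta : R) : C :=
  (r * cos theta) +i* (r * sin theta).

Definition hardy2_norm (f : C -> C) : \bar R :=
  ereal_sup [set ((((2 * pi)^-1)%:E *
      \int[lebesgue_measure]_(theta in `[0%R, (2 * pi)%R])
        (cabs (f (circle_point r theta)) ^+ 2)%:E) `^ (2^-1)%R)%E
    | r in `[0, 1[].

Definition mobius (a z : C) : C := (a - z) / (1 - a^* * z).

Definition bmoa_seminorm (f : C -> C) : \bar R :=
  ereal_sup [set hardy2_norm (fun z => f (mobius a z) - f a) | a in udisc].

Definition bmoa_norm (f : C -> C) : \bar R :=
  ((cabs (f 0))%:E + bmoa_seminorm f)%E.

Definition in_space (N : (C -> C) -> \bar R) (f : C -> C) : Prop :=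
  analytic f /\ (N f < +oo)%E.

Definition power_series_on_disc (a : nat -> C) (f : C -> C) : Prop :=
  forall z, udisc z -> series (fun k => a k * z ^+ k) @ \oo --> f z.

End spaces.

Section hankel.
Context {R : realType}.
Local Notation C := R[i].
Variable mu : {finite_measure set (measurableTypeR R) -> \bar R}.

Definition moment (n : nat) : R := \int[mu]_(t in `[0%R, 1%R[) (t ^+ n).

Definition hankel_coef_terms (a : nat -> C) (n k : nat) : C :=
  (moment (n + k))%:C * a k.

(* [hankel_graph f g]: the Hankel operator is well defined at [f] and its value
   is [g] (on the disc, where [g] is determined by [f]). *)
Definition hankel_graph (f g : C -> C) : Prop :=
  exists a : nat -> C,
    [/\ power_series_on_disc a f,
        forall n, cvgn (series (hankel_coef_terms a n)),
        power_series_on_disc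
          (fun n => limn (series (hankel_coef_terms a n))) g
      & analytic g].

Definition hankel_bounded (NX NY : (C -> C) -> \bar R) : Prop :=
  (forall f, in_space NX f -> exists2 g, hankel_graph f g & in_space NY g) /\
  (exists K : R, forall f g, in_space NX f -> hankel_graph f g ->
     (NY g <= K%:E * NX f)%E).

Definition carleson (alpha : R) : Prop :=
  exists2 K : R, 0 < K & forall t : R, 0 <= t < 1 ->
    (mu [set` `[t, 1%R[] <= (K * (1 - t) `^ alpha)%:E)%E.

End hankel.

(* Main.v *)
(** A function [f] of the Bloch type space of order [alpha > 1] satisfies
    [|f z| <= c (1 - |z|)^(1 - alpha)].  If [mu] is an [alpha]-Carleson measure,
    then [g z = \int f t / (1 - t z) dmu t], and a dyadic decomposition gives
    [\int (1 - t)^(1/2 - alpha) / (1 - t r) dmu t <= A (1 - r)^(-1/2)].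
    This controls [g'] directly.  For [BMOA], the [H^2] norm of
    [1 / (1 - t phi_a z) - 1 / (1 - t a)] is
    [t (1 - |a|^2)^(1/2) / (|1 - t a| (1 - t^2)^(1/2))], a Poisson integral,
    and Minkowski's inequality reduces the claim to the same estimate.

    The series defining the operator need not be dominated coefficientwise;
    the partial sums of [f] at [t] are bounded by [c (1 - t)^(1/2 - alpha)], which is
    [mu]-integrable, by writing them as circle means of [f] against the Dirichlet
    kernel.  The derivative of [f] is not assumed continuous, but it is bounded on
    compact sets, so Cauchy's formula follows by differentiating under the integral.

    Conversely, testing on [z^n] with [n] comparable to [1 / (1 - s)] gives
    [mu [s, 1) <= c (1 - s)^alpha]: both norms of the image bound
    [(1 - s^2) g' s] from above, for [BMOA] because [g (phi_s z) - g s] is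
    [z] times an analytic function whose value at [0] is [- (1 - s^2) g' s]. *)

Require Import Defs.
From mathcomp Require Import all_boot all_order all_algebra.
From mathcomp Require Import complex.
From mathcomp Require Import all_classical all_reals all_analysis.
From mathcomp Require Import measurable_realfun lebesgue_integral_under.
From mathcomp Require Import ring lra.

Set Implicit Arguments.
Unset Strict Implicit.
Unset Printing Implicit Defensive.

Import Order.TTheory GRing.Theory Num.Theory.
Import numFieldNormedType.Exports.

Local Open Scope classical_set_scope.
Local Open Scope ring_scope.
Local Open Scope complex_scope.

(** * The modulus and limits in R[i] *)

Section modulus.
Context {R : realType}.
Local Notation C := R[i].
Implicit Types (z w : C) (x : R).

(** One integral estimate suffices because every step can be made to cost exactly the power 1/2 of 1
    - t. The Dirichlet kernel has a logarithmic L^1 norm, but passing through L^2 costs (1 -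
    t)^(-1/2). The derivative of the Cauchy kernel contains (1 - t r)^(-2), and one of the two
    factors is given up for (1 - t)^(-1/2) (1 - r)^(-1/2). The H^2 norm contains (1 - t^2)^(-1/2).
    Each time the growth (1 - t)^(1 - alpha) becomes (1 - t)^(1/2 - alpha), and r = 0 yields the
    integrable majorant of the partial sums. The obstacle on the side of the coefficients: the size
    bounds k^(alpha - 1) for those of f and k^(-alpha) for the moments only compare the series with
    the harmonic one, so convergence has to come from whole partial sums. Passages between L^1 and
    L^2 means are made by AM-GM, or by expanding a square, with a parameter tuned to the bound that
    is wanted. *)

Lemma cabsE z : cabs z = Num.sqrt (complex.Re z ^+ 2 + complex.Im z ^+ 2).
Proof. by rewrite /cabs normc_def. Qed.

Lemma cabsC z : (cabs z)%:C = `|z|.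
Proof. by rewrite cabsE normc_def. Qed.

Lemma cabs_ge0 z : 0 <= cabs z.
Proof. by rewrite cabsE sqrtr_ge0. Qed.

Lemma cabs_sqr z : cabs z ^+ 2 = complex.Re z ^+ 2 + complex.Im z ^+ 2.
Proof. by rewrite cabsE sqr_sqrtr // addr_ge0 ?sqr_ge0. Qed.

Lemma cabsM z w : cabs (z * w) = cabs z * cabs w.
Proof. by apply: complexI; rewrite rmorphM /= !cabsC normrM. Qed.

Lemma cabsV z : cabs z^-1 = (cabs z)^-1.
Proof. by apply: complexI; rewrite fmorphV /= !cabsC normfV. Qed.

Lemma cabsX z n : cabs (z ^+ n) = cabs z ^+ n.
Proof. by apply: complexI; rewrite rmorphXn /= !cabsC normrX. Qed.

Lemma cabsN z : cabs (- z) = cabs z.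
Proof. by rewrite /cabs normrN. Qed.

Lemma cabs0 : cabs (0 : C) = 0.
Proof. by rewrite /cabs normr0. Qed.

Lemma cabs1 : cabs (1 : C) = 1.
Proof. by rewrite /cabs normr1. Qed.

Lemma cabsB z w : cabs (z - w) = cabs (w - z).
Proof. by rewrite -cabsN opprB. Qed.

Lemma cabsJ z : cabs z^* = cabs z.
Proof. by rewrite /cabs normcJ. Qed.

Lemma ler_cabsD z w : cabs (z + w) <= cabs z + cabs w.
Proof. by rewrite -lecR rmorphD /= !cabsC ler_normD. Qed.

Lemma ler_cabsB z w : cabs (z - w) <= cabs z + cabs w.
Proof. by rewrite -(cabsN w) ler_cabsD. Qed.

Lemma lerB_cabs z w : cabs z - cabs w <= cabs (z - w).
Proof. by rewrite lerBlDr -{1}(subrK w z) ler_cabsD. Qed.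

Lemma cabs_eq0 z : (cabs z == 0) = (z == 0).
Proof. by rewrite -(inj_eq (@complexI R)) cabsC normr_eq0. Qed.

Lemma cabs_real x : cabs x%:C = `|x|.
Proof. by rewrite cabsE /= expr0n /= addr0 sqrtr_sqr. Qed.

Lemma ler_Re_cabs z : `|complex.Re z| <= cabs z.
Proof. by rewrite -lecR cabsC normc_ge_Re. Qed.

Lemma ler_Im_cabs z : `|complex.Im z| <= cabs z.
Proof.
by rewrite cabsE -sqrtr_sqr ler_wsqrtr // lerDr sqr_ge0.
Qed.

Lemma ler_cabs_ReIm z : cabs z <= `|complex.Re z| + `|complex.Im z|.
Proof.
rewrite -(@ler_pXn2r _ 2) ?nnegrE ?cabs_ge0 ?addr_ge0 //.
rewrite cabs_sqr sqrrD !real_normK ?num_real // lerD2r lerDl.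
by rewrite mulrn_wge0 ?mulr_ge0.
Qed.

Lemma ler_cabs_sum (I : Type) (r : seq I) (P : pred I) (F : I -> C) :
  cabs (\sum_(i <- r | P i) F i) <= \sum_(i <- r | P i) cabs (F i).
Proof.
elim/big_ind2: _ => //; first by rewrite cabs0.
by move=> z1 x1 z2 x2 h1 h2; rewrite (le_trans (ler_cabsD _ _)) ?lerD.
Qed.

Lemma cabs_sqrC z : (cabs z ^+ 2)%:C = z * z^*.
Proof. by rewrite rmorphXn /= cabsC sqr_normc. Qed.

Lemma ReZ x z : complex.Re (x%:C * z) = x * complex.Re z.
Proof. by case: z => a b /=; rewrite mul0r subr0. Qed.

Lemma ImZ x z : complex.Im (x%:C * z) = x * complex.Im z.
Proof. by case: z => a b /=; rewrite mul0r addr0. Qed.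

Lemma ReM z w : complex.Re (z * w) =
  complex.Re z * complex.Re w - complex.Im z * complex.Im w.
Proof. by case: z; case: w. Qed.

Lemma ImM z w : complex.Im (z * w) =
  complex.Re z * complex.Im w + complex.Im z * complex.Re w.
Proof. by case: z; case: w. Qed.

Lemma ReD z w : complex.Re (z + w) = complex.Re z + complex.Re w.
Proof. by case: z; case: w. Qed.

Lemma ImD z w : complex.Im (z + w) = complex.Im z + complex.Im w.
Proof. by case: z; case: w. Qed.

Lemma ReN z : complex.Re (- z) = - complex.Re z.
Proof. by case: z. Qed.

Lemma ImN z : complex.Im (- z) = - complex.Im z.
Proof. by case: z. Qed.

Lemma complexP z w : complex.Re z = complex.Re w ->
  complex.Im z = complex.Im w -> z = w.
Proof. by case: z; case: w => a b c d /= -> ->. Qed.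

(** A rotation onto the positive axis turns a bound on a modulus into a bound on a real part, which
    real integrals and monotonicity can handle. *)
Lemma phaseP z : exists2 u : C, cabs u = 1 & u * z = (cabs z)%:C.
Proof.
have [->|z0] := eqVneq z 0; first by exists 1; rewrite ?cabs1 // mulr0 cabs0.
have cz0 : cabs z != 0 by rewrite cabs_eq0.
exists (z^* / (cabs z)%:C).
  by rewrite cabsM cabsV cabsJ cabs_real ger0_norm ?cabs_ge0 // mulfV.
rewrite mulrAC [_ * z]mulrC -cabs_sqrC expr2 rmorphM /= mulfK //.
by rewrite (inj_eq (@complexI R) _ 0).
Qed.

Lemma cabs_lt1_sub1_neq0 z : cabs z < 1 -> 1 - z != 0.
Proof.
by apply: contraTneq => /subr0_eq <-; rewrite cabs1 ltxx.
Qed.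

End modulus.

Lemma cvg_near_eq {T : Type} {U : topologicalType} (F : set_system T)
    {FF : Filter F} (f g : T -> U) (l : U) :
  (\forall x \near F, f x = g x) -> f @ F --> l -> g @ F --> l.
Proof. by move=> fg; apply: cvg_trans; exact: near_eq_cvg. Qed.

Section complex_limits.
Context {R : realType}.
Local Notation C := R[i].

(** The topology of [R[i]] takes its radii in [R[i]] itself; positive elements there are real, so
    real radii suffice. *)
Lemma cvgCP {T : Type} {F : set_system T} {FF : Filter F} (u : T -> C) (l : C) :
  u @ F --> l <-> forall e : R, 0 < e -> \forall x \near F, cabs (l - u x) < e.
Proof.
split=> [/cvgrPdist_lt h e e0|h].
  have e0C : 0 < e%:C by rewrite (ltcR 0 e).
  by near=> x; rewrite -ltcR cabsC; near: x; exact: h.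
apply/cvgrPdist_lt => e e0.
have eE : e = (complex.Re e)%:C by rewrite RRe_real // gtr0_real.
near=> x; rewrite eE -cabsC ltcR; near: x; apply: h.
by rewrite -ltcR -eE.
Unshelve. all: by end_near. Qed.

Lemma cvgC_Re {T : Type} {F : set_system T} {FF : Filter F} (u : T -> C) (l : C) :
  u @ F --> l -> (fun x => complex.Re (u x)) @ F --> complex.Re l.
Proof.
move=> /cvgCP h; apply/cvgrPdist_lt => e e0; near=> x.
rewrite -ReN -ReD (le_lt_trans (ler_Re_cabs _)) //.
by near: x; exact: h.
Unshelve. all: by end_near. Qed.

Lemma cvgC_Im {T : Type} {F : set_system T} {FF : Filter F} (u : T -> C) (l : C) :
  u @ F --> l -> (fun x => complex.Im (u x)) @ F --> complex.Im l.
Proof.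
move=> /cvgCP h; apply/cvgrPdist_lt => e e0; near=> x.
rewrite -ImN -ImD (le_lt_trans (ler_Im_cabs _)) //.
by near: x; exact: h.
Unshelve. all: by end_near. Qed.

Lemma cvgC_ReIm {T : Type} {F : set_system T} {FF : Filter F} (u : T -> C) (l : C) :
  (fun x => complex.Re (u x)) @ F --> complex.Re l ->
  (fun x => complex.Im (u x)) @ F --> complex.Im l -> u @ F --> l.
Proof.
move=> /cvgrPdist_lt hr /cvgrPdist_lt hi; apply/cvgCP => e e0; near=> x.
rewrite (le_lt_trans (ler_cabs_ReIm _)) // ReD ReN ImD ImN.
rewrite [e]splitr ltrD //; near: x; [apply: hr|apply: hi]; exact: divr_gt0.
Unshelve. all: by end_near. Qed.

Lemma cvgC_cabs {T : Type} {F : set_system T} {FF : Filter F} (u : T -> C) (l : C) :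
  u @ F --> l -> (fun x => cabs (u x)) @ F --> cabs l.
Proof.
move=> /cvgCP h; apply/cvgrPdist_lt => e e0; near=> x.
have hx : cabs (l - u x) < e by near: x; exact: h.
rewrite ltr_norml ltrNl opprB !(le_lt_trans _ hx) ?lerB_cabs //.
by rewrite cabsB lerB_cabs.
Unshelve. all: by end_near. Qed.

Lemma cvgC_real {T : Type} {F : set_system T} {FF : Filter F} (u : T -> R) (l : R) :
  u @ F --> l -> (fun x => (u x)%:C) @ F --> l%:C.
Proof.
by move=> h; apply: cvgC_ReIm => //=; exact: cvg_cst.
Qed.

Lemma cvgC0_cabs {T : Type} {F : set_system T} {FF : Filter F}
    (u : T -> C) (v : T -> R) (l : C) :
  (\forall x \near F, cabs (l - u x) <= v x) -> v @ F --> 0 -> u @ F --> l.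
Proof.
move=> h /cvgrPdist_lt hv; apply/cvgCP => e e0; near=> x.
have hx : cabs (l - u x) <= v x by near: x.
apply: (le_lt_trans hx); apply: (le_lt_trans (ler_norm _)).
by rewrite -normrN -sub0r; near: x; exact: hv.
Unshelve. all: by end_near. Qed.

End complex_limits.

(** * Integrals of complex-valued functions *)

Section cmeasurable.
Context {R : realType} d (T : measurableType d) (D : set T).
Local Notation C := R[i].

(** Measurability by real coordinates, so that no sigma-algebra on [R[i]] enters. *)
Definition cmeasurable (F : T -> C) :=
  measurable_fun D (fun x => complex.Re (F x)) /\
  measurable_fun D (fun x => complex.Im (F x)).

Lemma cmeasurable_cst (c : C) : cmeasurable (fun=> c).
Proof. by split; exact: measurable_cst. Qed.

Lemma cmeasurableD (F G : T -> C) :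
  cmeasurable F -> cmeasurable G -> cmeasurable (fun x => F x + G x).
Proof.
move=> [F1 F2] [G1 G2]; split.
- by under eq_fun do rewrite ReD; exact: measurable_funD.
- by under eq_fun do rewrite ImD; exact: measurable_funD.
Qed.

Lemma cmeasurableN (F : T -> C) : cmeasurable F -> cmeasurable (fun x => - F x).
Proof.
move=> [F1 F2]; split.
- by under eq_fun do rewrite ReN; exact: measurable_funN.
- by under eq_fun do rewrite ImN; exact: measurable_funN.
Qed.

Lemma cmeasurableB (F G : T -> C) :
  cmeasurable F -> cmeasurable G -> cmeasurable (fun x => F x - G x).
Proof. by move=> mF mG; apply: cmeasurableD => //; exact: cmeasurableN. Qed.

Lemma cmeasurableM (F G : T -> C) :
  cmeasurable F -> cmeasurable G -> cmeasurable (fun x => F x * G x).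
Proof.
move=> [F1 F2] [G1 G2]; split.
- under eq_fun do rewrite ReM.
  by apply: measurable_funB; exact: measurable_funM.
- under eq_fun do rewrite ImM.
  by apply: measurable_funD; exact: measurable_funM.
Qed.

Lemma cmeasurableX (F : T -> C) n : cmeasurable F -> cmeasurable (fun x => F x ^+ n).
Proof.
move=> mF; elim: n => [|n ih].
  by under eq_fun do rewrite expr0; exact: cmeasurable_cst.
by under eq_fun do rewrite exprS; exact: cmeasurableM.
Qed.

Lemma cmeasurable_real (f : T -> R) :
  measurable_fun D f -> cmeasurable (fun x => (f x)%:C).
Proof. by move=> mf; split => //=; exact: measurable_cst. Qed.

Lemma cmeasurableJ (F : T -> C) : cmeasurable F -> cmeasurable (fun x => (F x)^*).
Proof.
move=> [F1 F2]; split.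
- by apply: eq_measurable_fun F1 => x _; case: (F x).
- by apply: eq_measurable_fun (measurable_funN F2) => x _ /=; case: (F x).
Qed.

Lemma measurable_fun_cabs2 (F : T -> C) : cmeasurable F ->
  measurable_fun D (fun x => cabs (F x) ^+ 2).
Proof.
move=> [F1 F2]; under eq_fun do rewrite cabs_sqr.
by apply: measurable_funD; exact: measurable_funX.
Qed.

Lemma measurable_fun_powR (f : T -> R) p : measurable_fun D f ->
  measurable_fun D (fun x => f x `^ p).
Proof. by move=> mf; exact: measurableT_comp (measurable_powR p) mf. Qed.

Lemma measurable_fun_cabs (F : T -> C) : cmeasurable F ->
  measurable_fun D (fun x => cabs (F x)).
Proof.
move=> mF; apply: eq_measurable_fun (measurable_fun_powR (2^-1) (measurable_fun_cabs2 mF)).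
move=> x _ /=; rewrite -(powR_mulrn 2 (cabs_ge0 _)) -powRrM divff // powRr1 //.
exact: cabs_ge0.
Qed.

(** On nonnegative reals inversion is the power of exponent -1, also at 0, where both values are
    0. *)
Lemma measurable_fun_pinv (f : T -> R) : (forall x, D x -> 0 <= f x) ->
  measurable_fun D f -> measurable_fun D (fun x => (f x)^-1).
Proof.
move=> f0 mf; apply: eq_measurable_fun (measurable_fun_powR (-1) mf).
by move=> x /set_mem Dx /=; rewrite powR_inv1 // f0.
Qed.

Lemma cmeasurableV (F : T -> C) : cmeasurable F -> cmeasurable (fun x => (F x)^-1).
Proof.
move=> mF.
have -> : (fun x => (F x)^-1) = (fun x => ((cabs (F x) ^+ 2)^-1)%:C * (F x)^*).
  by apply/funext => x; rewrite invc_norm fmorphV /= rmorphXn /= cabsC.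
apply: cmeasurableM; last exact: cmeasurableJ.
apply: cmeasurable_real; apply: measurable_fun_pinv => [x _|].
  by rewrite sqr_ge0.
exact: measurable_fun_cabs2.
Qed.

Lemma cmeasurable_sum (F : nat -> T -> C) N : (forall k, cmeasurable (F k)) ->
  cmeasurable (fun x => \sum_(0 <= k < N) F k x).
Proof.
move=> mF; elim: N => [|N ih].
  by under eq_fun do rewrite big_nil; exact: cmeasurable_cst.
by under eq_fun do rewrite big_nat_recr //=; exact: cmeasurableD.
Qed.

End cmeasurable.

Section cintegral.
Context {R : realType} d (T : measurableType d).
Variables (m : {measure set T -> \bar R}) (D : set T).
Hypothesis mD : measurable D.
Local Notation C := R[i].

Definition cintegrable (F : T -> C) :=
  m.-integrable D (EFin \o (fun x => complex.Re (F x))) /\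
  m.-integrable D (EFin \o (fun x => complex.Im (F x))).

Definition cint (F : T -> C) : C :=
  (\int[m]_(x in D) complex.Re (F x)) +i* (\int[m]_(x in D) complex.Im (F x)).

Lemma cintegrable_measurable F : cintegrable F -> cmeasurable D F.
Proof.
by move=> [/integrableP[/measurable_EFinP F1 _] /integrableP[/measurable_EFinP F2 _]].
Qed.

Lemma le_integrableR (f g : T -> R) : measurable_fun D f ->
  (forall x, D x -> `|f x| <= g x) -> m.-integrable D (EFin \o g) ->
  m.-integrable D (EFin \o f).
Proof.
move=> mf fg ig; apply: le_integrable ig => //; first exact/measurable_EFinP.
by move=> x Dx; rewrite /= lee_fin (le_trans (fg x Dx)) // ler_norm.
Qed.

Lemma le_cintegrable (F : T -> C) (g : T -> R) : cmeasurable D F ->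
  (forall x, D x -> cabs (F x) <= g x) -> m.-integrable D (EFin \o g) ->
  cintegrable F.
Proof.
move=> [F1 F2] Fg ig; split; apply: le_integrableR (ig) => // x Dx.
- exact: le_trans (ler_Re_cabs _) (Fg x Dx).
- exact: le_trans (ler_Im_cabs _) (Fg x Dx).
Qed.

Lemma cintegrable_cabs (F : T -> C) : cintegrable F ->
  m.-integrable D (EFin \o (fun x => cabs (F x))).
Proof.
move=> iF; have mF := cintegrable_measurable iF; case: (iF) => i1 i2.
apply: (@le_integrableR _ (fun x => `|complex.Re (F x)| + `|complex.Im (F x)|)).
- exact: measurable_fun_cabs.
- by move=> x Dx; rewrite ger0_norm ?cabs_ge0 // ler_cabs_ReIm.
- by apply: (integrableD mD (f := fun x => `|complex.Re (F x)|%:E)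
      (g := fun x => `|complex.Im (F x)|%:E)); exact: integrable_norm.
Qed.

Lemma eq_cint (F G : T -> C) : (forall x, D x -> F x = G x) -> cint F = cint G.
Proof.
by move=> FG; congr Complex; apply: eq_Rintegral => x /set_mem Dx; rewrite FG.
Qed.

Lemma eq_cintegrable (F G : T -> C) : (forall x, D x -> F x = G x) ->
  cintegrable F -> cintegrable G.
Proof.
move=> FG [h1 h2]; split; [apply: eq_integrable h1|apply: eq_integrable h2] => //;
by move=> x /set_mem Dx; rewrite /= FG.
Qed.

Lemma cintegrableD (F G : T -> C) :
  cintegrable F -> cintegrable G -> cintegrable (fun x => F x + G x).
Proof.
move=> [F1 F2] [G1 G2]; split.
- by have := integrableD mD F1 G1; apply: eq_integrable => // x _ /=; rewrite ReD EFinD.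
- by have := integrableD mD F2 G2; apply: eq_integrable => // x _ /=; rewrite ImD EFinD.
Qed.

Lemma cintD (F G : T -> C) : cintegrable F -> cintegrable G ->
  cint (fun x => F x + G x) = cint F + cint G.
Proof.
move=> [F1 F2] [G1 G2]; apply: complexP; rewrite /cint /=.
- by rewrite -RintegralD //; apply: eq_Rintegral => x _; rewrite ReD.
- by rewrite -RintegralD //; apply: eq_Rintegral => x _; rewrite ImD.
Qed.

Lemma cintegrableZl (c : C) (F : T -> C) :
  cintegrable F -> cintegrable (fun x => c * F x).
Proof.
move=> iF; have mF := cintegrable_measurable iF.
apply: (@le_cintegrable _ (fun x => cabs c * cabs (F x))).
- by apply: cmeasurableM => //; exact: cmeasurable_cst.
- by move=> x _; rewrite cabsM.
- have := integrableZl mD (cabs c) (cintegrable_cabs iF).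
  by apply: eq_integrable => // x _; rewrite /= EFinM.
Qed.

Lemma cintZl (c : C) (F : T -> C) : cintegrable F ->
  cint (fun x => c * F x) = c * cint F.
Proof.
move=> [F1 F2].
have iZ (a : R) (f : T -> R) : m.-integrable D (EFin \o f) ->
    m.-integrable D (EFin \o (fun x => a * f x)).
  by move=> /(integrableZl mD a); apply: eq_integrable => // x _; rewrite /= EFinM.
apply: complexP; rewrite /cint /= ?ReM ?ImM /=; rewrite -!RintegralZl //.
- rewrite -RintegralB //; [|exact: iZ|exact: iZ].
  by apply: eq_Rintegral => x _; rewrite ReM.
- rewrite -RintegralD //; [|exact: iZ|exact: iZ].
  by apply: eq_Rintegral => x _; rewrite ImM.
Qed.

Lemma cintegrableN (F : T -> C) : cintegrable F -> cintegrable (fun x => - F x).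
Proof.
move=> /(cintegrableZl (-1)); apply: eq_cintegrable => x _; exact: mulN1r.
Qed.

Lemma cintegrableB (F G : T -> C) :
  cintegrable F -> cintegrable G -> cintegrable (fun x => F x - G x).
Proof. by move=> iF iG; apply: cintegrableD => //; exact: cintegrableN. Qed.

Lemma cintB (F G : T -> C) : cintegrable F -> cintegrable G ->
  cint (fun x => F x - G x) = cint F - cint G.
Proof.
move=> iF iG; rewrite cintD //; last exact: cintegrableN.
by rewrite -[X in _ - X]mul1r -mulNr -cintZl //; congr (_ + _); apply: eq_cint => x _; rewrite mulN1r.
Qed.

Lemma cintegrable0 : cintegrable (fun=> 0).
Proof. by split; exact: integrable0. Qed.

Lemma cint0 : cint (fun=> 0) = 0.
Proof. by rewrite /cint /= /Rintegral integral0. Qed.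

Lemma cintegrable_sum (F : nat -> T -> C) N : (forall k, cintegrable (F k)) ->
  cintegrable (fun x => \sum_(0 <= k < N) F k x).
Proof.
move=> iF; elim: N => [|N ih].
  by under eq_fun do rewrite big_nil; exact: cintegrable0.
by under eq_fun do rewrite big_nat_recr //=; exact: cintegrableD.
Qed.

Lemma cint_sum (F : nat -> T -> C) N : (forall k, cintegrable (F k)) ->
  cint (fun x => \sum_(0 <= k < N) F k x) = \sum_(0 <= k < N) cint (F k).
Proof.
move=> iF; elim: N => [|N ih].
  by under eq_fun do rewrite big_nil; rewrite cint0 big_nil.
under eq_fun do rewrite big_nat_recr //=.
by rewrite cintD ?big_nat_recr //= ?ih //; exact: cintegrable_sum.
Qed.

Lemma Re_cint (F : T -> C) :
  complex.Re (cint F) = \int[m]_(x in D) complex.Re (F x).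
Proof. by []. Qed.

(** The phase of the integral is a constant that moves inside; the real part of the rotated
    integrand is at most its modulus. *)
Lemma cabs_cint (F : T -> C) : cintegrable F ->
  cabs (cint F) <= \int[m]_(x in D) cabs (F x).
Proof.
move=> iF; have [u u1 uF] := phaseP (cint F).
have -> : cabs (cint F) = complex.Re (cint (fun x => u * F x)).
  by rewrite cintZl // uF.
have [iuF _] := cintegrableZl u iF.
rewrite Re_cint; apply: le_Rintegral => //; first exact: cintegrable_cabs.
move=> x _; rewrite (le_trans (ler_norm _)) // (le_trans (ler_Re_cabs _)) //.
by rewrite cabsM u1 mul1r.
Qed.

Lemma cabs_cint_le (F : T -> C) (g : T -> R) : cmeasurable D F ->
  (forall x, D x -> cabs (F x) <= g x) -> m.-integrable D (EFin \o g) ->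
  cabs (cint F) <= \int[m]_(x in D) g x.
Proof.
move=> mF Fg ig; have iF := le_cintegrable mF Fg ig.
apply: (le_trans (cabs_cint iF)); apply: le_Rintegral => //.
exact: cintegrable_cabs.
Qed.

Lemma cmeasurable_cvg (F_ : nat -> T -> C) (F : T -> C) :
  (forall n, cmeasurable D (F_ n)) ->
  (forall x, D x -> F_ ^~ x @ \oo --> F x) -> cmeasurable D F.
Proof.
move=> mF_ F_F; split.
- apply: (measurable_fun_cvg (h := fun n x => complex.Re (F_ n x))).
    by move=> n; case: (mF_ n).
  by move=> x Dx; apply: cvgC_Re; exact: F_F.
- apply: (measurable_fun_cvg (h := fun n x => complex.Im (F_ n x))).
    by move=> n; case: (mF_ n).
  by move=> x Dx; apply: cvgC_Im; exact: F_F.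
Qed.

Lemma cint_dominated (F_ : nat -> T -> C) (F : T -> C) (g : T -> R) :
  (forall n, cmeasurable D (F_ n)) ->
  (forall x, D x -> F_ ^~ x @ \oo --> F x) ->
  m.-integrable D (EFin \o g) ->
  (forall n x, D x -> cabs (F_ n x) <= g x) ->
  cint (F_ n) @[n --> \oo] --> cint F.
Proof.
move=> mF_ F_F ig F_g; have mF := cmeasurable_cvg mF_ F_F.
have key (p : C -> R) : (forall n, measurable_fun D (fun x => p (F_ n x))) ->
    measurable_fun D (fun x => p (F x)) ->
    (forall x, D x -> p (F_ n x) @[n --> \oo] --> p (F x)) ->
    (forall z, `|p z| <= cabs z) ->
    \int[m]_(x in D) p (F_ n x) @[n --> \oo] --> \int[m]_(x in D) p (F x).
  move=> h1 h2 h3 h4.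
  have [] := @dominated_convergence _ _ _ m D mD
    (fun n x => (p (F_ n x))%:E) (fun x => (p (F x))%:E) (EFin \o g).
  - by move=> n; exact/measurable_EFinP.
  - exact/measurable_EFinP.
  - by apply: aeW => x Dx; apply: cvg_EFin; [exact: nearW|exact: h3].
  - exact: ig.
  - by apply: aeW => x n Dx; rewrite lee_fin (le_trans (h4 _)) // F_g.
  move=> i _ cv; apply: fine_cvg; rewrite fineK //; exact: integrable_fin_num i.
apply: cvgC_ReIm => /=; apply: key.
- by move=> n; case: (mF_ n).
- by case: mF.
- by move=> x Dx; apply: cvgC_Re; exact: F_F.
- exact: ler_Re_cabs.
- by move=> n; case: (mF_ n).
- by case: mF.
- by move=> x Dx; apply: cvgC_Im; exact: F_F.
- exact: ler_Im_cabs.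
Qed.

End cintegral.

(** * Calculus along real curves *)

Section ftc_bounded.
Context {R : realType}.
Local Notation leb := (@lebesgue_measure R).

Lemma is_derive_shiftr (K : R -> R) (x y k : R) :
  is_derive (y + x) 1 K k -> is_derive y 1 (fun t => K (t + x)) k.
Proof.
move=> h; rewrite -[k]mulr1.
exact: (@is_derive1_comp R K (shift x) y k 1 h (is_derive_shift _ _ _)).
Qed.

Lemma is_derive_shiftl (K : R -> R) (x y k : R) :
  is_derive (x + y) 1 K k -> is_derive y 1 (fun t => K (x + t)) k.
Proof.
rewrite addrC => /is_derive_shiftr.
by under [in X in X -> _]eq_fun do rewrite addrC.
Qed.

Lemma continuous_integrable_itv (P : R -> R) a b : continuous P ->
  leb.-integrable `[a, b] (EFin \o P).
Proof.
move=> cP; apply: continuous_compact_integrable; first exact: segment_compact.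
exact: continuous_subspaceT.
Qed.

Lemma is_derive_continuous (f : R -> R) (x d : R) :
  is_derive x 1 f d -> {for x, continuous f}.
Proof.
by move=> h; apply: differentiable_continuous; apply/derivable1_diffP; case: h.
Qed.

(* The derivative is only assumed to be bounded: differentiate
   [int_0^T P (x + t) dt] at [x = 0] in two ways. *)
Lemma FTC2_bounded (P p : R -> R) (T M : R) : 0 < T ->
  (forall t : R, is_derive t 1 P (p t)) -> (forall t, `|p t| <= M) ->
  \int[leb]_(t in `[0, T]) p t = P T - P 0.
Proof.
move=> T0 dP pM.
have cP : continuous P by move=> t; exact: is_derive_continuous (dP t).
(* The base point -1 lies to the left of the interval, so that [K] is differentiable at 0 and at the
   small negative arguments met by [J]. *)
pose K (y : R) : R := \int[leb]_(t in `[-1, y]) P t.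
have dK (y : R) : -1 < y -> is_derive y 1 K (P y).
  move=> y1.
  have yy1 : y < y + 1 by rewrite ltrDl.
  have [h1 h2] := @continuous_FTC1_closed R P (-1) y (y + 1) yy1
    (@continuous_integrable_itv P _ _ cP) y1 (cP y).
  apply: DeriveDef; [exact: h1|by rewrite -derive1E h2].
pose J (x : R) : R := \int[leb]_(t in `[0, T]) P (x + t).
have JE (x : R) : `|x| < 1 / 2 -> J x = K (x + T) - K x.
  move=> x1.
  have dKx (t : R) : 0 <= t -> is_derive t 1 (fun t => K (x + t)) (P (x + t)).
    move=> t0; apply: is_derive_shiftl; apply: dK.
    by move: x1; rewrite ltr_norml => /andP[]; lra.
  have h : (\int[leb]_(t in `[0%R, T]) (P (x + t))%:E = (K (x + T))%:E - (K (x + 0))%:E)%E.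
    apply: (@continuous_FTC2 R (fun t => P (x + t)) (fun t => K (x + t))) => //.
    - apply: continuous_subspaceT => t.
      exact: (is_derive_continuous (is_derive_shiftl (dP (x + t)))).
    - split.
      + by move=> t; rewrite in_itv /= => /andP[t0 _]; case: (dKx t (ltW t0)).
      + exact: cvg_at_right_filter (is_derive_continuous (dKx 0 (lexx 0))).
      + exact: cvg_at_left_filter (is_derive_continuous (dKx T (ltW T0))).
    - move=> t; rewrite in_itv /= => /andP[t0 _].
      by rewrite derive1E; case: (dKx t (ltW t0)).
  by rewrite /J /Rintegral h /= addr0.
have d1 : is_derive (0 : R) 1 (fun x => K (x + T) - K x) (P T - P 0).
  apply: is_deriveB; first by apply: is_derive_shiftr; rewrite add0r; apply: dK; lra.
  by apply: dK; lra.
have cv1 : h^-1 *: (J (h + 0) - J 0) @[h --> (0:R)^'] --> P T - P 0.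
  case: d1 => h1 h2; rewrite -h2.
  apply: cvg_trans h1; apply: near_eq_cvg.
  near=> h; rewrite addr0 !JE ?normr0 ?divr_gt0 //.
    by rewrite add0r /= /GRing.scale /= mulr1 addr0.
  by near: h; apply: dnbhs0_lt; rewrite divr_gt0.
have pE (t y : R) : (partial1of2 (fun x t => P (x + t))) t y = p (t + y).
  rewrite partial1of2E; have [_ <-] := is_derive_shiftr (dP (t + y)).
  by [].
have -> : \int[leb]_(t in `[0, T]) p t =
    \int[leb]_(t in `[0, T]) partial1of2 (fun x t => P (x + t)) 0 t.
  by apply: eq_Rintegral => t _; rewrite pE add0r.
(* Differentiation under the integral needs only the constant majorant [M]: here boundedness of [p]
   replaces its continuity. *)
suff cv2 : h^-1 *: (J (h + 0) - J 0) @[h --> (0:R)^'] -->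
    \int[leb]_(t in `[0, T]) partial1of2 (fun x t => P (x + t)) 0 t.
  exact: cvg_unique cv2 cv1.
apply: (@cvg_differentiation_under_integral R _ _ leb
  (fun x t => P (x + t)) `[0%R, T]%classic (measurable_itv _) 0 (-1) 1 _ _ _ (cst M)).
- by rewrite /= in_itv /= ltrN10 ltr01.
- move=> x _; apply: continuous_integrable_itv => t.
  exact: is_derive_continuous (is_derive_shiftl (dP _)).
- by move=> x y _ _; case: (is_derive_shiftr (dP (x + y))).
- by move=> t; exact: le_trans (normr_ge0 _) (pM 0).
- by apply: continuous_integrable_itv => t; exact: cst_continuous.
- by move=> x y _ _; rewrite pE pM.
Unshelve. all: by end_near. Qed.

End ftc_bounded.

(** * Derivatives of complex-valued functions of a real variable *)

Section curve_derivative.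
Context {R : realType}.
Local Notation C := R[i].
Implicit Types (g : R -> C) (x : R) (d : C).

(** On [R[i]] the derivative [derive] is taken over complex scalars, so the quotient by a real
    increment is written out. *)
Definition rderive g x d :=
  (fun h : R => (h^-1)%:C * (g (h + x) - g x)) @ (0:R)^' --> d.

Lemma is_derive1_cvg (f : R -> R) x (d : R) :
  h^-1 * (f (h + x) - f x) @[h --> (0:R)^'] --> d -> is_derive x 1 f d.
Proof.
move=> cv.
have cv' : h^-1 *: (f (h *: 1 + x) - f x) @[h --> (0:R)^'] --> d.
  by apply: (cvg_near_eq _ cv); near=> h; rewrite /GRing.scale /= mulr1.
apply: DeriveDef; first by apply/cvg_ex; exists d.
exact: cvg_lim cv'.
Unshelve. all: by end_near. Qed.

Lemma is_derive1_cvgP (f : R -> R) x (d : R) : is_derive x 1 f d ->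
  h^-1 * (f (h + x) - f x) @[h --> (0:R)^'] --> d.
Proof.
move=> [h1 h2]; rewrite -h2; apply: (cvg_near_eq _ h1).
by near=> h; rewrite /GRing.scale /= mulr1.
Unshelve. all: by end_near. Qed.

Lemma rderive_Re g x d : rderive g x d ->
  is_derive x 1 (fun t => complex.Re (g t)) (complex.Re d).
Proof.
move=> /cvgC_Re h; apply: is_derive1_cvg; apply: (cvg_near_eq _ h).
by near=> s; rewrite ReZ ReD ReN.
Unshelve. all: by end_near. Qed.

Lemma rderive_Im g x d : rderive g x d ->
  is_derive x 1 (fun t => complex.Im (g t)) (complex.Im d).
Proof.
move=> /cvgC_Im h; apply: is_derive1_cvg; apply: (cvg_near_eq _ h).
by near=> s; rewrite ImZ ImD ImN.
Unshelve. all: by end_near. Qed.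

Lemma rderive_ReIm g x d :
  is_derive x 1 (fun t => complex.Re (g t)) (complex.Re d) ->
  is_derive x 1 (fun t => complex.Im (g t)) (complex.Im d) -> rderive g x d.
Proof.
move=> /is_derive1_cvgP h1 /is_derive1_cvgP h2; apply: cvgC_ReIm.
- by apply: (cvg_near_eq _ h1); near=> h; rewrite ReZ ReD ReN.
- by apply: (cvg_near_eq _ h2); near=> h; rewrite ImZ ImD ImN.
Unshelve. all: by end_near. Qed.

Lemma rderive_cvg g x d : rderive g x d -> g (h + x) @[h --> (0:R)^'] --> g x.
Proof.
move=> gd; have h0 : (h:R)%:C @[h --> (0:R)^'] --> (0:R)%:C.
  by apply: cvgC_real; exact: cvg_within.
have cv : h%:C * ((h^-1)%:C * (g (h + x) - g x)) + g x @[h --> (0:R)^'] --> g x.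
  rewrite -[X in _ --> X]add0r -[X in _ --> X + _](mul0r d).
  by apply: cvgD; [exact: cvgM h0 gd|exact: cvg_cst].
apply: (cvg_near_eq _ cv); near=> h.
have hn0 : h != 0 by near: h; exact: nbhs_dnbhs_neq.
by rewrite /= mulrA -rmorphM /= divff // mul1r subrK.
Unshelve. all: by end_near. Qed.

Lemma rderiveZ (c : C) g x d : rderive g x d -> rderive (fun t => c * g t) x (c * d).
Proof.
move=> h; have cv : c * ((t^-1)%:C * (g (t + x) - g x)) @[t --> (0:R)^'] --> c * d.
  by apply: cvgM; [exact: cvg_cst|exact: h].
apply: (cvg_near_eq _ cv).
by near=> t; rewrite /= -mulrBr mulrCA.
Unshelve. all: by end_near. Qed.

Lemma derivable_cvg (f : C -> C) (z : C) : derivable f z 1 ->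
  h^-1 * (f (h + z) - f z) @[h --> (0:C)^'] --> derive1 f z.
Proof.
move=> h1; apply: (cvg_near_eq (f := fun h => h^-1 *: (f (h *: 1 + z) - f z)));
  last by rewrite derive1E; exact: h1.
near=> h.
by rewrite -[h *: 1]/(h * 1) mulr1.
Unshelve. all: by end_near. Qed.

Lemma cvg_derivable (f : C -> C) (z : C) (d : C) :
  h^-1 * (f (h + z) - f z) @[h --> (0:C)^'] --> d ->
  derivable f z 1 /\ derive1 f z = d.
Proof.
move=> cv.
have cv' : h^-1 *: (f (h *: 1 + z) - f z) @[h --> (0:C)^'] --> d.
  apply: (cvg_near_eq _ cv); near=> h.
  by rewrite -[h *: 1]/(h * 1) mulr1.
split; first by apply/cvg_ex; exists d.
by rewrite derive1E; exact: cvg_lim cv'.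
Unshelve. all: by end_near. Qed.

(** A continuous slope function spares the chain rule a division by [g (h + x) - g x], which may
    vanish for arbitrarily small [h]. *)
Lemma caratheodory (f : C -> C) (z : C) : derivable f z 1 ->
  exists q : C -> C, [/\ forall w : C, f w - f z = q w * (w - z),
    q z = derive1 f z & {for z, continuous q}].
Proof.
move=> /derivable_cvg cv.
exists (fun w => if w == z then derive1 f z else (f w - f z) / (w - z)); split.
- move=> w; have [->|wz] := eqVneq w z; first by rewrite !subrr mulr0.
  by rewrite divfK // subr_eq0.
- by rewrite eqxx.
apply: (@cvgCP R _ (nbhs z) _ _ _).2 => e e0; rewrite eqxx.
have [r r0 hr] : exists2 r : R, 0 < r & forall h : C, h != 0 -> cabs h < r ->
    cabs (derive1 f z - h^-1 * (f (h + z) - f z)) < e.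
  have : \forall h \near nbhs (0 : C), h != 0 ->
      cabs (derive1 f z - h^-1 * (f (h + z) - f z)) < e.
    exact: (cvgCP _ _).1 cv e e0.
  move=> /nbhs_ballP [r /= r0 hr].
  have rE : r = (complex.Re r)%:C by rewrite RRe_real // gtr0_real.
  exists (complex.Re r); first by rewrite -ltcR -rE.
  move=> h h0 hlt; apply: hr => //=.
  by rewrite /ball /= sub0r normrN rE -cabsC ltcR.
have h : \forall w \near nbhs z, cabs (z - w) < r.
  by apply: ((@cvgCP R C (nbhs z) (nbhs_filter z) (fun w => w) z).1 _ r r0); exact: cvg_id.
apply: (@filterS C (nbhs z) (nbhs_filter z) _ _ _ h) => w /=; rewrite cabsB => wz.
have [wz0|wnz] := eqVneq w z; first by rewrite subrr cabs0.
have := hr (w - z); rewrite subr_eq0 subrK => /(_ wnz wz).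
by rewrite mulrC.
Qed.

Lemma rderive_comp (f : C -> C) g x d : derivable f (g x) 1 -> rderive g x d ->
  rderive (fun t => f (g t)) x (derive1 f (g x) * d).
Proof.
move=> /caratheodory [q [fq <- cq]] gd.
have cqg : q (g (h + x)) @[h --> (0:R)^'] --> q (g x).
  exact: (cvg_comp _ _ (rderive_cvg gd) cq).
have cv : q (g (h + x)) * ((h^-1)%:C * (g (h + x) - g x)) @[h --> (0:R)^'] -->
    q (g x) * d.
  by apply: cvgM; [exact: cqg|exact: gd].
apply: (cvg_near_eq _ cv).
by near=> h; rewrite /= fq mulrCA.
Unshelve. all: by end_near. Qed.

Lemma rderive_affine (w v : C) x : rderive (fun s => w + s%:C * v) x v.
Proof.
apply: (cvg_near_eq _ (cvg_cst v)); near=> h.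
have hn0 : h != 0 by near: h; exact: nbhs_dnbhs_neq.
rewrite opprD addrACA subrr add0r -mulrBl -rmorphB /= addrK mulrA -rmorphM /=.
by rewrite mulVf // mul1r.
Unshelve. all: by end_near. Qed.

Definition cis (t : R) : C := cos t +i* sin t.

Lemma circle_pointE r t : circle_point r t = r%:C * cis t.
Proof. by rewrite /circle_point /cis; apply: complexP; rewrite ?ReZ ?ImZ. Qed.

Lemma cabs_cis t : cabs (cis t) = 1.
Proof. by rewrite cabsE /= cos2Dsin2 sqrtr1. Qed.

Lemma cisD s t : cis (s + t) = cis s * cis t.
Proof. by apply: complexP; rewrite ?ReM ?ImM /= ?cosD ?sinD // addrC. Qed.

Lemma cis0 : cis 0 = 1.
Proof. by rewrite /cis cos0 sin0. Qed.

Lemma cis2pi : cis (2 * pi) = 1.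
Proof. by rewrite /cis [2 * pi]mulrC mulr_natr cos2pi sin2pi. Qed.

Lemma cis_mulJ t : cis t * (cis t)^* = 1.
Proof. by rewrite -cabs_sqrC cabs_cis expr1n. Qed.

Lemma cisX t n : cis t ^+ n = cis (n%:R * t).
Proof.
elim: n => [|n ih]; first by rewrite expr0 mul0r cis0.
by rewrite exprS ih -cisD -addn1 natrD mulrDl mul1r addrC.
Qed.

Lemma rderive_cis t : rderive cis t ('i * cis t).
Proof.
apply: rderive_ReIm; rewrite ?ReM ?ImM /= ?mul0r ?mul1r ?add0r ?sub0r.
- exact: is_derive_cos.
- exact: is_derive_sin.
Qed.

End curve_derivative.

Arguments rderiveZ {R} c {g x d}.
Arguments rderive_affine {R} w v x.
Arguments rderive_cis {R} t.

Section cint_derivative.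
Context {R : realType} d (T : measurableType d).
Variables (m : {measure set T -> \bar R}) (D : set T).
Hypothesis mD : measurable D.
Local Notation C := R[i].

Lemma rderive_cint (f f' : R -> T -> C) (u v a : R) (G : T -> R) :
  u < a < v ->
  (forall x, u < x < v -> cintegrable m D (f x)) ->
  (forall x y, u < x < v -> D y -> rderive (f^~ y) x (f' x y)) ->
  (forall y, 0 <= G y) -> m.-integrable D (EFin \o G) ->
  (forall x y, u < x < v -> D y -> cabs (f' x y) <= G y) ->
  rderive (fun x => cint m D (f x)) a (cint m D (f' a)).
Proof.
move=> auv fi df G0 iG f'G.
have key (p : C -> R) :
    (forall x, u < x < v -> m.-integrable D (EFin \o (fun y => p (f x y)))) ->
    (forall x y, u < x < v -> D y ->
      is_derive x 1 (fun x => p (f x y)) (p (f' x y))) ->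
    (forall z, `|p z| <= cabs z) ->
    is_derive a 1 (fun x => \int[m]_(y in D) p (f x y)) (\int[m]_(y in D) p (f' a y)).
  move=> h1 h2 h3; apply: is_derive1_cvg.
  have pE x y : u < x < v -> D y ->
      partial1of2 (fun x y => p (f x y)) x y = p (f' x y).
    by move=> xuv Dy; rewrite partial1of2E; have [_ <-] := h2 x y xuv Dy.
  have -> : \int[m]_(y in D) p (f' a y) =
      \int[m]_(y in D) partial1of2 (fun x y => p (f x y)) a y.
    by apply: eq_Rintegral => y /set_mem Dy; rewrite pE.
  apply: (@cvg_differentiation_under_integral R _ _ m
    (fun x y => p (f x y)) D mD a u v _ _ _ G) => //.
  - by move=> x y; rewrite /= in_itv /= => xuv Dy; case: (h2 x y xuv Dy).
  - move=> x y; rewrite /= in_itv /= => xuv Dy.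
    by rewrite pE // (le_trans (h3 _)) // f'G.
apply: rderive_ReIm; apply: key.
- by move=> x /fi[].
- by move=> x y xuv Dy; apply: rderive_Re; exact: df.
- exact: ler_Re_cabs.
- by move=> x /fi[].
- by move=> x y xuv Dy; apply: rderive_Im; exact: df.
- exact: ler_Im_cabs.
Qed.

End cint_derivative.

(** * Means over circles *)

Section complex_geometric.
Context {R : realType}.
Local Notation C := R[i].

Lemma geometric_sum (w : C) n : w != 1 ->
  \sum_(0 <= k < n) w ^+ k = (1 - w ^+ n) / (1 - w).
Proof.
move=> w1; have w1' : 1 - w != 0 by rewrite subr_eq0 eq_sym.
apply: (mulIf w1'); rewrite divfK // mulrC.
by rewrite -[in RHS](expr1n _ n) subrXX big_mkord; congr (_ * _); apply: eq_bigr => i _; rewrite expr1n mul1r.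
Qed.

Lemma sub1_neq1 (w : C) : cabs w < 1 -> w != 1.
Proof. by apply: contraTneq => ->; rewrite cabs1 ltxx. Qed.

Lemma cvg_geometric (w : C) : cabs w < 1 ->
  \sum_(0 <= k < n) w ^+ k @[n --> \oo] --> (1 - w)^-1.
Proof.
move=> w1.
apply: (cvgC0_cabs (v := fun n => cabs w ^+ n * (cabs (1 - w))^-1)).
  near=> n; rewrite geometric_sum ?sub1_neq1 // mulrBl mul1r opprB addrC subrK.
  by rewrite cabsM cabsV cabsX.
rewrite -(mul0r (cabs (1 - w))^-1); apply: cvgM; last exact: cvg_cst.
by apply: cvg_expr; rewrite ger0_norm ?cabs_ge0.
Unshelve. all: by end_near. Qed.

Lemma cabs_sum_geometric (w : C) n : cabs w < 1 ->
  cabs (\sum_(0 <= k < n) w ^+ k) <= (1 - cabs w)^-1.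
Proof.
move=> w1; have h : 0 < 1 - cabs w by rewrite subr_gt0.
apply: (le_trans (ler_cabs_sum _ _ _)).
under eq_bigr do rewrite cabsX.
rewrite -[leRHS]mul1r ler_pdivlMr //.
suff -> : (\sum_(0 <= k < n) cabs w ^+ k) * (1 - cabs w) = 1 - cabs w ^+ n.
  by rewrite lerBlDr lerDl exprn_ge0 // cabs_ge0.
elim: n => [|n ih]; first by rewrite big_nil mul0r expr0 subrr.
by rewrite big_nat_recr //= mulrDl ih exprS; ring.
Qed.

End complex_geometric.

Section circle_mean.
Context {R : realType}.
Local Notation C := R[i].
Local Notation leb := (@lebesgue_measure R).
Implicit Types (u : R -> C) (t : R).

Definition arc : set (measurableTypeR R) := `[0, 2 * pi].

Lemma measurable_arc : measurable arc.
Proof. exact: measurable_itv. Qed.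

Lemma twopi_gt0 : 0 < 2 * pi :> R.
Proof. by rewrite mulr_gt0 ?pi_gt0. Qed.

Lemma leb_arc : leb arc = (2 * pi)%:E.
Proof. by rewrite /arc lebesgue_measure_itv /= lte_fin twopi_gt0 sube0. Qed.

Definition cmean u : C := ((2 * pi)^-1)%:C * cint leb arc u.
Definition rmean (v : R -> R) : R := (2 * pi)^-1 * \int[leb]_(t in arc) v t.

Lemma rderive_continuous u t d : rderive u t d -> {for t, continuous u}.
Proof.
move=> h; apply: (@cvgC_ReIm R R (nbhs t) (nbhs_filter t)).
- exact: (is_derive_continuous (rderive_Re h)).
- exact: (is_derive_continuous (rderive_Im h)).
Qed.

Lemma ccontinuous_Re u : continuous u -> continuous (fun t => complex.Re (u t)).
Proof. by move=> cu t; apply: (@cvgC_Re R R (nbhs t) (nbhs_filter t)); exact: cu. Qed.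

Lemma ccontinuous_Im u : continuous u -> continuous (fun t => complex.Im (u t)).
Proof. by move=> cu t; apply: (@cvgC_Im R R (nbhs t) (nbhs_filter t)); exact: cu. Qed.

Lemma ccontinuous_measurable u (D : set (measurableTypeR R)) : measurable D -> continuous u ->
  cmeasurable D u.
Proof.
move=> mD cu; split; apply: measurable_funTS; apply: continuous_measurable_fun.
- exact: ccontinuous_Re.
- exact: ccontinuous_Im.
Qed.

Lemma ccontinuous_cintegrable u : continuous u -> cintegrable leb arc u.
Proof.
move=> cu; split; apply: continuous_integrable_itv.
- exact: ccontinuous_Re.
- exact: ccontinuous_Im.
Qed.

Lemma integrable_arc_cst (M : R) : leb.-integrable arc (EFin \o cst M).
Proof. by apply: continuous_integrable_itv => t; exact: cst_continuous. Qed.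

Lemma integrable_arc_bounded (v : R -> R) (M : R) : measurable_fun arc v ->
  (forall t, `|v t| <= M) -> leb.-integrable arc (EFin \o v).
Proof.
move=> mv vM; apply: (le_integrableR measurable_arc mv _ (integrable_arc_cst M)).
by move=> t _; exact: vM.
Qed.

Lemma cintegrable_arc_bounded u (M : R) : cmeasurable arc u ->
  (forall t, cabs (u t) <= M) -> cintegrable leb arc u.
Proof.
move=> mu uM; apply: (le_cintegrable measurable_arc mu _ (integrable_arc_cst M)).
by move=> t _; exact: uM.
Qed.

Lemma rmean_cst (M : R) : rmean (cst M) = M.
Proof.
rewrite /rmean Rintegral_cst; last exact: measurable_arc.
rewrite (_ : fine _ = 2 * pi); last exact: (congr1 fine leb_arc).
by rewrite mulrCA mulVf ?mulr1 // gt_eqF // twopi_gt0.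
Qed.

Lemma rmean_le (v1 v2 : R -> R) : leb.-integrable arc (EFin \o v1) ->
  leb.-integrable arc (EFin \o v2) -> (forall t, v1 t <= v2 t) ->
  rmean v1 <= rmean v2.
Proof.
move=> i1 i2 h; rewrite /rmean ler_pM2l ?invr_gt0 ?twopi_gt0 //.
by apply: le_Rintegral => //; exact: measurable_arc.
Qed.

Lemma cabs_cmean u : cintegrable leb arc u ->
  cabs (cmean u) <= rmean (fun t => cabs (u t)).
Proof.
move=> iu; rewrite /cmean cabsM cabs_real ger0_norm ?invr_ge0 ?(ltW twopi_gt0) //.
by rewrite ler_pM2l ?invr_gt0 ?twopi_gt0 // cabs_cint //; exact: measurable_arc.
Qed.

Lemma cmean_cst (c : C) : cmean (fun=> c) = c.
Proof.
rewrite /cmean; apply: complexP; rewrite ?ReZ ?ImZ /cint /=.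
- exact: rmean_cst.
- exact: rmean_cst.
Qed.

(** Boundedness of [q] is enough, by [FTC2_bounded]; this is all that is known of a complex
    derivative along a circle. *)
Lemma cint_periodic (Q q : R -> C) (M : R) : (forall t, rderive Q t (q t)) ->
  (forall t, cabs (q t) <= M) -> Q (2 * pi) = Q 0 -> cint leb arc q = 0.
Proof.
move=> dQ qM Q0; apply: complexP; rewrite /cint /=.
- apply: etrans (@FTC2_bounded R _ _ _ M twopi_gt0 (fun t => rderive_Re (dQ t)) _) _.
  + by move=> t; exact: le_trans (ler_Re_cabs _) (qM t).
  + by rewrite Q0 subrr.
- apply: etrans (@FTC2_bounded R _ _ _ M twopi_gt0 (fun t => rderive_Im (dQ t)) _) _.
  + by move=> t; exact: le_trans (ler_Im_cabs _) (qM t).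
  + by rewrite Q0 subrr.
Qed.

Lemma rderive_cisM (k t : R) :
  rderive (fun t => cis (k * t)) t (k%:C * ('i * cis (k * t))).
Proof.
have dk : is_derive t 1 (fun t : R => k * t) k.
  apply: is_derive1_cvg; apply: (cvg_near_eq _ (cvg_cst k)); near=> h.
  have h0 : h != 0 by near: h; exact: nbhs_dnbhs_neq.
  by rewrite -mulrBr addrK mulrCA mulVf ?mulr1.
apply: rderive_ReIm; rewrite ?ReZ ?ImZ ?ReM ?ImM /= ?mul0r ?mul1r ?add0r ?sub0r.
- by rewrite mulrC; apply: (@is_derive1_comp R cos); exact: is_derive_cos.
- by rewrite mulrC; apply: (@is_derive1_comp R sin); exact: is_derive_sin.
Unshelve. all: by end_near. Qed.

Lemma cis_continuous : continuous (@cis R).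
Proof. by move=> t; exact: rderive_continuous (rderive_cis t). Qed.

Lemma cisN t : cis (- t) = (cis t)^*.
Proof. by rewrite /cis cosN sinN. Qed.

Lemma cisM_continuous (k : R) : continuous (fun t => cis (k * t)).
Proof. by move=> t; exact: rderive_continuous (@rderive_cisM k t). Qed.

Lemma i_neq0 : 'i != 0 :> C.
Proof. by rewrite -cabs_eq0 cabsE /= expr0n expr1n add0r sqrtr1 oner_eq0. Qed.

Lemma cint_cisM (k : R) : k != 0 -> cis (k * (2 * pi)) = 1 ->
  cint leb arc (fun t => cis (k * t)) = 0.
Proof.
move=> k0 k1; have ki : k%:C * 'i != 0.
  by rewrite mulf_neq0 ?i_neq0 // (inj_eq (@complexI R) _ 0).
apply: (@cint_periodic (fun t => (k%:C * 'i)^-1 * cis (k * t)) _ 1).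
- move=> t; have E : cis (k * t) = (k%:C * 'i)^-1 * (k%:C * ('i * cis (k * t))).
    by rewrite [k%:C * ('i * _)]mulrA mulKf.
  by rewrite [X in rderive _ _ X]E; exact: (rderiveZ _ (@rderive_cisM k t)).
- by move=> t; rewrite cabs_cis.
- by rewrite k1 mulr0 cis0.
Qed.

Lemma cis_nat2pi n : cis (n%:R * (2 * pi)) = 1 :> C.
Proof. by rewrite -cisX cis2pi expr1n. Qed.

Lemma cmean_cisX n : cmean (fun t => cis t ^+ n) = (n == 0)%:R.
Proof.
have [->|n0] := eqVneq n 0%N.
  by under eq_fun do rewrite expr0; rewrite cmean_cst.
under eq_fun do rewrite cisX.
rewrite /cmean cint_cisM ?mulr0 //; last exact: cis_nat2pi.
by rewrite pnatr_eq0.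
Qed.

Lemma cmean_cisJX n : cmean (fun t => (cis t)^* ^+ n) = (n == 0)%:R.
Proof.
have [->|n0] := eqVneq n 0%N.
  by under eq_fun do rewrite expr0; rewrite cmean_cst.
have E t : (cis t)^* ^+ n = cis (- n%:R * t).
  by rewrite mulNr cisN -cisX rmorphXn.
under eq_fun do rewrite E.
rewrite /cmean cint_cisM ?mulr0 //; first by rewrite oppr_eq0 pnatr_eq0.
by rewrite mulNr cisN cis_nat2pi rmorph1.
Qed.

(** The Cauchy kernel on a circle is a geometric series of ratio [q] times e^(-i t), with partial
    sums bounded by 1 / (1 - |q|); integrating term by term produces a power series in [q] whose
    coefficients are Fourier coefficients of [u]. *)
Lemma cmean_geometric u (q : C) (M : R) : cabs q < 1 -> cmeasurable arc u ->
  (forall t, cabs (u t) <= M) ->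
  \sum_(0 <= k < n) q ^+ k * cmean (fun t => u t * (cis t)^* ^+ k) @[n --> \oo]
  --> cmean (fun t => u t / (1 - q * (cis t)^*)).
Proof.
move=> q1 mu uM.
have mcis k : cmeasurable arc (fun t => (cis t)^* ^+ k : C).
  apply: cmeasurableX; apply: cmeasurableJ; apply: ccontinuous_measurable.
    exact: measurable_arc.
  exact: cis_continuous.
have cabsq t : cabs (q * (cis t)^*) = cabs q by rewrite cabsM cabsJ cabs_cis mulr1.
have iu k : cintegrable leb arc (fun t => q ^+ k * (u t * (cis t)^* ^+ k)).
  apply: cintegrableZl; first exact: measurable_arc.
  apply: (@cintegrable_arc_bounded _ M); first exact: cmeasurableM.
  by move=> t; rewrite cabsM cabsX cabsJ cabs_cis expr1n mulr1.
have E n : \sum_(0 <= k < n) q ^+ k * cmean (fun t => u t * (cis t)^* ^+ k) =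
    cmean (fun t => u t * \sum_(0 <= k < n) (q * (cis t)^*) ^+ k).
  rewrite /cmean.
  under [in RHS]eq_fun do rewrite mulr_sumr.
  under [in RHS]eq_fun do (under eq_bigr do rewrite exprMn mulrCA).
  rewrite cint_sum //; last exact: measurable_arc.
  rewrite mulr_sumr; apply: eq_bigr => k _.
  rewrite mulrCA cintZl //; first exact: measurable_arc.
  apply: (@cintegrable_arc_bounded _ M); first exact: cmeasurableM.
  by move=> t; rewrite cabsM cabsX cabsJ cabs_cis expr1n mulr1.
under eq_fun do rewrite E.
apply: cvgM; first exact: cvg_cst.
apply: (@cint_dominated _ _ _ _ _ measurable_arc _ _ (cst (M * (1 - cabs q)^-1))).
- move=> n; apply: cmeasurableM => //; apply: cmeasurable_sum => k.
  by apply: cmeasurableX; apply: cmeasurableM; [exact: cmeasurable_cst|exact: mcis 1%N].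
- move=> t _; apply: cvgM; first exact: cvg_cst.
  by apply: cvg_geometric; rewrite cabsq.
- exact: integrable_arc_cst.
- move=> n t _; rewrite cabsM ler_pM ?cabs_ge0 //.
  by rewrite -(cabsq t) cabs_sum_geometric // cabsq.
Qed.

(** In the geometric expansion only the constant mode has a nonzero mean. *)
Lemma cmean_cauchy_kernel (q : C) : cabs q < 1 ->
  cmean (fun t => 1 / (1 - q * (cis t)^*)) = 1.
Proof.
move=> q1; have cv := @cmean_geometric (fun=> 1) q 1 q1
  (cmeasurable_cst _ _) (fun=> eq_ind_r (fun x => x <= 1) (lexx 1) cabs1).
suff cv2 : \sum_(0 <= k < n) q ^+ k * cmean (fun t => 1 * (cis t)^* ^+ k)
    @[n --> \oo] --> (1 : C) by exact: cvg_unique cv cv2.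
apply: cvg_near_cst; near=> n.
have n0 : (0 < n)%N by near: n; exact: nbhs_infty_gt.
rewrite -(prednK n0) big_nat_recl // big1 ?addr0 => [|k _].
  by rewrite expr0 mul1r; under eq_fun do rewrite mul1r; rewrite (cmean_cisJX 0).
by under eq_fun do rewrite mul1r; rewrite cmean_cisJX mulr0.
Unshelve. all: by end_near. Qed.

(** The Poisson kernel (1 - |w|^2) / |1 - w|^2 is the real part of (1 + w) / (1 - w) = 2 / (1 - w) -
    1. *)
Lemma poisson_kernelE (w : C) : cabs w < 1 ->
  (cabs (1 - w) ^+ 2)^-1 = (2 * complex.Re (1 / (1 - w)) - 1) / (1 - cabs w ^+ 2).
Proof.
move=> w1; have w2 : 1 - cabs w ^+ 2 != 0.
  by rewrite gt_eqF // subr_gt0 exprn_ilt1 // cabs_ge0.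
have w3 : cabs (1 - w) ^+ 2 != 0.
  by rewrite expf_neq0 // cabs_eq0 cabs_lt1_sub1_neq0.
have E : `|1 - w| ^- 2 = ((cabs (1 - w) ^+ 2)^-1)%:C.
  by rewrite fmorphV /= rmorphXn /= cabsC.
rewrite mul1r invc_norm E.
rewrite ReZ; move: w2 w3; rewrite !cabs_sqr; case: w w1 E => a b _ _ /= w2 w3.
rewrite ?oppr0 ?sub0r ?add0r ?sqrrN; move: w3; rewrite ?oppr0 ?sub0r ?add0r ?sqrrN => w3.
by field; rewrite w2.
Qed.

End circle_mean.

(** * Cauchy's formula and power series *)

Section cauchy.
Context {R : realType}.
Local Notation C := R[i].
Local Notation leb := (@lebesgue_measure R).

Lemma Re_cmean (u : R -> C) : complex.Re (cmean u) = rmean (fun t => complex.Re (u t)).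
Proof. by rewrite /cmean ReZ. Qed.

Lemma cisJ_continuous : continuous (fun t : R => (cis t)^*).
Proof.
have -> : (fun t : R => (cis t)^*) = (fun t => cis (-1 * t)).
  by apply/funext => t; rewrite mulN1r cisN.
exact: cisM_continuous.
Qed.

Lemma cauchy_kernel_continuous (q : C) : cabs q < 1 ->
  continuous (fun t : R => (1 - q * (cis t)^*)^-1).
Proof.
move=> q1 t.
have qt : cabs (q * (cis t)^*) < 1 by rewrite cabsM cabsJ cabs_cis mulr1.
apply: cvgV; first exact: cabs_lt1_sub1_neq0.
apply: cvgB; first exact: cvg_cst.
apply: cvgM; first exact: cvg_cst.
exact: cisJ_continuous.
Qed.

(** The inverse square is a multiple of the real part of an affine function of the Cauchy kernel,
    whose mean is 1; this replaces Parseval's identity for the kernel. *)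
Lemma rmean_poisson (q : C) : cabs q < 1 ->
  rmean (fun t => (cabs (1 - q * (cis t)^*) ^+ 2)^-1) = (1 - cabs q ^+ 2)^-1.
Proof.
move=> q1; have qt t : cabs (q * (cis t)^*) = cabs q.
  by rewrite cabsM cabsJ cabs_cis mulr1.
pose p := (1 - cabs q ^+ 2)^-1.
have iK : cintegrable leb arc (fun t => (1 - q * (cis t)^*)^-1).
  by apply: ccontinuous_cintegrable; exact: cauchy_kernel_continuous.
have E t : (cabs (1 - q * (cis t)^*) ^+ 2)^-1 =
    complex.Re (p%:C * (2%:C * (1 - q * (cis t)^*)^-1 - 1)).
  by rewrite poisson_kernelE ?qt // [RHS]ReZ ReD ReN [in RHS]ReZ mulrC mul1r.
under eq_fun do rewrite E.
have mA := @measurable_arc R.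
have i1 : cintegrable leb arc (fun=> 1 : C).
  by apply: ccontinuous_cintegrable => t; exact: cst_continuous.
rewrite -Re_cmean /cmean cintZl //; last first.
  by apply: cintegrableB => //; exact: cintegrableZl.
rewrite cintB //; last exact: cintegrableZl.
rewrite cintZl // mulrCA mulrBr [_ * (2%:C * _)]mulrCA.
have := cmean_cauchy_kernel q1; under eq_fun do rewrite mul1r.
rewrite /cmean => ->; have := @cmean_cst R 1; rewrite /cmean => ->.
rewrite mulr1 ReZ /=; rewrite -[RHS]mulr1; congr (_ * _).
by rewrite addrK.
Qed.

Lemma rmean_poisson_cis (q : C) : cabs q < 1 ->
  rmean (fun t => (cabs (1 - q * cis t) ^+ 2)^-1) = (1 - cabs q ^+ 2)^-1.
Proof.
move=> q1; rewrite -(cabsJ q) -rmean_poisson ?cabsJ //.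
congr rmean; apply/funext => t; congr ((_ ^+ 2)^-1).
by rewrite -[LHS]cabsJ rmorphB rmorph1 rmorphM.
Qed.

(** Derivatives at the end points serve only for continuity. Vanishing is asked inside the interval
    because [cauchy_formula] divides by [s]. *)
Lemma rderive0_cst (P : R -> C) :
  (forall s, 0 <= s <= 1 -> exists d, rderive P s d) ->
  (forall s, 0 < s < 1 -> rderive P s 0) -> P 1 = P 0.
Proof.
move=> h1 h2.
have key (p : R -> R) : (forall s : R, 0 <= s <= 1 -> exists d, is_derive s 1 p d) ->
    (forall s : R, 0 < s < 1 -> is_derive s 1 p 0) -> p 1 = p 0.
  move=> k1 k2.
  have d1 (s : R) : s \in `]0, 1[ -> derivable p s 1.
    by rewrite in_itv /= => hs; case: (k2 s hs).
  have cp : {within `[0, 1], continuous p}.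
    apply: derivable_within_continuous => s; rewrite in_itv /= => hs.
    by have [d []] := k1 s hs.
  have d0 (s : R) : s \in `]0, 1[ -> derive1 p s = 0.
    by rewrite in_itv /= => hs; rewrite derive1E; case: (k2 s hs).
  apply/eqP; rewrite eq_le; apply/andP; split.
  - have d0' s : s \in `]0, 1[ -> derive1 p s <= 0 by move=> /d0 ->.
    exact: (ler0_derive1_nincr d1 d0' cp (lexx 0) ler01 (lexx 1)).
  - have d0' s : s \in `]0, 1[ -> 0 <= derive1 p s by move=> /d0 ->.
    exact: (ger0_derive1_ndecr d1 d0' cp (lexx 0) ler01 (lexx 1)).
apply: complexP.
- apply: (key (fun s => complex.Re (P s))) => s hs; last exact: (rderive_Re (h2 s hs)).
  by have [d hd] := h1 s hs; exists (complex.Re d); exact: rderive_Re hd.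
- apply: (key (fun s => complex.Im (P s))) => s hs; last exact: (rderive_Im (h2 s hs)).
  by have [d hd] := h1 s hs; exists (complex.Im d); exact: rderive_Im hd.
Qed.

(** The substitute for continuity of the derivative: it holds for functions of finite Bloch norm and
    for Cauchy integrals. *)
Definition locally_bounded_derivative (f : C -> C) :=
  forall r : R, r < 1 -> exists M, forall z, cabs z <= r -> cabs (derive1 f z) <= M.

Lemma circle_in_disc (r t : R) : 0 <= r < 1 -> udisc (r%:C * cis t).
Proof.
by move=> /andP[r0 r1]; rewrite /udisc /= cabsM cabs_cis cabs_real mulr1 ger0_norm.
Qed.

(* [s |-> cmean (f (w + s (rho e^{it} - w)) / (1 - (w / rho) e^{-it}))] is constant:
   its derivative is the integral of a [t]-derivative of a periodic function. *)
Lemma cauchy_formula (f : C -> C) (w : C) (rho : R) :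
  analytic f -> locally_bounded_derivative f -> rho < 1 -> cabs w < rho ->
  cmean (fun t => f (rho%:C * cis t) / (1 - w / rho%:C * (cis t)^*)) = f w.
Proof.
move=> af bf rho1 wrho; have rho0 : 0 < rho := le_lt_trans (cabs_ge0 w) wrho.
have rhoC0 : rho%:C != 0 by rewrite (inj_eq (@complexI R) _ 0) gt_eqF.
pose q := w / rho%:C.
have q1 : cabs q < 1.
  by rewrite cabsM cabsV cabs_real gtr0_norm // ltr_pdivrMr // mul1r.
pose K (t : R) : C := (1 - q * (cis t)^*)^-1.
have K0 t : 1 - q * (cis t)^* != 0.
  by apply: cabs_lt1_sub1_neq0; rewrite cabsM cabsJ cabs_cis mulr1.
(* The [s]-derivative of the moving point cancels the kernel. What remains of the derivative of [F]
   in [s] is, up to the factor [s%:C * 'i], the [t]-derivative of [f (z s t)]. *)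
have KE t : K t * (rho%:C * cis t - w) = rho%:C * cis t.
  apply: (mulfI (K0 t)); rewrite mulrA mulfV // mul1r mulrBl mul1r.
  congr (_ - _); rewrite mulrACA /q divfK // [_^* * _]mulrC cis_mulJ mulr1 //.
pose z (s t : R) : C := w + s%:C * (rho%:C * cis t - w).
(* Room beyond [0, 1] for two-sided derivatives at the end points; with the divisor 4 the points
   [z s t] stay in the disc of radius rho + 2 eta = (1 + rho) / 2. *)
pose eta := (1 - rho) / 4; have eta0 : 0 < eta by rewrite divr_gt0 // subr_gt0.
have zle (s t : R) : - eta < s < 1 + eta -> cabs (z s t) <= (1 + rho) / 2.
  move=> /andP[s1 s2].
  have -> : z s t = (1 - s)%:C * w + (s * rho)%:C * cis t.
    by rewrite /z rmorphB rmorph1 rmorphM /=; ring.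
  rewrite (le_trans (ler_cabsD _ _)) // !cabsM !cabs_real cabs_cis mulr1 normrM.
  rewrite (gtr0_norm rho0).
  have h1 : `|1 - s| * cabs w <= `|1 - s| * rho by rewrite ler_wpM2l // ltW.
  have h2 : `|1 - s| + `|s| <= 1 + 2 * eta.
    by case: (ger0P s) => ?; case: (ger0P (1 - s)) => ?; lra.
  have h3 : (`|1 - s| + `|s|) * rho <= (1 + 2 * eta) * rho := ler_wpM2r (ltW rho0) h2.
  have h4 : 2 * eta * rho <= 2 * eta by nra.
  by move: h1 h3 h4; rewrite /eta mulrDl; lra.
have half1 : (1 + rho) / 2 < 1 by lra.
have zd (s t : R) : - eta < s < 1 + eta -> udisc (z s t).
  by move=> /(zle s t) h; exact: le_lt_trans h half1.
have [M hM] := bf _ half1.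
have M0 : 0 <= M.
  by apply: le_trans (cabs_ge0 (derive1 f 0)) (hM 0 _); rewrite cabs0; lra.
have zt s t : rderive (z s) t (s%:C * rho%:C * ('i * cis t)).
  have h := rderiveZ (s%:C * rho%:C) (rderive_cis t).
  apply: (cvg_near_eq _ h); near=> x.
  by congr (_ * _); rewrite /z; ring.
have zs s t : rderive (z^~ t) s (rho%:C * cis t - w) by exact: rderive_affine.
pose F (s t : R) : C := K t * f (z s t).
pose F' (s t : R) : C := derive1 f (z s t) * (rho%:C * cis t).
have dF s t : - eta < s < 1 + eta -> rderive (F^~ t) s (F' s t).
  move=> hs; have h := rderiveZ (K t) (@rderive_comp R f (z^~ t) s _ (af _ (zd s t hs)) (zs s t)).
  by rewrite /F' -(KE t) mulrCA.
have F'M s t : - eta < s < 1 + eta -> cabs (F' s t) <= M.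
  move=> hs; rewrite /F' !cabsM cabs_cis cabs_real mulr1 gtr0_norm //.
  by rewrite -[leRHS]mulr1 ler_pM ?cabs_ge0 ?(ltW rho0) ?(ltW rho1) // hM // zle.
have iF s : - eta < s < 1 + eta -> cintegrable leb arc (F s).
  move=> hs; apply: ccontinuous_cintegrable => t.
  apply: cvgM; first exact: cauchy_kernel_continuous.
  exact: (rderive_continuous (@rderive_comp R f (z s) t _ (af _ (zd s t hs)) (zt s t))).
have mA := @measurable_arc R.
have dPhi s : - eta < s < 1 + eta ->
    rderive (fun s => cint leb arc (F s)) s (cint leb arc (F' s)).
  move=> hs; apply: (rderive_cint mA (G := cst M) hs) => //.
  - by move=> x t hx _; exact: dF.
  - exact: integrable_arc_cst.
  - by move=> x t hx _; exact: F'M.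
have dPhi0 s : 0 < s < 1 -> cint leb arc (F' s) = 0.
  move=> /andP[s0 s1]; have hs : - eta < s < 1 + eta by apply/andP; split; lra.
  have sC0 : s%:C * 'i != 0.
    by rewrite mulf_neq0 ?i_neq0 // (inj_eq (@complexI R) _ 0) gt_eqF.
  apply: (@cint_periodic R (fun t => (s%:C * 'i)^-1 * f (z s t)) _ M).
  - move=> t; have h := rderiveZ (s%:C * 'i)^-1 (@rderive_comp R f (z s) t _ (af _ (zd s t hs)) (zt s t)).
    have -> : F' s t =
        (s%:C * 'i)^-1 * (derive1 f (z s t) * (s%:C * rho%:C * ('i * cis t))).
      rewrite -[LHS](mulKf sC0); congr (_ * _); rewrite /F'; ring.
    exact: h.
  - by move=> t; exact: F'M.
  - by rewrite /z cis2pi cis0.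
have E : cint leb arc (F 1) = cint leb arc (F 0).
  apply: (@rderive0_cst (fun s => cint leb arc (F s))) => s hs.
  - eexists; apply: dPhi; move: hs => /andP[]; lra.
  - rewrite -(dPhi0 s hs); apply: dPhi; move: hs => /andP[]; lra.
have E1 : cint leb arc (fun t => f (rho%:C * cis t) / (1 - q * (cis t)^*)) =
    cint leb arc (F 1).
  by apply: eq_cint => t _; rewrite /F /z rmorph1 mul1r [w + _]addrC subrK mulrC.
have E0 : cint leb arc (F 0) = f w * cint leb arc K.
  rewrite -cintZl //; first by apply: eq_cint => t _; rewrite /F /z rmorph0 mul0r addr0 mulrC.
  by apply: ccontinuous_cintegrable; exact: cauchy_kernel_continuous.
rewrite /cmean E1 E E0 mulrCA.
have := cmean_cauchy_kernel q1; under eq_fun do rewrite mul1r.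
by rewrite /cmean => ->; rewrite mulr1.
Unshelve. all: by end_near. Qed.

End cauchy.

(** * Growth along radii and power series expansions *)

Section expansion.
Context {R : realType}.
Local Notation C := R[i].
Local Notation leb := (@lebesgue_measure R).

(** With [u] the phase of [f z - f 0], the real function phi(s) - Re (u f(s z)) has a nonnegative
    derivative. Comparing its end values gives the bound without integrating the derivative of
    [f]. *)
Lemma growth_bound (f : C -> C) (z : C) (phi phi' : R -> R) :
  analytic f -> udisc z ->
  (forall s : R, 0 <= s <= 1 -> is_derive s 1 phi (phi' s)) ->
  (forall s : R, 0 <= s <= 1 -> cabs (derive1 f (s%:C * z)) * cabs z <= phi' s) ->
  cabs (f z - f 0) <= phi 1 - phi 0.
Proof.
move=> af dz dphi hphi; have [u u1 uE] := phaseP (f z - f 0).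
pose psi (s : R) := phi s - complex.Re (u * f (s%:C * z)).
have dsz (s : R) : 0 <= s <= 1 -> udisc (s%:C * z).
  move=> /andP[s0 s1]; rewrite /udisc /= cabsM cabs_real ger0_norm //.
  by apply: le_lt_trans dz; rewrite ler_piMl // cabs_ge0.
have dpsi (s : R) : 0 <= s <= 1 ->
    is_derive s 1 psi (phi' s - complex.Re (u * (derive1 f (s%:C * z) * z))).
  move=> hs; apply: is_deriveB; first exact: dphi.
  have h : rderive (fun s : R => s%:C * z) s z.
    by have := rderive_affine 0 z s; under [X in rderive X _ _]eq_fun do rewrite add0r.
  exact: (rderive_Re (rderiveZ u
    (@rderive_comp R f (fun s : R => s%:C * z) s _ (af _ (dsz s hs)) h))).
have in01 (s : R) : s \in `]0, 1[ -> 0 <= s <= 1.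
  by rewrite in_itv /= => /andP[/ltW -> /ltW ->].
have d1 (s : R) : s \in `]0, 1[ -> derivable psi s 1.
  by move=> /in01 /dpsi [].
have d2 (s : R) : s \in `]0, 1[ -> 0 <= derive1 psi s.
  move=> /in01 hs; rewrite derive1E; have [_ ->] := dpsi s hs.
  rewrite subr_ge0 (le_trans _ (hphi s hs)) // (le_trans (ler_norm _)) //.
  by rewrite (le_trans (ler_Re_cabs _)) // !cabsM u1 mul1r.
have cp : {within `[0, 1], continuous psi}.
  by apply: derivable_within_continuous => s; rewrite in_itv /= => /dpsi [].
have := ger0_derive1_ndecr d1 d2 cp (lexx 0) ler01 (lexx 1).
rewrite /psi rmorph0 mul0r rmorph1 mul1r => h.
have -> : cabs (f z - f 0) = complex.Re (u * (f z - f 0)) by rewrite uE.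
by rewrite mulrBr ReD ReN; lra.
Qed.

Lemma bounded_circle (f : C -> C) (r : R) : analytic f ->
  locally_bounded_derivative f -> r < 1 ->
  exists M, forall z, cabs z <= r -> cabs (f z) <= M.
Proof.
move=> af bf r1; have [M hM] := bf r r1.
exists (cabs (f 0) + M) => z zr.
have z1 : cabs z < 1 := le_lt_trans zr r1.
have hs (s : R) : 0 <= s <= 1 -> cabs (derive1 f (s%:C * z)) <= M.
  move=> /andP[s0 s1]; apply: hM; rewrite cabsM cabs_real ger0_norm //.
  by apply: le_trans zr; rewrite ler_piMl // cabs_ge0.
have M0 : 0 <= M by apply: le_trans (hs 0 _); rewrite ?cabs_ge0 ?lexx ?ler01.
have := @growth_bound f z (fun s => M * s) (fun=> M) af z1.
rewrite mulr1 mulr0 subr0 => h.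
have {}h : cabs (f z - f 0) <= M.
  apply: h => s hs'.
    apply: is_derive1_cvg; apply: (cvg_near_eq _ (cvg_cst M)); near=> t.
    have t0 : t != 0 by near: t; exact: nbhs_dnbhs_neq.
    by rewrite -mulrBr addrK mulrCA mulVf ?mulr1.
  by rewrite -[leRHS]mulr1 ler_pM ?cabs_ge0 ?hs // ltW.
by rewrite -(subrK (f 0) (f z)) addrC (le_trans (ler_cabsD _ _)) // lerD2l.
Unshelve. all: by end_near. Qed.

Lemma circle_continuous (f : C -> C) (r : R) : analytic f -> 0 <= r < 1 ->
  continuous (fun t => f (r%:C * cis t)).
Proof.
move=> af hr t.
exact: (rderive_continuous (@rderive_comp R f (fun t => r%:C * cis t) t _
  (af _ (circle_in_disc t hr)) (rderiveZ r%:C (rderive_cis t)))).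
Qed.

Lemma cmean_orthogonal (k n : nat) :
  cmean (fun t => cis t ^+ k * (cis t)^* ^+ n) = (k == n)%:R :> C.
Proof.
case: (leqP n k) => [nk|/ltnW kn].
  have E t : cis t ^+ k * (cis t)^* ^+ n = cis t ^+ (k - n) :> C.
    by rewrite -{1}(subnK nk) exprD -mulrA -exprMn cis_mulJ expr1n mulr1.
  by under eq_fun do rewrite E; rewrite cmean_cisX subn_eq0 eqn_leq nk andbT.
have E t : cis t ^+ k * (cis t)^* ^+ n = (cis t)^* ^+ (n - k) :> C.
  by rewrite -{1}(subnKC kn) exprD mulrA -exprMn cis_mulJ expr1n mul1r.
by under eq_fun do rewrite E; rewrite cmean_cisJX subn_eq0 eqn_leq kn.
Qed.

Lemma cis_measurable : cmeasurable (@arc R) (@cis R).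
Proof.
by apply: ccontinuous_measurable; [exact: measurable_arc|exact: cis_continuous].
Qed.

Lemma cvg_term_bounded (a : nat -> C) (z : C) :
  cvgn (series (fun k => a k * z ^+ k)) ->
  exists M, forall k, cabs (a k) * cabs z ^+ k <= M.
Proof.
move=> /cvg_series_cvg_0 /cvgC_cabs; rewrite cabs0 => h.
have /cvg_seq_bounded [M [Mr hM]] : cvgn (fun k => cabs (a k * z ^+ k)).
  by apply/cvg_ex; exists 0.
exists (M + 1) => k; rewrite -cabsX -cabsM.
by rewrite (le_trans (ler_norm _)) // hM // ltrDl.
Qed.

(** Orthogonality on a circle reads the coefficients off the sum. Hence the sum determines them,
    even if expansions are known on discs of different radii. *)
Lemma power_series_coefficient (a : nat -> C) (S : C -> C) (R0 r : R) (n : nat) :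
  (forall z, cabs z < R0 -> series (fun k => a k * z ^+ k) @ \oo --> S z) ->
  0 <= r < R0 ->
  cmean (fun t => S (r%:C * cis t) * (cis t)^* ^+ n) = a n * r%:C ^+ n.
Proof.
(* Convergence at a larger radius [r1] bounds the terms there, so on the circle of radius [r] they
   decay like (r / r1)^k and all partial sums have one constant majorant. *)
move=> hS /andP[r0 rR]; pose r1 := (r + R0) / 2.
have rr1 : r < r1 by rewrite /r1; lra.
have r10 : 0 < r1 := le_lt_trans r0 rr1.
have r1R : r1 < R0 by rewrite /r1; lra.
have [M hM] : exists M, forall k, cabs (a k) * r1 ^+ k <= M.
  have := @cvg_term_bounded a r1%:C; rewrite cabs_real (gtr0_norm r10); apply.
  by apply/cvg_ex; exists (S r1%:C); apply: hS; rewrite cabs_real gtr0_norm.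
have M0 : 0 <= M by rewrite (le_trans _ (hM 0%N)) // expr0 mulr1 cabs_ge0.
pose q := r / r1; have q0 : 0 <= q by rewrite divr_ge0 // ltW.
have q1 : q < 1 by rewrite ltr_pdivrMr // mul1r.
have hcis k t : cabs (a k * (r%:C * cis t) ^+ k) <= M * q ^+ k.
  rewrite cabsM cabsX cabsM cabs_cis mulr1 cabs_real ger0_norm //.
  rewrite expr_div_n mulrA ler_pdivlMr ?exprn_gt0 // mulrAC ler_wpM2r ?exprn_ge0 //.
have hsum N t : cabs (series (fun k => a k * (r%:C * cis t) ^+ k) N) <= M / (1 - q).
  rewrite /series /= (le_trans (ler_cabs_sum _ _ _)) //.
  have h : \sum_(0 <= k < N) cabs (a k * (r%:C * cis t) ^+ k) <=
      \sum_(0 <= k < N) M * q ^+ k by apply: ler_sum => k _; exact: hcis.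
  rewrite (le_trans h) // -mulr_sumr ler_wpM2l //.
  have := @cabs_sum_geometric R q%:C N; rewrite cabs_real (ger0_norm q0) => /(_ q1).
  apply: le_trans; rewrite (eq_bigr (fun k => (q ^+ k)%:C)); last first.
    by move=> k _; rewrite rmorphXn.
  by rewrite -rmorph_sum /= cabs_real ler_norm.
have mA := @measurable_arc R.
have mJ m : cmeasurable (@arc R) (fun t => (cis t)^* ^+ m : C).
  by apply: cmeasurableX; apply: cmeasurableJ; exact: cis_measurable.
have mT k : cmeasurable (@arc R) (fun t => cis t ^+ k * (cis t)^* ^+ n : C).
  by apply: cmeasurableM => //; apply: cmeasurableX; exact: cis_measurable.
have iT k : cintegrable leb arc (fun t => cis t ^+ k * (cis t)^* ^+ n : C).
  apply: (@cintegrable_arc_bounded R _ 1) => // t.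
  by rewrite cabsM !cabsX cabsJ cabs_cis !expr1n mulr1.
pose F N t := series (fun k => a k * (r%:C * cis t) ^+ k) N * (cis t)^* ^+ n.
have FE N t : F N t =
    \sum_(0 <= k < N) (a k * r%:C ^+ k) * (cis t ^+ k * (cis t)^* ^+ n).
  rewrite /F /series /= mulr_suml; apply: eq_bigr => k _.
  by rewrite exprMn; ring.
have {}FE N : F N = fun t =>
    \sum_(0 <= k < N) (a k * r%:C ^+ k) * (cis t ^+ k * (cis t)^* ^+ n).
  by apply/funext => t; exact: FE.
have cF N : (n < N)%N -> cmean (F N) = a n * r%:C ^+ n.
  move=> nN; rewrite FE.
  rewrite /cmean cint_sum //; last by move=> k; exact: cintegrableZl.
  rewrite mulr_sumr (eq_bigr (fun k => (a k * r%:C ^+ k) * (k == n)%:R)); last first.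
    by move=> k _; rewrite cintZl // mulrCA -cmean_orthogonal.
  rewrite big_mkord (bigD1 (Ordinal nN)) //= eqxx mulr1 big1 ?addr0 // => i ni.
  by rewrite (_ : (i == n :> nat) = false) ?mulr0 //; apply: contraNF ni.
have cv1 : cmean (F N) @[N --> \oo] -->
    cmean (fun t => S (r%:C * cis t) * (cis t)^* ^+ n).
  apply: cvgM; first exact: cvg_cst.
  apply: (@cint_dominated _ _ _ _ _ mA _ _ (cst (M / (1 - q)))).
  - move=> N; rewrite FE; apply: cmeasurable_sum => k.
    by apply: cmeasurableM => //; exact: cmeasurable_cst.
  - move=> t _; apply: cvgM; last exact: cvg_cst.
    by apply: hS; rewrite cabsM cabs_cis mulr1 cabs_real ger0_norm.
  - exact: integrable_arc_cst.
  - by move=> N t _; rewrite /F cabsM cabsX cabsJ cabs_cis expr1n mulr1.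
have cv2 : cmean (F N) @[N --> \oo] --> a n * r%:C ^+ n.
  by apply: cvg_near_cst; near=> N; apply: cF; near: N; exact: nbhs_infty_gt.
exact: cvg_unique cv1 cv2.
Unshelve. all: by end_near. Qed.

(** Cauchy's formula on a circle expands [f] only inside that circle. The coefficients of two
    circles agree because both series represent [f] on a smaller circle, so the coefficients found
    at radius 1/2 serve the whole disc. *)
Lemma analytic_power_series (f : C -> C) : analytic f ->
  locally_bounded_derivative f -> exists a, power_series_on_disc a f.
Proof.
move=> af bf.
pose c (rho : R) n := (rho%:C ^+ n)^-1 * cmean (fun t => f (rho%:C * cis t) * (cis t)^* ^+ n).
have hc (rho : R) : 0 < rho < 1 -> forall z, cabs z < rho ->
    series (fun k => c rho k * z ^+ k) @ \oo --> f z.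
  move=> /andP[rho0 rho1] z zr.
  have [M hM] := bounded_circle af bf rho1.
  have q1 : cabs (z / rho%:C) < 1.
    by rewrite cabsM cabsV cabs_real gtr0_norm // ltr_pdivrMr // mul1r.
  have hr : 0 <= rho < 1 by rewrite ltW.
  have := @cmean_geometric R (fun t => f (rho%:C * cis t)) (z / rho%:C) M q1.
  rewrite cauchy_formula // => h.
  apply: (cvg_near_eq _ (h _ _)).
  - near=> n; rewrite /series /=; apply: eq_bigr => k _.
    by rewrite /c exprMn exprVn; ring.
  - apply: ccontinuous_measurable; first exact: measurable_arc.
    exact: circle_continuous.
  - by move=> t; apply: hM; rewrite cabsM cabs_cis mulr1 cabs_real gtr0_norm.
have c_indep (rho : R) n : 0 < rho < 1 -> c rho n = c (1 / 2) n.
  move=> hrho; pose r := Num.min rho (1 / 2) / 2.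
  have r0 : 0 < Num.min rho (1 / 2).
    by rewrite lt_min; move: hrho => /andP[-> _]; rewrite divr_gt0.
  have h1 : Num.min rho (1 / 2) <= rho by rewrite ge_min lexx.
  have h2 : Num.min rho (1 / 2) <= 1 / 2 by rewrite ge_min lexx orbT.
  have rr : r%:C ^+ n != 0.
    by rewrite expf_neq0 // (inj_eq (@complexI R) _ 0) gt_eqF // divr_gt0.
  apply: (mulIf rr).
  rewrite -(@power_series_coefficient _ f rho r n (hc _ hrho)); last first.
    by rewrite /r; apply/andP; split; lra.
  rewrite -(@power_series_coefficient _ f (1 / 2) r n (hc (1 / 2) _)) //.
    by apply/andP; split; lra.
  by rewrite /r; apply/andP; split; lra.
exists (c (1 / 2)) => z dz.
pose rho := (1 + cabs z) / 2; have z0 := cabs_ge0 z.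
have dz' : cabs z < 1 := dz.
have hrho : 0 < rho < 1 by rewrite /rho; apply/andP; split; lra.
have -> : (fun k => c (1 / 2) k * z ^+ k) = (fun k => c rho k * z ^+ k).
  by apply/funext => k; rewrite (c_indep rho).
by apply: hc => //; rewrite /rho; lra.
Unshelve. all: by end_near. Qed.

Lemma mean_value_circle (f : C -> C) (r : R) : analytic f ->
  locally_bounded_derivative f -> 0 < r < 1 ->
  cmean (fun t => f (r%:C * cis t)) = f 0.
Proof.
move=> af bf /andP[r0 r1].
rewrite -[RHS](cauchy_formula af bf r1) ?cabs0 //.
congr cmean; apply/funext => t.
by rewrite mul0r mul0r subr0 divr1.
Qed.

End expansion.

(** * Carleson measures *)

Section carleson_estimate.
Context {R : realType}.
Variable mu : {finite_measure set (measurableTypeR R) -> \bar R}.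

Lemma quarterE : 4^-1 = 2^-1 ^+ 2 :> R.
Proof. by rewrite exprVn -natrX. Qed.

(** With y = 2^(-k) the term is y / (y^2 + s^2), which decays geometrically on both sides of y = s
    and has size 1 / s there. The decrements of 4 y / (s (s + y)) under halving of y majorize the
    terms, so the sum telescopes without being split at y = s. *)
Lemma telescoping_bound (s : R) n : 0 < s ->
  \sum_(0 <= k < n) (2^-1) ^+ k / ((4^-1) ^+ k + s ^+ 2) <= 4 / s.
Proof.
move=> s0; pose y k : R := (2^-1) ^+ k.
have y0 k : 0 < y k by rewrite exprn_gt0.
have y4 k : (4^-1 : R) ^+ k = y k ^+ 2.
  by rewrite quarterE /y -!exprM mulnC.
have yS k : y k.+1 = y k / 2 by rewrite /y exprSr.
suff h : \sum_(0 <= k < n) y k / ((4^-1) ^+ k + s ^+ 2) <=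
    4 / s * (y 0%N / (s + y 0%N) - y n / (s + y n)).
  apply: (le_trans h); rewrite -[leRHS]mulr1 ler_wpM2l ?divr_ge0 ?(ltW s0) //.
  have h1 : 0 <= y n / (s + y n) by rewrite divr_ge0 ?addr_ge0 ?(ltW s0) ?(ltW (y0 _)).
  have h2 : y 0%N / (s + y 0%N) <= 1.
    by rewrite ler_pdivrMr ?addr_gt0 // mul1r lerDr ltW.
  lra.
elim: n => [|n ih]; first by rewrite big_nil subrr mulr0.
rewrite big_nat_recr //=.
suff h : y n / ((4^-1) ^+ n + s ^+ 2) <= 4 / s * (y n / (s + y n) - y n.+1 / (s + y n.+1)).
  by apply: (le_trans (lerD ih h)); rewrite -mulrDr addrA subrK.
rewrite y4 yS.
move: (y n) (y0 n) => z z0.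
have -> : 4 / s * (z / (s + z) - z / 2 / (s + z / 2)) = 4 * z / ((s + z) * (2 * s + z)).
  by field; rewrite !gt_eqF //; nra.
rewrite ler_pdivlMr; last by nra.
rewrite mulrAC ler_pdivrMr; last by nra.
have : z * (4 * (z ^+ 2 + s ^+ 2) - (s + z) * (2 * s + z)) >= 0.
  rewrite mulr_ge0 ?(ltW z0) //.
  have := sqr_ge0 (z - s); have := sqr_ge0 z; have := sqr_ge0 s; nra.
lra.
Qed.

Lemma dyadic_scale (u : R) : 0 < u <= 1 ->
  exists k, (4^-1) ^+ k.+1 < u <= (4^-1) ^+ k.
Proof.
move=> /andP[u0 u1].
have ex : exists n, (4^-1 : R) ^+ n < u.
  have : (4^-1 : R) ^+ n @[n --> \oo] --> 0 by apply: cvg_expr; rewrite ger0_norm //; lra.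
  move=> /cvgrPdist_lt /(_ u u0) [n _ /(_ n (leqnn n))].
  by rewrite /= sub0r normrN ger0_norm ?exprn_ge0 // => h; exists n.
case: (ex_minnP ex) => [[|m] hm hmin]; first by move: hm; rewrite expr0; lra.
exists m; rewrite hm /= leNgt; apply/negP => /hmin; by rewrite ltnn.
Qed.

(** Here [u] stands for 1 - t. The exponent is negative, so the power is largest at the lower end of
    the scale. The denominator is at least (u + (1 - r)) / 2, and u exceeds a quarter of 4^(-k):
    together these give the 8. *)
Lemma carleson_kernel_bound (alpha r u : R) k : 1 < alpha -> 0 <= r < 1 ->
  (4^-1) ^+ k.+1 < u <= (4^-1) ^+ k ->
  u `^ (1 / 2 - alpha) / (1 - (1 - u) * r) <=
  ((4^-1) ^+ k.+1) `^ (1 / 2 - alpha) * (8 / ((4^-1) ^+ k + (1 - r))).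
Proof.
move=> a1 /andP[r0 r1] /andP[hu1 hu2].
have x0 : 0 < (4^-1 : R) ^+ k by rewrite exprn_gt0.
have xE : (4^-1 : R) ^+ k.+1 = (4^-1) ^+ k / 4 by rewrite exprSr.
have x1 : 0 < (4^-1 : R) ^+ k.+1 by rewrite exprn_gt0.
have xle1 : (4^-1 : R) ^+ k <= 1 by rewrite exprn_ile1 //; lra.
have u0 : 0 < u by lra.
have hden : (u + (1 - r)) / 2 <= 1 - (1 - u) * r by nra.
have den0 : 0 < 1 - (1 - u) * r by nra.
apply: ler_pM; rewrite ?powR_ge0 ?invr_ge0 ?(ltW den0) //.
  have -> : 1 / 2 - alpha = - (alpha - 1 / 2) by lra.
  rewrite !powRN lef_pV2 ?posrE ?powR_gt0 //.
  by apply: ge0_ler_powR; rewrite ?nnegrE; lra.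
rewrite -[leLHS]mul1r ler_pdivrMr // mulrAC ler_pdivlMr; last lra.
move: xE; set X := _ ^+ k in hu2 x0 xle1 *; move: ((4^-1) ^+ k.+1) x1 hu1 => Y; lra.
Qed.

Lemma measurable_carleson_kernel (b r : R) : 0 <= r < 1 ->
  measurable_fun (`[0%R, 1%R[%classic : set (measurableTypeR R))
    (fun t : measurableTypeR R => (1 - t) `^ b / (1 - t * r)).
Proof.
move=> /andP[r0 r1]; apply: measurable_funM.
  apply: measurable_fun_powR; apply: measurable_funB; first exact: measurable_cst.
  exact: measurable_id.
apply: measurable_fun_pinv.
  by move=> t; rewrite /= in_itv /= => /andP[t0 t1]; nra.
apply: measurable_funB; first exact: measurable_cst.
by apply: measurable_funM; [exact: measurable_id|exact: measurable_cst].
Qed.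

Lemma carleson_integral (alpha : R) : 1 < alpha -> carleson mu alpha ->
  exists2 A : R, 0 < A & forall r : R, 0 <= r < 1 ->
  (\int[mu]_(t in `[0%R, 1%R[) (((1 - t) `^ (1 / 2 - alpha) / (1 - t * r))%:E) <=
   (A / Num.sqrt (1 - r))%:E)%E.
Proof.
move=> a1 [K K0 hK]; pose b := 1 / 2 - alpha.
(* The factor 8 and the power of 4^(-1) come from [carleson_kernel_bound], [K] from the Carleson
   condition, the last 4 from [telescoping_bound]. *)
pose B := 8 * K * (4^-1 `^ b) * 4.
have B0 : 0 < B by rewrite !mulr_gt0 // powR_gt0.
exists B => // r hr; have [r0 r1] := andP hr.
pose delta := 1 - r; have d0 : 0 < delta by rewrite /delta; lra.
pose c k : R := ((4^-1) ^+ k.+1) `^ b * (8 / ((4^-1) ^+ k + delta)).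
have x0 k : 0 < (4^-1 : R) ^+ k by rewrite exprn_gt0.
have xle1 k : (4^-1 : R) ^+ k <= 1 by rewrite exprn_ile1 //; lra.
have c0 k : 0 <= c k.
  have h : 0 <= (4^-1) ^+ k + delta by have := x0 k; lra.
  by rewrite mulr_ge0 ?powR_ge0 // divr_ge0.
(* Tails instead of dyadic rings: a point of scale [k] lies in [A_ k], the Carleson condition
   measures [A_ k] directly, and overlaps only enlarge a sum of nonnegative terms. *)
pose A_ k : set (measurableTypeR R) := `[1 - (4^-1) ^+ k, 1[%classic.
have mA k : measurable (A_ k) by exact: measurable_itv.
pose f k (t : measurableTypeR R) := ((c k)%:E * (\1_(A_ k) t)%:E)%E.
have f0 k t : (0 <= f k t)%E by rewrite mule_ge0 ?lee_fin.
have mI : measurable (`[0%R, 1%R[%classic : set (measurableTypeR R)) by exact: measurable_itv.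
have mf k : measurable_fun (`[0%R, 1%R[%classic : set (measurableTypeR R)) (f k).
  apply: measurable_funeM; apply/measurable_EFinP.
  exact: measurable_indic.
apply: (@le_trans _ _ (\int[mu]_(t in `[0%R, 1%R[) (\sum_(k <oo) f k t))%E).
  apply: ge0_le_integral => //.
  - move=> t; rewrite /= in_itv /= => /andP[t0 t1].
    have h : 0 <= 1 - t * r by nra.
    by rewrite lee_fin divr_ge0 ?powR_ge0.
  - by apply/measurable_EFinP; exact: measurable_carleson_kernel.
  - by apply: ge0_emeasurable_sum => // k t _ _; exact: f0.
  - move=> t; rewrite /= in_itv /= => /andP[t0 t1].
    have ht : 0 < 1 - t <= 1 by apply/andP; split; lra.
    have [k hk] := dyadic_scale ht.
    have hle : (1 - t) `^ b / (1 - t * r) <= c k.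
      have := carleson_kernel_bound a1 hr hk.
      by rewrite subKr.
    apply: (@le_trans _ _ (f k t)).
      have tA : A_ k t by rewrite /A_ /= in_itv /=; move: hk => /andP[_ h]; apply/andP; split; lra.
      by rewrite /f indicE mem_set // mule1 lee_fin.
    apply: le_trans (nneseries_lim_ge k.+1 _) => //.
    by rewrite big_nat_recr //= leeDr // sume_ge0.
rewrite integral_nneseries //.
apply: lime_le; first by apply: is_cvg_nneseries => n _ _; exact: integral_ge0.
near=> n.
have If k : (\int[mu]_(t in `[0%R, 1%R[) f k t <=
    (8 * K * 4^-1 `^ b * ((2^-1) ^+ k / ((4^-1) ^+ k + Num.sqrt delta ^+ 2)))%:E)%E.
  rewrite ge0_integralZl //.
  - rewrite integral_indic // (_ : A_ k `&` _ = A_ k); last first.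
      apply/setIidPl => t; rewrite /A_ /= !in_itv /= => /andP[h ->]; rewrite andbT.
      by have := xle1 k; lra.
    have hA : 0 <= 1 - (4^-1 : R) ^+ k < 1.
      by apply/andP; split; have := xle1 k; have := x0 k; lra.
    apply: (le_trans (lee_wpmul2l _ (hK _ hA))); first by rewrite lee_fin.
    rewrite -EFinM lee_fin subKr /c.
    rewrite sqr_sqrtr ?(ltW d0) //.
    have -> : ((4^-1 : R) ^+ k.+1) `^ b = 4^-1 `^ b * ((4^-1) ^+ k) `^ b.
      by rewrite exprS powRM // ltW.
    (* Since b + alpha = 1/2, the scale 4^(-k) contributes exactly 2^(-k); the ratio 4 is chosen to
       make this square root a plain power. *)
    have E : ((4^-1 : R) ^+ k) `^ b * ((4^-1) ^+ k) `^ alpha = (2^-1) ^+ k.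
      rewrite -powRD; last by rewrite (gt_eqF (x0 k)) implybT.
      have -> : b + alpha = 2^-1 by rewrite /b; lra.
      rewrite powR12_sqrt ?(ltW (x0 k)) //.
      have -> : (4^-1 : R) ^+ k = ((2^-1) ^+ k) ^+ 2.
        by rewrite quarterE -!exprM mulnC.
      by rewrite sqrtr_sqr ger0_norm // exprn_ge0.
    rewrite -E [leLHS](_ : _ = 8 * K * 4^-1 `^ b *
      (((4^-1 ^+ k) `^ b * (4^-1 ^+ k) `^ alpha) / (4^-1 ^+ k + delta))) //; ring.
  - by apply/measurable_EFinP; exact: measurable_indic.
  - by rewrite lee_fin.
apply: (@le_trans _ _ (\sum_(0 <= k < n)
    (8 * K * 4^-1 `^ b * ((2^-1) ^+ k / ((4^-1) ^+ k + Num.sqrt delta ^+ 2)))%:E)%E).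
  by apply: lee_sum => k _; exact: If.
rewrite sumEFin lee_fin -mulr_sumr.
rewrite /B -!mulrA; do 3 (rewrite ler_wpM2l ?(ltW K0) ?powR_ge0 //).
by apply: telescoping_bound; rewrite sqrtr_gt0.
Unshelve. all: by end_near. Qed.

End carleson_estimate.

(** * Cauchy-type integrals and the Hankel operator *)

Section cauchy_integral.
Context {R : realType}.
Local Notation C := R[i].
Variable mu : {finite_measure set (measurableTypeR R) -> \bar R}.

Definition unit_itv : set (measurableTypeR R) := `[0%R, 1%R[%classic.

Lemma measurable_unit_itv : measurable unit_itv.
Proof. exact: measurable_itv. Qed.

Let mI := measurable_unit_itv.

Lemma lerB_cabs1 (z : C) : 1 - cabs z <= cabs (1 - z).
Proof. by have := lerB_cabs 1 z; rewrite cabs1. Qed.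

Variables (v psi : measurableTypeR R -> C).
Hypothesis iv : cintegrable mu unit_itv v.
Hypothesis mpsi : cmeasurable unit_itv psi.
Hypothesis psi1 : forall t, unit_itv t -> cabs (psi t) <= 1.

(** The parameter [psi] is not fixed to be t: the choice psi(t) = t gives the image of the operator,
    and a Moebius transform of t gives the cofactor of z in the lower bound for BMOA. *)
Definition cauchy_integral (z : C) : C :=
  cint mu unit_itv (fun t => v t / (1 - psi t * z)).

Lemma cauchy_den_ge (z : C) t : unit_itv t -> 1 - cabs z <= cabs (1 - psi t * z).
Proof.
move=> It; apply: le_trans (lerB_cabs1 _); rewrite cabsM lerD2l lerN2.
by rewrite ler_piMl ?cabs_ge0 // psi1.
Qed.

Lemma cauchy_den_neq0 (z : C) t : udisc z -> unit_itv t -> 1 - psi t * z != 0.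
Proof.
move=> dz It; rewrite -cabs_eq0 gt_eqF // (lt_le_trans _ (cauchy_den_ge z It)) //.
by rewrite subr_gt0.
Qed.

Lemma cmeasurable_cauchy_den (z : C) : cmeasurable unit_itv (fun t => 1 - psi t * z).
Proof.
apply: cmeasurableB; first exact: cmeasurable_cst.
by apply: cmeasurableM => //; exact: cmeasurable_cst.
Qed.

Lemma integrable_cabs_scaled (c : R) :
  mu.-integrable unit_itv (EFin \o (fun t => cabs (v t) * c)).
Proof.
have h := integrableZl mI c (cintegrable_cabs mI iv).
apply: eq_integrable h => // t _; by rewrite /= mulrC EFinM.
Qed.

Lemma cintegrable_cauchy (z : C) : udisc z ->
  cintegrable mu unit_itv (fun t => v t / (1 - psi t * z)).
Proof.
move=> dz; have d0 : 0 < 1 - cabs z by rewrite subr_gt0.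
apply: (le_cintegrable mI _ _ (integrable_cabs_scaled (1 - cabs z)^-1)).
  apply: cmeasurableM; first exact: cintegrable_measurable iv.
  by apply: cmeasurableV; exact: cmeasurable_cauchy_den.
move=> t It; rewrite cabsM cabsV ler_wpM2l ?cabs_ge0 // lef_pV2 ?posrE //.
  exact: cauchy_den_ge.
exact: lt_le_trans d0 (cauchy_den_ge z It).
Qed.

Lemma cintegrable_cauchy_deriv (z : C) : udisc z ->
  cintegrable mu unit_itv (fun t => v t * psi t / (1 - psi t * z) ^+ 2).
Proof.
move=> dz; have d0 : 0 < 1 - cabs z by rewrite subr_gt0.
apply: (le_cintegrable mI _ _ (integrable_cabs_scaled ((1 - cabs z) ^+ 2)^-1)).
  apply: cmeasurableM.
    by apply: cmeasurableM => //; exact: cintegrable_measurable iv.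
  by apply: cmeasurableV; apply: cmeasurableX; exact: cmeasurable_cauchy_den.
move=> t It; have h := cauchy_den_ge z It.
rewrite !cabsM cabsV cabsX ler_pM ?mulr_ge0 ?invr_ge0 ?exprn_ge0 ?cabs_ge0 //.
  by rewrite ler_piMr ?cabs_ge0 ?psi1.
rewrite lef_pV2 ?posrE ?exprn_gt0 //; last exact: lt_le_trans d0 h.
by rewrite lerXn2r ?nnegrE ?cabs_ge0 // ltW.
Qed.

(** The error of the difference quotient is explicit: h v psi^2 over a product of three
    denominators, each at least [e], half of 1 - |z|. It is therefore O(h), with no limit theorem
    for integrals. *)
Lemma cauchy_integral_derive (z : C) : udisc z ->
  derivable cauchy_integral z 1 /\
  derive1 cauchy_integral z =
    cint mu unit_itv (fun t => v t * psi t / (1 - psi t * z) ^+ 2).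
Proof.
move=> dz; apply: cvg_derivable.
have d0 : 0 < 1 - cabs z by rewrite subr_gt0.
pose e := (1 - cabs z) / 2; have e0 : 0 < e by rewrite divr_gt0.
pose V := \int[mu]_(t in unit_itv) cabs (v t).
have near_e : \forall h \near (0 : C)^', cabs h < e.
  have eC : 0 < e%:C by rewrite (ltcR 0 e).
  have h := @dnbhs0_lt _ C _ eC.
  by near=> x; rewrite -ltcR cabsC; near: x.
have cv0 : (fun h : C => h) @ (0 : C)^' --> (0 : C) by exact: cvg_within.
apply: (cvgC0_cabs (v := fun h => cabs h * (V * (e ^+ 3)^-1))); last first.
  rewrite -[X in _ --> X](mul0r (V * (e ^+ 3)^-1)) -(@cabs0 R).
  by apply: cvgM; [exact: cvgC_cabs|exact: cvg_cst].
near=> h.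
have h0 : h != 0 by near: h; exact: nbhs_dnbhs_neq.
have he : cabs h < e by near: h.
have dhz : udisc (h + z).
  rewrite /udisc /= (le_lt_trans (ler_cabsD _ _)) //.
  by have : cabs z < 1 := dz; move: he; rewrite /e; lra.
have i1 := cintegrable_cauchy dz; have i2 := cintegrable_cauchy dhz.
have i3 := cintegrable_cauchy_deriv dz.
have i4 := cintegrableB mI i2 i1.
have i5 := cintegrableZl mI h^-1 i4.
have i6 := cintegrableB mI i3 i5.
rewrite /cauchy_integral -cintB // -cintZl // -cintB //.
have -> : cabs h * (V * (e ^+ 3)^-1) = \int[mu]_(t in unit_itv) (cabs (v t) * (cabs h / e ^+ 3)).
  rewrite RintegralZr //; first by rewrite mulrCA.
  exact: cintegrable_cabs.
apply: (cabs_cint_le mI (cintegrable_measurable i6) _ (integrable_cabs_scaled _)).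
move=> t It.
have n1 := cauchy_den_neq0 dz It; have n2 := cauchy_den_neq0 dhz It.
have -> : v t * psi t / (1 - psi t * z) ^+ 2 -
    h^-1 * (v t / (1 - psi t * (h + z)) - v t / (1 - psi t * z)) =
    - (v t * (h * psi t ^+ 2 / ((1 - psi t * (h + z)) * (1 - psi t * z) ^+ 2))).
  by field; rewrite h0 n1 n2.
rewrite cabsN cabsM ler_wpM2l ?cabs_ge0 // (cabsM (h * _)) (cabsM h) cabsV.
have e1 : e <= cabs (1 - psi t * (h + z)).
  apply: le_trans (cauchy_den_ge (h + z) It).
  by have := ler_cabsD h z; move: he; rewrite /e; lra.
have e2 : e <= cabs (1 - psi t * z).
  by apply: le_trans (cauchy_den_ge z It); rewrite /e; lra.
have e3 : e ^+ 3 <= cabs (1 - psi t * (h + z)) * cabs (1 - psi t * z) ^+ 2.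
  by rewrite exprS ler_pM ?exprn_ge0 ?(ltW e0) // lerXn2r ?nnegrE ?cabs_ge0 // ltW.
have e30 : 0 < e ^+ 3 by rewrite exprn_gt0.
apply: ler_pM.
- by rewrite mulr_ge0 ?cabs_ge0.
- by rewrite invr_ge0 cabs_ge0.
- by rewrite ler_piMr ?cabs_ge0 // cabsX exprn_ile1 ?cabs_ge0 // psi1.
- by rewrite cabsM cabsX lef_pV2 ?posrE //; exact: lt_le_trans e30 e3.
Unshelve. all: by end_near. Qed.

Lemma cauchy_integral_analytic : analytic cauchy_integral.
Proof. by move=> z /cauchy_integral_derive[]. Qed.

Lemma cauchy_integral_lbd : locally_bounded_derivative cauchy_integral.
Proof.
move=> r r1; exists (\int[mu]_(t in unit_itv) (cabs (v t) * ((1 - r) ^+ 2)^-1)) => z zr.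
have dz : udisc z := le_lt_trans zr r1.
have [_ ->] := cauchy_integral_derive dz.
have i3 := cintegrable_cauchy_deriv dz.
apply: (cabs_cint_le mI (cintegrable_measurable i3) _ (integrable_cabs_scaled _)).
move=> t It; have h := cauchy_den_ge z It.
have r0 : 0 < 1 - r by rewrite subr_gt0.
have h2 : 1 - r <= cabs (1 - psi t * z) by apply: le_trans h; rewrite lerD2l lerN2.
rewrite !cabsM cabsV cabsX ler_pM ?mulr_ge0 ?invr_ge0 ?exprn_ge0 ?cabs_ge0 //.
  by rewrite ler_piMr ?cabs_ge0 ?psi1.
rewrite lef_pV2 ?posrE ?exprn_gt0 //; last exact: lt_le_trans r0 h2.
by rewrite lerXn2r ?nnegrE ?cabs_ge0 // ltW.
Qed.

End cauchy_integral.

(** * The Hankel operator as an integral operator *)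

Section hankel_integral.
Context {R : realType}.
Local Notation C := R[i].
Variable mu : {finite_measure set (measurableTypeR R) -> \bar R}.
Local Notation I := (@unit_itv R).
Let mI := @measurable_unit_itv R.

Lemma cmeasurable_id : cmeasurable I (fun t : measurableTypeR R => t%:C).
Proof. by apply: cmeasurable_real; exact: measurable_id. Qed.

Lemma cabs_unit_itv (t : R) : I t -> cabs t%:C <= 1.
Proof.
by rewrite /unit_itv /= in_itv /= cabs_real => /andP[t0 /ltW t1]; rewrite ger0_norm.
Qed.

Lemma udisc_unit_itv (t : R) : I t -> udisc t%:C.
Proof.
by rewrite /unit_itv /udisc /= in_itv /= cabs_real => /andP[t0 t1]; rewrite ger0_norm.
Qed.

Lemma cintegrable_monomial n : cintegrable mu I (fun t => t%:C ^+ n).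
Proof.
apply: (le_cintegrable mI (g := cst 1)).
- by apply: cmeasurableX; exact: cmeasurable_id.
- by move=> t It; rewrite cabsX exprn_ile1 ?cabs_ge0 // cabs_unit_itv.
- exact: finite_measure_integrable_cst.
Qed.

Lemma cint_monomial n : cint mu I (fun t => t%:C ^+ n) = (moment mu n)%:C.
Proof.
apply: complexP => /=.
  by apply: eq_Rintegral => t _; rewrite -rmorphXn.
transitivity (\int[mu]_(x in I) (cst (0:R) x)).
  by apply: eq_Rintegral => t _; rewrite -rmorphXn.
by rewrite Rintegral_cst // mul0r.
Qed.

Variables (a : nat -> C) (f : C -> C) (g0 : measurableTypeR R -> R).
Hypothesis haf : power_series_on_disc a f.
Hypothesis ig0 : mu.-integrable I (EFin \o g0).
Hypothesis dom : forall N t, I t ->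
  cabs (\sum_(0 <= k < N) a k * t%:C ^+ k) <= g0 t.

Lemma cmeasurable_partial_sum N :
  cmeasurable I (fun t : measurableTypeR R => \sum_(0 <= k < N) a k * t%:C ^+ k).
Proof.
apply: cmeasurable_sum => k; apply: cmeasurableM; first exact: cmeasurable_cst.
by apply: cmeasurableX; exact: cmeasurable_id.
Qed.

Lemma cmeasurable_restriction : cmeasurable I (fun t : measurableTypeR R => f t%:C).
Proof.
apply: (cmeasurable_cvg cmeasurable_partial_sum) => t It.
exact: (haf (udisc_unit_itv It)).
Qed.

Lemma cabs_restriction (t : R) : I t -> cabs (f t%:C) <= g0 t.
Proof.
move=> It; have cv := cvgC_cabs (FF := eventually_filter) (haf (udisc_unit_itv It)).
by apply: (cvgr_to_le cv); apply: nearW => N; exact: dom.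
Qed.

Lemma cintegrable_restriction : cintegrable mu I (fun t : measurableTypeR R => f t%:C).
Proof.
by apply: (le_cintegrable mI cmeasurable_restriction _ ig0) => t; exact: cabs_restriction.
Qed.

Lemma hankel_coef_cvg n : series (hankel_coef_terms mu a n) @ \oo -->
  cint mu I (fun t => t%:C ^+ n * f t%:C).
Proof.
have E N : series (hankel_coef_terms mu a n) N =
    cint mu I (fun t => t%:C ^+ n * \sum_(0 <= k < N) a k * t%:C ^+ k).
  under [in RHS]eq_fun do rewrite mulr_sumr.
  under [in RHS]eq_fun do (under eq_bigr do rewrite mulrCA -exprD).
  rewrite cint_sum //; last first.
    by move=> k; apply: cintegrableZl => //; exact: cintegrable_monomial.
  apply: eq_bigr => k _; rewrite cintZl //; last exact: cintegrable_monomial.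
  by rewrite cint_monomial mulrC.
rewrite (funext E).
apply: (cint_dominated mI _ _ ig0).
- move=> N; apply: cmeasurableM; last exact: cmeasurable_partial_sum.
  by apply: cmeasurableX; exact: cmeasurable_id.
- move=> t It; apply: cvgM; first exact: cvg_cst.
  exact: (haf (udisc_unit_itv It)).
- move=> N t It; rewrite cabsM cabsX -[leRHS]mul1r ler_pM ?exprn_ge0 ?cabs_ge0 //.
    by rewrite exprn_ile1 ?cabs_ge0 // cabs_unit_itv.
  exact: dom.
Qed.

Definition hankel_integral (z : C) : C :=
  cint mu I (fun t => f t%:C / (1 - t%:C * z)).

(** Expanding 1 / (1 - t z) geometrically under the integral; the majorant is [g0] times 1 / (1 -
    |z|). *)
Lemma hankel_integral_series :
  power_series_on_disc (fun n => limn (series (hankel_coef_terms mu a n)))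
    hankel_integral.
Proof.
move=> z dz.
have iT k : cintegrable mu I (fun t => t%:C ^+ k * f t%:C).
  apply: (le_cintegrable mI _ _ ig0).
    apply: cmeasurableM; last exact: cmeasurable_restriction.
    by apply: cmeasurableX; exact: cmeasurable_id.
  move=> t It; rewrite cabsM cabsX -[leRHS]mul1r ler_pM ?exprn_ge0 ?cabs_ge0 //.
    by rewrite exprn_ile1 ?cabs_ge0 // cabs_unit_itv.
  exact: cabs_restriction.
have E N : series (fun n => limn (series (hankel_coef_terms mu a n)) * z ^+ n) N =
    cint mu I (fun t => f t%:C * \sum_(0 <= k < N) (t%:C * z) ^+ k).
  under [in RHS]eq_fun do rewrite mulr_sumr.
  have E2 t k : f t%:C * (t%:C * z) ^+ k = z ^+ k * (t%:C ^+ k * f t%:C).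
    by rewrite exprMn; ring.
  under [in RHS]eq_fun do (under eq_bigr do rewrite E2).
  rewrite cint_sum //; last by move=> k; exact: cintegrableZl.
  apply: eq_bigr => k _; rewrite cintZl // mulrC; congr (_ * _).
  by apply: cvg_lim => //; exact: hankel_coef_cvg.
rewrite (funext E).
have d0 : 0 < 1 - cabs z by rewrite subr_gt0.
have tz t : I t -> cabs (t%:C * z) <= cabs z.
  by move=> It; rewrite cabsM ler_piMl ?cabs_ge0 // cabs_unit_itv.
have igz : mu.-integrable I (EFin \o (fun t => g0 t * (1 - cabs z)^-1)).
  have h := integrableZl mI (1 - cabs z)^-1 ig0.
  by apply: eq_integrable h => // t _; rewrite /= mulrC EFinM.
apply: (cint_dominated mI _ _ igz).
- move=> N; apply: cmeasurableM; first exact: cmeasurable_restriction.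
  apply: cmeasurable_sum => k; apply: cmeasurableX; apply: cmeasurableM.
    exact: cmeasurable_id.
  exact: cmeasurable_cst.
- move=> t It; apply: cvgM; first exact: cvg_cst.
  by apply: cvg_geometric; exact: le_lt_trans (tz t It) dz.
- move=> N t It; rewrite cabsM ler_pM ?cabs_ge0 ?cabs_restriction //.
  have h := tz t It; have h1 : cabs (t%:C * z) < 1 := le_lt_trans h dz.
  apply: (le_trans (cabs_sum_geometric N h1)).
  by rewrite lef_pV2 ?posrE ?subr_gt0 // lerD2l lerN2.
Qed.

Lemma hankel_integral_analytic : analytic hankel_integral.
Proof.
apply: cauchy_integral_analytic.
- exact: cintegrable_restriction.
- exact: cmeasurable_id.
- by move=> t; exact: cabs_unit_itv.
Qed.

Lemma hankel_integral_graph : hankel_graph mu f hankel_integral.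
Proof.
exists a; split.
- exact: haf.
- move=> n; apply/cvg_ex.
  exists (cint mu I (fun t => t%:C ^+ n * f t%:C)); exact: hankel_coef_cvg.
- exact: hankel_integral_series.
- exact: hankel_integral_analytic.
Qed.

Lemma hankel_integral_unique (g : C -> C) :
  power_series_on_disc (fun n => limn (series (hankel_coef_terms mu a n))) g ->
  forall z, udisc z -> g z = hankel_integral z.
Proof. by move=> hg z dz; exact: cvg_unique (hg z dz) (hankel_integral_series dz). Qed.

End hankel_integral.

(** * Growth of Bloch functions *)

Section bloch_growth.
Context {R : realType}.
Local Notation C := R[i].
Local Notation leb := (@lebesgue_measure R).

(** A real witness for the extended supremum, so that later estimates are inequalities between
    reals. *)
Lemma bloch_normP (alpha : R) (f : C -> C) (B : R) :
  (bloch_norm alpha f <= B%:E)%E <->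
  exists2 b : R, cabs (f 0) + b <= B &
    forall z, udisc z -> cabs (derive1 f z) * (1 - cabs z ^+ 2) `^ alpha <= b.
Proof.
split=> [h|[b hb hz]].
  have fin : bloch_seminorm alpha f \is a fin_num.
    rewrite fin_numE; apply/andP; split; apply/eqP => e.
      have : (0 <= bloch_seminorm alpha f)%E.
        apply: (@le_trans _ _ (cabs (derive1 f 0) * (1 - cabs (0:C) ^+ 2) `^ alpha)%:E).
          by rewrite lee_fin mulr_ge0 ?cabs_ge0 ?powR_ge0.
        apply: ereal_sup_ubound; exists (0 : C) => //.
        by rewrite /udisc /= cabs0.
      by rewrite e.
    by move: h; rewrite /bloch_norm e.
  exists (fine (bloch_seminorm alpha f)).
    by move: h; rewrite /bloch_norm -{1}(fineK fin) -EFinD lee_fin.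
  move=> z dz; rewrite -lee_fin fineK //.
  by apply: ereal_sup_ubound; exists z.
apply: (@le_trans _ _ ((cabs (f 0))%:E + b%:E)%E); last by rewrite -EFinD lee_fin.
rewrite leeD2l //; apply: ge_ereal_sup => _ [z dz <-].
by rewrite lee_fin; exact: hz.
Qed.

(** The factor 1 + y of 1 - y^2 is at least 1 and is dropped. *)
Lemma bloch_deriv_bound (alpha B y : R) (d : R) : 0 <= alpha -> 0 <= y < 1 -> 0 <= d ->
  d * (1 - y ^+ 2) `^ alpha <= B -> d <= B * (1 - y) `^ (- alpha).
Proof.
move=> a0 /andP[y0 y1] d0 h.
have h1 : 0 < 1 - y by lra.
rewrite powRN ler_pdivlMr ?powR_gt0 //; apply: le_trans h.
rewrite ler_wpM2l //; apply: ge0_ler_powR; rewrite ?nnegrE //; nra.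
Qed.

Lemma is_derive_powR_affine (p c s : R) : 0 < 1 - s * c ->
  is_derive s 1 (fun s => (1 - s * c) `^ p) (- (p * c * (1 - s * c) `^ (p - 1))).
Proof.
move=> h.
have dg : is_derive s 1 (fun s : R => 1 - s * c) (- c).
  apply: is_derive1_cvg; apply: (cvg_near_eq _ (cvg_cst (- c))); near=> x.
  have x0 : x != 0 by near: x; exact: nbhs_dnbhs_neq.
  by field.
have -> : - (p * c * (1 - s * c) `^ (p - 1)) = p * (1 - s * c) `^ (p - 1) * - c by ring.
exact: (@is_derive1_comp R (fun y => y `^ p) _ s _ _ (is_derive1_powR p h) dg).
Unshelve. all: by end_near. Qed.

(** The bound b (1 - |z|)^(-alpha) on the derivative is integrated along the radius. As alpha > 1,
    the primitive is a power of exponent 1 - alpha divided by alpha - 1; that power is at least 1 on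
    the disc and so absorbs the value at 0. *)
Lemma bloch_growth (alpha B : R) (f : C -> C) (z : C) : 1 < alpha -> analytic f ->
  (bloch_norm alpha f <= B%:E)%E -> udisc z ->
  cabs (f z) <= B * (1 + (alpha - 1)^-1) * (1 - cabs z) `^ (1 - alpha).
Proof.
move=> a1 af /bloch_normP [b hb hz] dz.
have f0 := cabs_ge0 (f 0).
have z0 := cabs_ge0 z; have z1 : cabs z < 1 := dz.
have b0 : 0 <= b.
  have d0 : udisc (0 : C) by rewrite /udisc /= cabs0.
  by apply: le_trans (hz 0 d0); rewrite mulr_ge0 ?cabs_ge0 ?powR_ge0.
have am : 0 < alpha - 1 by lra.
pose phi (s : R) := b / (alpha - 1) * (1 - s * cabs z) `^ (1 - alpha).
pose phi' (s : R) := b * cabs z * (1 - s * cabs z) `^ (- alpha).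
have hs (s : R) : 0 <= s <= 1 -> 0 <= s * cabs z < 1.
  move=> /andP[s0 s1]; rewrite mulr_ge0 //=.
  by apply: le_lt_trans z1; rewrite ler_piMl.
have h : cabs (f z - f 0) <= phi 1 - phi 0.
  apply: (@growth_bound R f z phi phi') => // s s01.
  - have hpos : 0 < 1 - s * cabs z by have /andP[] := hs s s01; lra.
    have hd := is_derive_powR_affine (1 - alpha) hpos.
    have -> : phi' s = b / (alpha - 1) *
        (- ((1 - alpha) * cabs z * (1 - s * cabs z) `^ (1 - alpha - 1))).
      rewrite /phi' (_ : 1 - alpha - 1 = - alpha); last by ring.
      by field; rewrite gt_eqF.
    by apply: is_derive1_cvg; move: hd => /is_derive1_cvgP hd;
      apply: (cvg_near_eq _ (cvgM (cvg_cst (b / (alpha - 1))) hd));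
      apply: nearW => x; rewrite /= /phi; ring.
  - have s0 : 0 <= s by case/andP: s01.
    have e : cabs (s%:C * z) = s * cabs z by rewrite cabsM cabs_real ger0_norm.
    have dsz : udisc (s%:C * z).
      by rewrite /udisc /= e; have /andP[] := hs s s01.
    have := hz _ dsz; rewrite e => hh.
    have := bloch_deriv_bound _ (hs s s01) (cabs_ge0 _) hh => /(_ (ltW (lt_trans ltr01 a1))) h2.
    by rewrite /phi' mulrAC ler_wpM2r.
have hfz : cabs (f z) <= cabs (f z - f 0) + cabs (f 0).
  by rewrite -{1}(subrK (f 0) (f z)) ler_cabsD.
have P1 : 1 <= (1 - cabs z) `^ (1 - alpha).
  have hpos : 0 < 1 - cabs z by lra.
  rewrite (_ : 1 - alpha = - (alpha - 1)); last by ring.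
  rewrite powRN -[leLHS]invr1 lef_pV2 ?posrE ?powR_gt0 //.
  have e1 : 1 `^ (alpha - 1) = 1 :> R by rewrite powR1.
  rewrite -[leRHS]e1.
  by apply: ge0_ler_powR; rewrite ?nnegrE; lra.
move: h; rewrite /phi mul1r mul0r subr0 powR1 mulr1.
move: P1; set P := _ `^ _ => P1 h.
have iam : 0 < (alpha - 1)^-1 by rewrite invr_gt0.
have k1 : b / (alpha - 1) * P <= B * (alpha - 1)^-1 * P.
  apply: ler_wpM2r; first lra.
  apply: ler_wpM2r; first exact: ltW.
  lra.
have k2 : B <= B * P.
  have : B * 1 <= B * P by apply: ler_wpM2l; lra.
  by rewrite mulr1.
have k3 : 0 <= b / (alpha - 1) by rewrite mulr_ge0 // ltW.
rewrite mulrDr mulr1 mulrDl; lra.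
Qed.

Lemma bloch_lbd (alpha B : R) (f : C -> C) : 0 <= alpha ->
  (bloch_norm alpha f <= B%:E)%E -> locally_bounded_derivative f.
Proof.
move=> a0 /bloch_normP [b hb hz] r r1; exists (b * (1 - r) `^ (- alpha)) => z zr.
have z0 := cabs_ge0 z.
have b0 : 0 <= b.
  have d0 : udisc (0 : C) by rewrite /udisc /= cabs0.
  by apply: le_trans (hz 0 d0); rewrite mulr_ge0 ?cabs_ge0 ?powR_ge0.
have dz : udisc z := le_lt_trans zr r1.
have hz1 : 0 <= cabs z < 1 by rewrite z0.
apply: (le_trans (bloch_deriv_bound a0 hz1 (cabs_ge0 _) (hz z dz))).
apply: ler_wpM2l => //; rewrite !powRN lef_pV2 ?posrE ?powR_gt0 ?subr_gt0 //.
by apply: ge0_ler_powR; rewrite ?nnegrE; lra.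
Qed.

(** With q = t / rho, the partial sum is the circle mean of [f] times a finite geometric sum of
    ratio q e^(-i s), of modulus at most 2 / |1 - q e^(-i s)|. The mean of the latter is controlled
    by the mean of its square, the Poisson value 1 / (1 - q^2). This gives the power -1/2, uniformly
    in [N]. *)
Lemma partial_sum_bound (a : nat -> C) (f : C -> C) (t rho M : R) N :
  analytic f -> power_series_on_disc a f -> 0 <= t < rho -> rho < 1 ->
  (forall z, cabs z = rho -> cabs (f z) <= M) ->
  cabs (\sum_(0 <= k < N) a k * t%:C ^+ k) <= 2 * M / Num.sqrt (1 - (t / rho) ^+ 2).
Proof.
move=> af haf /andP[t0 trho] rho1 hM; have rho0 : 0 < rho := le_lt_trans t0 trho.
have rhoC0 : rho%:C != 0 by rewrite (inj_eq (@complexI R) _ 0) gt_eqF.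
have hcirc s : cabs (rho%:C * cis s) = rho.
  by rewrite cabsM cabs_cis mulr1 cabs_real gtr0_norm.
have M0 : 0 <= M.
  by apply: le_trans (cabs_ge0 (f (rho%:C * cis 0))) (hM _ (hcirc 0)).
pose q := t / rho; have q0 : 0 <= q by rewrite divr_ge0 // ltW.
have q1 : q < 1 by rewrite ltr_pdivrMr // mul1r.
have q2 : 0 < 1 - q ^+ 2 by rewrite subr_gt0 exprn_ilt1.
have cq : cabs q%:C = q by rewrite cabs_real ger0_norm.
have qc s : cabs (q%:C * (cis s)^*) < 1 by rewrite cabsM cabsJ cabs_cis mulr1 cq.
have hr : 0 <= rho < 1 by rewrite ltW.
have mA := @measurable_arc R.
have mf : cmeasurable (@arc R) (fun s => f (rho%:C * cis s)).
  by apply: ccontinuous_measurable => //; exact: circle_continuous.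
have mJ : cmeasurable (@arc R) (fun s => (cis s)^* : C).
  by apply: cmeasurableJ; exact: cis_measurable.
have mfk k : cmeasurable (@arc R) (fun s => f (rho%:C * cis s) * (cis s)^* ^+ k).
  by apply: cmeasurableM => //; exact: cmeasurableX.
have ifk k : cintegrable leb arc (fun s => f (rho%:C * cis s) * (cis s)^* ^+ k).
  apply: (@cintegrable_arc_bounded R _ M) => // s.
  by rewrite cabsM cabsX cabsJ cabs_cis expr1n mulr1 hM.
have E : \sum_(0 <= k < N) a k * t%:C ^+ k =
    cmean (fun s => f (rho%:C * cis s) * \sum_(0 <= k < N) (q%:C * (cis s)^*) ^+ k).
  under [in RHS]eq_fun do rewrite mulr_sumr.
  have E2 s k : f (rho%:C * cis s) * (q%:C * (cis s)^*) ^+ k =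
      q%:C ^+ k * (f (rho%:C * cis s) * (cis s)^* ^+ k).
    by rewrite exprMn; ring.
  under [in RHS]eq_fun do (under eq_bigr do rewrite E2).
  rewrite /cmean cint_sum //; last by move=> k; exact: cintegrableZl.
  rewrite mulr_sumr; apply: eq_bigr => k _; rewrite cintZl // mulrCA.
  have := @power_series_coefficient R a f 1 rho k haf hr; rewrite /cmean => ->.
  rewrite mulrCA; congr (_ * _); rewrite -exprMn; congr (_ ^+ _).
  by rewrite /q rmorphM /= fmorphV /= divfK.
pose L := Num.sqrt (1 - q ^+ 2); have L0 : 0 < L by rewrite sqrtr_gt0.
have L2 : L ^+ 2 = 1 - q ^+ 2 by rewrite sqr_sqrtr // ltW.
pose P s := (cabs (1 - q%:C * (cis s)^*) ^+ 2)^-1.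
have Pnn s : 0 <= P s by rewrite invr_ge0 exprn_ge0 ?cabs_ge0.
have D0 s : 0 < cabs (1 - q%:C * (cis s)^*).
  by rewrite lt_neqAle cabs_ge0 andbT eq_sym cabs_eq0 cabs_lt1_sub1_neq0.
have Dge s : 1 - q <= cabs (1 - q%:C * (cis s)^*).
  by apply: le_trans (lerB_cabs1 _); rewrite cabsM cabsJ cabs_cis mulr1 cq.
have Pb s : P s <= ((1 - q) ^+ 2)^-1.
  rewrite lef_pV2 ?posrE ?exprn_gt0 ?subr_gt0 // lerXn2r ?nnegrE ?cabs_ge0 //.
  by rewrite subr_ge0 ltW.
have mP : measurable_fun (@arc R) P.
  apply: measurable_fun_pinv => [s _|]; first by rewrite exprn_ge0 ?cabs_ge0.
  apply: measurable_fun_cabs2; apply: cmeasurableB; first exact: cmeasurable_cst.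
  by apply: cmeasurableM => //; exact: cmeasurable_cst.
have iP : leb.-integrable (@arc R) (EFin \o P).
  by apply: (@integrable_arc_bounded R P ((1 - q) ^+ 2)^-1) => // s; rewrite ger0_norm.
(* AM-GM: [2 / x <= 1 / L + L / x ^ 2], whose mean is [2 / L]. *)
pose G s := M * (L^-1 + L * P s).
have iG : leb.-integrable (@arc R) (EFin \o G).
  apply: (@integrable_arc_bounded R G (M * (L^-1 + L * ((1 - q) ^+ 2)^-1))).
    apply: measurable_funM; first exact: measurable_cst.
    apply: measurable_funD; first exact: measurable_cst.
    by apply: measurable_funM => //; exact: measurable_cst.
  move=> s; rewrite ger0_norm; last first.
    by rewrite mulr_ge0 ?addr_ge0 ?invr_ge0 ?mulr_ge0 ?Pnn // ltW.
  by rewrite ler_wpM2l // lerD2l ler_wpM2l // ltW.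
have mean_G : rmean G = 2 * M / L.
  rewrite /rmean /G RintegralZl //; last first.
    apply: eq_integrable (integrableD mA (integrable_arc_cst L^-1)
       (integrableZl mA L iP)) => // s _ /=.
  rewrite RintegralD //; last by apply: eq_integrable (integrableZl mA L iP).
    rewrite RintegralZl // mulrCA mulrDr.
    have := @rmean_cst R L^-1; rewrite /rmean => ->.
    rewrite mulrCA; have := @rmean_poisson R q%:C; rewrite cq => /(_ q1).
    rewrite /rmean -L2 => ->.
    by field; rewrite gt_eqF.
  exact: integrable_arc_cst.
rewrite E -mean_G.
have mS : cmeasurable (@arc R)
    (fun s => f (rho%:C * cis s) * \sum_(0 <= k < N) (q%:C * (cis s)^*) ^+ k).
  apply: cmeasurableM => //; apply: cmeasurable_sum => k; apply: cmeasurableX.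
  by apply: cmeasurableM => //; exact: cmeasurable_cst.
have bS s : cabs (f (rho%:C * cis s) * \sum_(0 <= k < N) (q%:C * (cis s)^*) ^+ k) <= G s.
  rewrite cabsM /G ler_pM ?cabs_ge0 ?hM //.
  rewrite geometric_sum ?sub1_neq1 // cabsM cabsV.
  have hx := D0 s; rewrite /P; move: (cabs (1 - q%:C * (cis s)^*)) hx => x x0.
  have h2 : cabs (1 - (q%:C * (cis s)^*) ^+ N) <= 2.
    rewrite (le_trans (ler_cabsB _ _)) // cabs1 cabsX.
    have := exprn_ile1 N (cabs_ge0 (q%:C * (cis s)^*)) (ltW (qc s)); lra.
  apply: (@le_trans _ _ (2 / x)); first by rewrite ler_wpM2r // invr_ge0 ltW.
  have -> : L^-1 + L * (x ^+ 2)^-1 = (x ^+ 2 + L ^+ 2) / (L * x ^+ 2).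
    by field; rewrite !gt_eqF.
  rewrite ler_pdivlMr ?mulr_gt0 ?exprn_gt0 //.
  have -> : 2 / x * (L * x ^+ 2) = 2 * L * x by field; rewrite gt_eqF.
  by have := sqr_ge0 (x - L); nra.
have iS := le_cintegrable mA mS (fun s _ => bS s) iG.
apply: (le_trans (cabs_cmean iS)); apply: rmean_le => //.
exact: cintegrable_cabs.
Qed.

End bloch_growth.

(** * Upper bounds *)

Section tonelli_on.
Local Open Scope ereal_scope.
Context d1 d2 (T1 : measurableType d1) (T2 : measurableType d2) (R : realType).
Variable m1 : {sigma_finite_measure set T1 -> \bar R}.
Variable m2 : {sigma_finite_measure set T2 -> \bar R}.
Variables (D1 : set T1) (D2 : set T2).
Hypotheses (mD1 : measurable D1) (mD2 : measurable D2).
Variable F : T1 * T2 -> R.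
Hypotheses (mF : measurable_fun setT F) (F0 : forall p, (0 <= F p)%R).

(** Indicators of the two domains carry the iterated integrals over to the whole product space,
    where Tonelli's theorem applies. *)
Let f (p : T1 * T2) : \bar R := (F p * (\1_D1 p.1 * \1_D2 p.2))%:E.

Let mf : measurable_fun setT f.
Proof.
apply/measurable_EFinP; apply: measurable_funM => //; apply: measurable_funM.
- exact: measurableT_comp (measurable_indic mD1) measurable_fst.
- exact: measurableT_comp (measurable_indic mD2) measurable_snd.
Qed.

Let f0 p : 0 <= f p.
Proof. by rewrite lee_fin mulr_ge0 // mulr_ge0. Qed.

Let inner1 x : D1 x -> \int[m2]_y f (x, y) = \int[m2]_(y in D2) (F (x, y))%:E.
Proof.
move=> Dx; rewrite [RHS]integral_mkcond; apply: eq_integral => y _.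
rewrite /f patchE /= !indicE (mem_set Dx) mul1r.
by case: (y \in D2); rewrite ?mulr1 ?mulr0.
Qed.

Let inner1_out x : ~ D1 x -> \int[m2]_y f (x, y) = 0.
Proof.
move=> Dx; rewrite (eq_integral (cst 0)) ?integral0 // => y _.
by rewrite /f /= !indicE (memNset Dx) mul0r mulr0.
Qed.

Let inner2 y : D2 y -> \int[m1]_x f (x, y) = \int[m1]_(x in D1) (F (x, y))%:E.
Proof.
move=> Dy; rewrite [RHS]integral_mkcond; apply: eq_integral => x _.
rewrite /f patchE /= !indicE (mem_set Dy) mulr1.
by case: (x \in D1); rewrite ?mul1r ?mul0r ?mulr1 ?mulr0.
Qed.

Let inner2_out y : ~ D2 y -> \int[m1]_x f (x, y) = 0.
Proof.
move=> Dy; rewrite (eq_integral (cst 0)) ?integral0 // => x _.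
by rewrite /f /= !indicE (memNset Dy) !mulr0.
Qed.

Lemma tonelli_on :
  \int[m1]_(x in D1) \int[m2]_(y in D2) (F (x, y))%:E =
  \int[m2]_(y in D2) \int[m1]_(x in D1) (F (x, y))%:E.
Proof.
rewrite [LHS]integral_mkcond [RHS]integral_mkcond.
transitivity (\int[m1]_x \int[m2]_y f (x, y)).
  apply: eq_integral => x _; rewrite patchE; case: ifPn => [/set_mem Dx|/negP Dx].
    by rewrite inner1.
  by rewrite inner1_out // => Dx'; apply: Dx; exact: mem_set.
transitivity (\int[m2]_y \int[m1]_x f (x, y)); first exact: (@fubini_tonelli _ _ _ _ _ m1 m2 f mf f0).
apply: eq_integral => y _; rewrite patchE; case: ifPn => [/set_mem Dy|/negP Dy].
  by rewrite inner2.
by rewrite inner2_out // => Dy'; apply: Dy; exact: mem_set.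
Qed.

Lemma measurable_fun_tonelli_on1 :
  measurable_fun D1 (fun x => \int[m2]_(y in D2) (F (x, y))%:E).
Proof.
apply: (@eq_measurable_fun _ _ _ _ _ (fun x => \int[m2]_y f (x, y))).
  by move=> x /set_mem Dx; rewrite inner1.
apply: measurable_funTS; exact: (@measurable_fun_fubini_tonelli_F _ _ _ _ _ m2 f mf f0).
Qed.

Lemma measurable_fun_tonelli_on :
  measurable_fun D2 (fun y => \int[m1]_(x in D1) (F (x, y))%:E).
Proof.
apply: (@eq_measurable_fun _ _ _ _ _ (fun y => \int[m1]_x f (x, y))).
  by move=> y /set_mem Dy; rewrite inner2.
apply: measurable_funTS; exact: (@measurable_fun_fubini_tonelli_G _ _ _ _ _ m1 f mf f0).
Qed.

End tonelli_on.

(** * Minkowski's integral inequality on the circle *)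

Section minkowski_circle.
Context {R : realType}.
Local Notation leb := (@lebesgue_measure R).
Variable mu : {finite_measure set (measurableTypeR R) -> \bar R}.
Local Notation I := (@unit_itv R).
Local Notation arc := (@arc R).
Let mI := @measurable_unit_itv R.
Let mA := @measurable_arc R.

(* Minkowski's integral inequality in the form [| int W K(t, .) |_2 <= int W k]
   with [k t] bounding the norm of [K(t, .)], by AM-GM and Tonelli. *)
Lemma minkowski_circle (W k : measurableTypeR R -> R)
    (K : measurableTypeR R * measurableTypeR R -> R) (h : measurableTypeR R -> R) (A : R) :
  measurable_fun setT W -> measurable_fun setT k -> measurable_fun setT K ->
  measurable_fun arc h ->
  (forall t, 0 <= W t) -> (forall t, 0 <= k t) -> (forall t, I t -> 0 < k t) ->
  (forall p, 0 <= K p) -> (forall s, 0 <= h s) -> 0 < A ->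
  (\int[mu]_(t in I) (W t * k t)%:E <= A%:E)%E ->
  (forall t, I t -> (\int[leb]_(s in arc) (K (t, s) ^+ 2)%:E <= (2 * pi * k t ^+ 2)%:E)%E) ->
  (forall s, arc s -> ((h s)%:E <= \int[mu]_(t in I) (W t * K (t, s))%:E)%E) ->
  (\int[leb]_(s in arc) (h s ^+ 2)%:E <= (2 * pi * A ^+ 2)%:E)%E.
Proof.
move=> mW mk mK mh W0 k0 kp K0 h0 A0 hA hK hh.
(* [F] is the second factor of W K = (W k)^(1/2) (W K^2 / k)^(1/2), squared; by the bound on the
   norm of K(t, .), its integral over the circle is at most 2 pi W k. *)
pose F (p : measurableTypeR R * measurableTypeR R) := W p.1 * (k p.1)^-1 * K p ^+ 2.
have F0 p : 0 <= F p by rewrite !mulr_ge0 ?invr_ge0 ?exprn_ge0.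
have mki : measurable_fun setT (fun t => (k t)^-1) by apply: measurable_fun_pinv.
have mF : measurable_fun setT F.
  apply: measurable_funM; last exact: measurable_funX.
  apply: measurable_funM; first exact: measurableT_comp mW measurable_fst.
  exact: measurableT_comp mki measurable_fst.
have mKs s : measurable_fun I (fun t => K (t, s)).
  have mp : measurable_fun setT (fun t : measurableTypeR R => (t, s)).
    by apply: measurable_fun_pair; [exact: measurable_id|exact: measurable_cst].
  by apply: measurable_funTS; exact: measurableT_comp mK mp.
have mKt t : measurable_fun arc (fun s => K (t, s)).
  have mp : measurable_fun setT (fun s : measurableTypeR R => (t, s)).
    by apply: measurable_fun_pair; [exact: measurable_cst|exact: measurable_id].
  by apply: measurable_funTS; exact: measurableT_comp mK mp.
have mFs s : measurable_fun I (fun t => (F (t, s))%:E).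
  apply/measurable_EFinP; apply: measurable_funM; last exact: measurable_funX.
  by apply: measurable_funM; apply: measurable_funTS.
pose Z s := (\int[mu]_(t in I) (F (t, s))%:E)%E.
have Z0 s : (0 <= Z s)%E by apply: integral_ge0 => t _; rewrite lee_fin.
have mWk : measurable_fun I (fun t => (W t * k t)%:E).
  by apply/measurable_EFinP; apply: measurable_funM; exact: measurable_funTS.
have amgm s (l : R) : arc s -> 0 < l ->
    ((h s)%:E <= (l / 2 * A)%:E + (2 * l)^-1%:E * Z s)%E.
  move=> As l0; have l2 : 0 <= l / 2 by rewrite divr_ge0 // ltW.
  have l3 : 0 <= (2 * l)^-1 by rewrite invr_ge0 mulr_ge0 // ltW.
  apply: (le_trans (hh s As)).
  apply: (@le_trans _ _ (\int[mu]_(t in I)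
      ((l / 2)%:E * (W t * k t)%:E + (2 * l)^-1%:E * (F (t, s))%:E))%E).
    apply: ge0_le_integral => //.
    - by move=> t _; rewrite lee_fin mulr_ge0.
    - by apply/measurable_EFinP; apply: measurable_funM => //; exact: measurable_funTS.
    - by apply: emeasurable_funD; exact: measurable_funeM.
    - move=> t It; rewrite -!EFinM -EFinD lee_fin /F /=.
      have kt := kp t It.
      have -> : l / 2 * (W t * k t) + (2 * l)^-1 * (W t / k t * K (t, s) ^+ 2) =
          W t * ((l * k t - K (t, s)) ^+ 2 / (2 * l * k t) + K (t, s)).
        by field; rewrite !gt_eqF.
      rewrite ler_wpM2l // lerDr divr_ge0 ?sqr_ge0 //.
      by rewrite !mulr_ge0 // ltW.
  have e1 : (\int[mu]_(t in I) ((l / 2)%:E * (W t * k t)%:E) =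
      (l / 2)%:E * \int[mu]_(t in I) (W t * k t)%:E)%E.
    by rewrite ge0_integralZl ?lee_fin // => t _; rewrite lee_fin mulr_ge0.
  have e2 : (\int[mu]_(t in I) ((2 * l)^-1%:E * (F (t, s))%:E) = (2 * l)^-1%:E * Z s)%E.
    by rewrite ge0_integralZl ?lee_fin // => t _; rewrite lee_fin.
  rewrite ge0_integralD //.
  - rewrite e1 e2 [(l / 2 * A)%:E]EFinM leeD2r //.
    by apply: lee_wpmul2l; rewrite ?lee_fin.
  - by move=> t _; rewrite -EFinM lee_fin mulr_ge0 // mulr_ge0.
  - exact: measurable_funeM.
  - by move=> t _; rewrite -EFinM lee_fin mulr_ge0.
  - exact: measurable_funeM.
have hZ s : arc s -> ((h s ^+ 2)%:E <= A%:E * Z s)%E.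
  move=> As; have [->|hn0] := eqVneq (h s) 0.
    by rewrite expr0n mule_ge0 ?lee_fin // ltW.
  have hp : 0 < h s by rewrite lt_neqAle eq_sym hn0 h0.
  (* With l = h / A the first term is h / 2 and is absorbed on the left, which leaves h^2 <= A Z.
     The value [Z s] may still be infinite. *)
  have := amgm s (h s / A) As (divr_gt0 hp A0).
  have := Z0 s; case: (Z s) => [z| |] //= z0.
    rewrite -!EFinM -EFinD !lee_fin => hle.
    have {}hle : h s <= h s / 2 + A * z / (2 * h s).
      apply: (le_trans hle); rewrite le_eqVlt; apply/orP; left; apply/eqP.
      by field; rewrite !gt_eqF.
    have h2 : h s / 2 <= A * z / (2 * h s) by lra.
    move: h2; rewrite ler_pdivlMr ?mulr_gt0 // => h2.
    by apply: le_trans h2; rewrite expr2; lra.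
  by move=> _; rewrite gt0_muley ?lte_fin // leey.
apply: (@le_trans _ _ (\int[leb]_(s in arc) (A%:E * Z s))%E).
  apply: ge0_le_integral => //.
  - by move=> s _; rewrite lee_fin exprn_ge0.
  - by apply/measurable_EFinP; exact: measurable_funX.
  - by apply: measurable_funeM; exact: (measurable_fun_tonelli_on mu mI mA mF F0).
rewrite ge0_integralZl // ?lee_fin ?(ltW A0) //; last first.
  exact: (measurable_fun_tonelli_on mu mI mA mF F0).
rewrite /Z -(tonelli_on mu leb mI mA mF F0).
have step : (\int[mu]_(t in I) \int[leb]_(s in arc) (F (t, s))%:E <=
    \int[mu]_(t in I) ((2 * pi)%:E * (W t * k t)%:E))%E.
  apply: ge0_le_integral => //.
  - by move=> t _; apply: integral_ge0 => s _; rewrite lee_fin.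
  - exact: (measurable_fun_tonelli_on1 leb mI mA mF F0).
  - exact: measurable_funeM.
  - move=> t It; have kt := kp t It.
    under eq_integral do rewrite /F /= EFinM.
    rewrite ge0_integralZl //.
    + apply: (le_trans (lee_wpmul2l _ (hK t It))).
        by rewrite lee_fin mulr_ge0 // invr_ge0.
      rewrite -!EFinM lee_fin le_eqVlt; apply/orP; left; apply/eqP.
      by field; rewrite gt_eqF.
    + by apply/measurable_EFinP; exact: measurable_funX.
    + by move=> s _; rewrite lee_fin exprn_ge0.
    + by rewrite lee_fin mulr_ge0 // invr_ge0.
apply: (le_trans (lee_wpmul2l _ step)); first by rewrite lee_fin ltW.
rewrite ge0_integralZl //; last 2 first.
- by move=> t _; rewrite lee_fin mulr_ge0.
- by rewrite lee_fin ltW // twopi_gt0.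
apply: (@le_trans _ _ (A%:E * ((2 * pi)%:E * A%:E))%E).
  apply: lee_wpmul2l; first by rewrite lee_fin ltW.
  by apply: lee_wpmul2l => //; rewrite lee_fin ltW // twopi_gt0.
by rewrite -!EFinM lee_fin le_eqVlt; apply/orP; left; apply/eqP; ring.
Qed.

End minkowski_circle.

(** * Moebius maps and the Poisson integral *)

Section disc_geometry.
Context {R : realType}.
Local Notation C := R[i].
Local Notation leb := (@lebesgue_measure R).

Lemma eq_on_disc_derive (f g : C -> C) (z : C) :
  (forall w, udisc w -> f w = g w) -> udisc z -> derivable f z 1 ->
  derivable g z 1 /\ derive1 g z = derive1 f z.
Proof.
move=> fg dz df; apply: cvg_derivable.
have e0 : 0 < (1 - cabs z)%:C by rewrite (ltcR 0) subr_gt0.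
apply: (cvg_near_eq _ (derivable_cvg df)); near=> h.
have hz : cabs h < 1 - cabs z.
  by rewrite -ltcR cabsC; near: h; exact: (@dnbhs0_lt _ C _ e0).
rewrite !fg // /udisc /=; apply: (le_lt_trans (ler_cabsD _ _)); lra.
Unshelve. all: by end_near. Qed.

Lemma derivable_continuous (f : C -> C) (z : C) : derivable f z 1 -> {for z, continuous f}.
Proof. by move=> h; apply: differentiable_continuous; apply/derivable1_diffP. Qed.

Lemma mobius_den_neq0 (a z : C) : udisc a -> udisc z -> 1 - a^* * z != 0.
Proof.
rewrite /udisc /= => da dz; apply: cabs_lt1_sub1_neq0.
rewrite cabsM cabsJ; have := cabs_ge0 a; have := cabs_ge0 z; nra.
Qed.

Lemma mobius_identity (a z : C) :
  cabs (1 - a^* * z) ^+ 2 - cabs (a - z) ^+ 2 =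
  (1 - cabs a ^+ 2) * (1 - cabs z ^+ 2).
Proof. by rewrite !cabs_sqr; case: a => a1 a2; case: z => z1 z2 /=; ring. Qed.

Lemma mobius_disc (a z : C) : udisc a -> udisc z -> udisc (mobius a z).
Proof.
move=> da dz; have den := mobius_den_neq0 da dz.
rewrite /udisc /= /mobius cabsM cabsV ltr_pdivrMr ?mul1r; last first.
  by rewrite lt_neqAle cabs_ge0 andbT eq_sym cabs_eq0.
rewrite -(@ltr_pXn2r _ 2) ?nnegrE ?cabs_ge0 // -subr_gt0 mobius_identity.
have := cabs_ge0 a; have := cabs_ge0 z; move: da dz; rewrite /udisc /= => da dz z0 a0.
by rewrite mulr_gt0 // subr_gt0 exprn_ilt1.
Qed.

(** Multiplied by the denominator of the Moebius map, 1 - t phi_a(z) becomes affine in z with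
    constant term 1 - t a. The difference is thus z times a constant multiple of a Cauchy kernel in
    z: the modulus of that kernel drives the upper bound for BMOA, the factor z the lower one. *)
Lemma mobius_kernel_diff (a z : C) (t : R) : udisc a -> udisc z -> 0 <= t < 1 ->
  [/\ 1 - t%:C * a != 0, (1 - t%:C * a) - (a^* - t%:C) * z != 0 &
  (1 - t%:C * mobius a z)^-1 - (1 - t%:C * a)^-1 =
  - (t%:C * (1 - (cabs a ^+ 2)%:C) * z /
     ((1 - t%:C * a) * ((1 - t%:C * a) - (a^* - t%:C) * z)))].
Proof.
move=> da dz /andP[t0 t1].
have ct : cabs t%:C < 1 by rewrite cabs_real ger0_norm.
have n1 : 1 - t%:C * a != 0.
  apply: cabs_lt1_sub1_neq0; rewrite cabsM.
  by have := cabs_ge0 a; have := cabs_ge0 t%:C; move: da; rewrite /udisc /=; nra.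
have n2 := mobius_den_neq0 da dz.
have n3 : 1 - t%:C * mobius a z != 0.
  apply: cabs_lt1_sub1_neq0; rewrite cabsM.
  have := mobius_disc da dz; rewrite /udisc /=.
  by have := cabs_ge0 (mobius a z); have := cabs_ge0 t%:C; nra.
have E : (1 - t%:C * mobius a z) * (1 - a^* * z) = (1 - t%:C * a) - (a^* - t%:C) * z.
  rewrite mulrBl mul1r -mulrA /mobius divfK //; ring.
have n4 : (1 - t%:C * a) - (a^* - t%:C) * z != 0 by rewrite -E mulf_neq0.
split=> //.
have -> : (1 - t%:C * mobius a z)^-1 = (1 - a^* * z) / ((1 - t%:C * a) - (a^* - t%:C) * z).
  by rewrite -E; field; rewrite n2 n3.
rewrite cabs_sqrC; field; rewrite n1 n4 //.
Qed.

Lemma integrable_poisson (q : C) : cabs q < 1 ->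
  leb.-integrable (@arc R) (EFin \o (fun s => (cabs (1 - q * cis s) ^+ 2)^-1)).
Proof.
move=> q1; apply: (@integrable_arc_bounded R _ ((1 - cabs q) ^+ 2)^-1).
  apply: measurable_fun_pinv => [s _|]; first by rewrite exprn_ge0 ?cabs_ge0.
  apply: measurable_fun_cabs2; apply: cmeasurableB; first exact: cmeasurable_cst.
  by apply: cmeasurableM; [exact: cmeasurable_cst|exact: cis_measurable].
move=> s; have h : 1 - cabs q <= cabs (1 - q * cis s).
  by apply: le_trans (lerB_cabs1 _); rewrite cabsM cabs_cis mulr1.
have q0 : 0 < 1 - cabs q by lra.
rewrite ger0_norm ?invr_ge0 ?exprn_ge0 ?cabs_ge0 //.
rewrite lef_pV2 ?posrE ?exprn_gt0 //; last exact: lt_le_trans q0 h.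
by rewrite lerXn2r ?nnegrE ?cabs_ge0 // ltW.
Qed.

Lemma integral_poisson (q : C) : cabs q < 1 ->
  (\int[leb]_(s in @arc R) ((cabs (1 - q * cis s) ^+ 2)^-1)%:E =
   (2 * pi / (1 - cabs q ^+ 2))%:E)%E.
Proof.
move=> q1; have ip := integrable_poisson q1.
rewrite -[LHS]fineK; last exact: (integrable_fin_num (@measurable_arc R) ip).
congr EFin; have := rmean_poisson_cis q1; rewrite /rmean /Rintegral => h.
have pi0 : 2 * pi != 0 :> R by rewrite gt_eqF // twopi_gt0.
by apply: (mulfI (invr_neq0 pi0)); rewrite h mulKf.
Qed.

Lemma hardy2_norm_le (h : C -> C) (A : R) : 0 <= A ->
  (forall r : R, 0 <= r < 1 -> (\int[leb]_(s in @arc R)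
     (cabs (h (circle_point r s)) ^+ 2)%:E <= (2 * pi * A ^+ 2)%:E)%E) ->
  (hardy2_norm h <= A%:E)%E.
Proof.
move=> A0 hh; apply: ge_ereal_sup => _ [r hr <-].
have hr' : 0 <= r < 1 by move: hr; rewrite /= in_itv.
have pi0 : 0 < (2 * pi)^-1 :> R by rewrite invr_gt0 twopi_gt0.
have -> : A%:E = ((A ^+ 2)%:E `^ (2^-1))%E.
  rewrite poweR_EFin powR12_sqrt ?sqr_ge0 // sqrtr_sqr ger0_norm //.
apply: gt0_ler_poweR; rewrite ?invr_ge0 //.
- rewrite in_itv /= leey andbT mule_ge0 ?lee_fin ?(ltW pi0) //.
  by apply: integral_ge0 => s _; rewrite lee_fin exprn_ge0 ?cabs_ge0.
- by rewrite in_itv /= leey andbT lee_fin sqr_ge0.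
apply: (@le_trans _ _ ((2 * pi)^-1%:E * (2 * pi * A ^+ 2)%:E)%E).
  by apply: lee_wpmul2l; [rewrite lee_fin ltW|exact: hh].
by rewrite -EFinM lee_fin mulrA mulVf ?mul1r // gt_eqF // twopi_gt0.
Qed.

End disc_geometry.

(** * Bloch and BMOA estimates of Cauchy integrals for a Carleson measure *)

Section carleson_upper.
Context {R : realType}.
Local Notation C := R[i].
Local Notation leb := (@lebesgue_measure R).
Variable mu : {finite_measure set (measurableTypeR R) -> \bar R}.
Local Notation I := (@unit_itv R).
Local Notation arc := (@arc R).
Let mI := @measurable_unit_itv R.
Let mA := @measurable_arc R.

Definition carleson_kernel (alpha r : R) (t : measurableTypeR R) : R :=
  (1 - t) `^ (1 / 2 - alpha) / (1 - t * r).

Lemma unit_itvP (t : R) : I t -> 0 <= t < 1.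
Proof. by rewrite /unit_itv /= in_itv. Qed.

Lemma carleson_kernel_ge0 (alpha r t : R) : 0 <= r < 1 -> I t ->
  0 <= carleson_kernel alpha r t.
Proof.
move=> /andP[r0 r1] /unit_itvP /andP[t0 t1].
have h : 0 <= 1 - t * r by nra.
by rewrite divr_ge0 ?powR_ge0.
Qed.

Lemma carleson_Rintegral (alpha : R) : 1 < alpha -> carleson mu alpha ->
  exists2 A : R, 0 < A & forall r : R, 0 <= r < 1 ->
  mu.-integrable I (EFin \o carleson_kernel alpha r) /\
  (\int[mu]_(t in I) (carleson_kernel alpha r t)%:E <= (A / Num.sqrt (1 - r))%:E)%E.
Proof.
move=> a1 /(carleson_integral a1) [A A0 hA]; exists A => // r hr.
split; last exact: hA.
apply/integrableP; split.
  by apply/measurable_EFinP; exact: measurable_carleson_kernel.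
apply: le_lt_trans (ltry (A / Num.sqrt (1 - r))).
apply: le_trans (hA r hr).
rewrite le_eqVlt; apply/orP; left; apply/eqP; apply: eq_integral => t /set_mem It.
by rewrite /= ger0_norm // carleson_kernel_ge0.
Qed.

(** The square root split off is spent against one denominator in the derivative estimate, and
    against (1 - t)^(-1/2) in the H^2 estimate. *)
Lemma powR_split (alpha x : R) : 0 < x ->
  x `^ (1 - alpha) = x `^ (1 / 2 - alpha) * Num.sqrt x.
Proof.
move=> x0; rewrite -(powR12_sqrt (ltW x0)) -powRD; last by rewrite (gt_eqF x0) implybT.
by congr (_ `^ _); lra.
Qed.

Variables (alpha A B : R) (v : measurableTypeR R -> C).
Hypothesis a1 : 1 < alpha.
Hypothesis A0 : 0 < A.
Hypothesis B0 : 0 < B.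
Hypothesis hA : forall r : R, 0 <= r < 1 ->
  mu.-integrable I (EFin \o carleson_kernel alpha r) /\
  (\int[mu]_(t in I) (carleson_kernel alpha r t)%:E <= (A / Num.sqrt (1 - r))%:E)%E.
Hypothesis iv : cintegrable mu I v.
Hypothesis hv : forall t, I t -> cabs (v t) <= B * (1 - t) `^ (1 - alpha).

Let idC (t : measurableTypeR R) : C := t%:C.
Let G := cauchy_integral mu v idC.

Lemma carleson_Rint_le (r c : R) : 0 <= r < 1 -> 0 <= c ->
  mu.-integrable I (EFin \o (fun t => c * carleson_kernel alpha r t)) /\
  \int[mu]_(t in I) (c * carleson_kernel alpha r t) <= c * (A / Num.sqrt (1 - r)).
Proof.
move=> hr c0; have [ik hk] := hA hr; split.
  by have h := integrableZl mI c ik; apply: eq_integrable h.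
rewrite RintegralZl // ler_wpM2l // -lee_fin /Rintegral fineK //.
exact: integrable_fin_num.
Qed.

(** AM-GM together with (1 - t) + (1 - r) <= 2 (1 - t r). *)
Lemma sqrt_den (r t : R) : 0 <= r < 1 -> 0 <= t < 1 ->
  Num.sqrt (1 - t) * Num.sqrt (1 - r) <= 1 - t * r.
Proof.
move=> /andP[r0 r1] /andP[t0 t1].
have h1 : Num.sqrt (1 - t) ^+ 2 = 1 - t by rewrite sqr_sqrtr //; lra.
have h2 : Num.sqrt (1 - r) ^+ 2 = 1 - r by rewrite sqr_sqrtr //; lra.
by have := sqr_ge0 (Num.sqrt (1 - t) - Num.sqrt (1 - r)); nra.
Qed.

(** By [sqrt_den], one of the two factors 1 / (1 - t r) is at most (1 - t)^(-1/2) (1 - r)^(-1/2).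
    The integrand becomes the Carleson kernel over the square root of 1 - r, and integrating it
    supplies the second such root. *)
Lemma cauchy_deriv_bound (z : C) : udisc z ->
  cabs (derive1 G z) <= B * A / (1 - cabs z).
Proof.
move=> dz; have [_ ->] := @cauchy_integral_derive R mu v idC iv (@cmeasurable_id R)
  (@cabs_unit_itv R) z dz.
have z0 := cabs_ge0 z; have z1 : cabs z < 1 := dz.
have hr : 0 <= cabs z < 1 by rewrite z0.
have s0 : 0 < Num.sqrt (1 - cabs z) by rewrite sqrtr_gt0 subr_gt0.
have c0 : 0 <= B / Num.sqrt (1 - cabs z) by rewrite divr_ge0 // ltW.
have [ik hk] := carleson_Rint_le hr c0.
have i3 := @cintegrable_cauchy_deriv R mu v idC iv (@cmeasurable_id R)
  (@cabs_unit_itv R) z dz.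
apply: le_trans (cabs_cint_le mI (cintegrable_measurable i3) _ ik) _; last first.
  apply: (le_trans hk); rewrite le_eqVlt; apply/orP; left; apply/eqP.
  rewrite -[in RHS](@sqr_sqrtr _ (1 - cabs z)) ?subr_ge0 ?(ltW z1) //.
  by field; rewrite gt_eqF.
move=> t It; have ht := unit_itvP It; have /andP[t0 t1] := ht.
have t1' : 0 < 1 - t by lra.
have x0 : 0 < Num.sqrt (1 - t) by rewrite sqrtr_gt0.
have hd := sqrt_den hr ht.
have d0 : 0 < 1 - t * cabs z by nra.
have hden : 1 - t * cabs z <= cabs (1 - idC t * z).
  by apply: le_trans (lerB_cabs1 _); rewrite cabsM cabs_real ger0_norm.
have h1 : cabs (v t * idC t) <= B * (1 - t) `^ (1 - alpha).
  rewrite cabsM; apply: le_trans (hv It).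
  by rewrite ler_piMr ?cabs_ge0 // cabs_unit_itv.
have h2 : (cabs (1 - idC t * z) ^+ 2)^-1 <= ((1 - t * cabs z) ^+ 2)^-1.
  rewrite lef_pV2 ?posrE ?exprn_gt0 //; last exact: lt_le_trans d0 hden.
  by rewrite lerXn2r ?nnegrE ?cabs_ge0 // ltW.
rewrite (cabsM (v t * _)) cabsV cabsX.
apply: (@le_trans _ _ (B * (1 - t) `^ (1 - alpha) * ((1 - t * cabs z) ^+ 2)^-1)).
  by apply: ler_pM; rewrite ?cabs_ge0 ?invr_ge0 ?exprn_ge0 ?cabs_ge0.
rewrite powR_split // /carleson_kernel.
set P := _ `^ _; have P0 : 0 <= P by rewrite powR_ge0.
move: (Num.sqrt (1 - t)) (Num.sqrt (1 - cabs z)) (1 - t * cabs z) x0 s0 hd d0 => x y d x0 y0 hd d0.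
have -> : B * (P * x) * (d ^+ 2)^-1 = B * P / (y * d) * (x * y / d).
  by field; rewrite !gt_eqF.
have -> : B / y * (P / d) = B * P / (y * d) * 1.
  by field; rewrite !gt_eqF.
apply: ler_wpM2l; first by rewrite divr_ge0 ?mulr_ge0 // ltW.
by rewrite ler_pdivrMr // mul1r.
Qed.

Lemma cauchy_at0_bound : cabs (G 0) <= B * A.
Proof.
have hr : 0 <= (0 : R) < 1 by rewrite lexx ltr01.
have [ik hk] := carleson_Rint_le hr (ltW B0).
have d0 : udisc (0 : C) by rewrite /udisc /= cabs0.
have i3 := @cintegrable_cauchy R mu v idC iv (@cmeasurable_id R) (@cabs_unit_itv R) 0 d0.
apply: le_trans (cabs_cint_le mI (cintegrable_measurable i3) _ ik) _; last first.
  by apply: (le_trans hk); rewrite subr0 sqrtr1 divr1.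
move=> t It; have /andP[t0 t1] := unit_itvP It.
rewrite mulr0 subr0 divr1 (le_trans (hv It)) // /carleson_kernel mulr0 subr0 divr1.
rewrite ler_wpM2l ?(ltW B0) // powR_split ?subr_gt0 // ler_piMr ?powR_ge0 //.
by rewrite -[leRHS]sqrtr1 ler_wsqrtr //; lra.
Qed.

Lemma mobius_circle_continuous (a : C) (r s : R) : udisc a -> 0 <= r < 1 ->
  {for s, continuous (fun s => mobius a (r%:C * cis s))}.
Proof.
move=> da hr; have dz := @circle_in_disc R r s hr.
have FF : Filter (nbhs s) := nbhs_filter s.
have cc : (fun s' => r%:C * cis s' : C) @ s --> (r%:C * cis s : C).
  by apply: cvgM; [exact: cvg_cst|exact: cis_continuous].
have cn := @cvgB _ C _ (nbhs s) FF _ _ _ _ (cvg_cst (FF := FF) a) cc.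
have cd := @cvgB _ C _ (nbhs s) FF _ _ _ _ (cvg_cst (FF := FF) (1 : C))
  (@cvgM _ _ (nbhs s) FF _ _ _ _ (cvg_cst (FF := FF) a^*) cc).
have ci := @cvgV _ _ (nbhs s) FF _ _ (mobius_den_neq0 da dz) cd.
exact: (@cvgM _ _ (nbhs s) FF _ _ _ _ cn ci).
Qed.

Lemma cauchy_hardy_bound (a : C) : udisc a ->
  (hardy2_norm (fun z => G (mobius a z) - G a)%R <= (2 * A * B)%:E)%E.
Proof.
move=> da; apply: hardy2_norm_le; first by rewrite !mulr_ge0 // ltW.
move=> r hr; have /andP[r0 r1] := hr.
pose rho := cabs a; have rho0 : 0 <= rho := cabs_ge0 a.
have rho1 : rho < 1 := da.
have hrho : 0 <= rho < 1 by rewrite rho0.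
pose delta := 1 - rho; have d0 : 0 < delta by rewrite subr_gt0.
have sd0 : 0 < Num.sqrt delta by rewrite sqrtr_gt0.
pose W (t : measurableTypeR R) : R := B * (1 - t) `^ (1 - alpha).
(* A majorant of the H^2 norm of the kernel difference; the 2 is the root of the 4 in 1 - rho^2 <= 4
   delta. The absolute value keeps [k] nonnegative for every real [t], as [minkowski_circle]
   asks. *)
pose k (t : measurableTypeR R) : R :=
  2 * Num.sqrt delta * (1 - t) `^ (- 2^-1) * `|1 - t * rho|^-1.
pose num : R := 1 - rho ^+ 2.
have num0 : 0 < num by rewrite subr_gt0 exprn_ilt1.
pose D (p : measurableTypeR R * measurableTypeR R) : C :=
  (1 - p.1%:C * a) * ((1 - p.1%:C * a) - (a^* - p.1%:C) * (r%:C * cis p.2)).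
pose K (p : measurableTypeR R * measurableTypeR R) : R := num * (cabs (D p))^-1.
have m1t : measurable_fun setT (fun t : measurableTypeR R => 1 - t).
  by apply: measurable_funB; [exact: measurable_cst|exact: measurable_id].
have mW : measurable_fun setT W.
  by apply: measurable_funM; [exact: measurable_cst|exact: measurable_fun_powR].
have mk : measurable_fun setT k.
  apply: measurable_funM.
    by apply: measurable_funM; [exact: measurable_cst|exact: measurable_fun_powR].
  apply: measurable_fun_pinv => //.
  apply: measurableT_comp => //; apply: measurable_funB; first exact: measurable_cst.
  by apply: measurable_funM; [exact: measurable_id|exact: measurable_cst].
have mcst (c : C) : cmeasurable setT (fun _ : measurableTypeR R * measurableTypeR R => c).
  exact: cmeasurable_cst.
have mp1 : cmeasurable setT (fun p : measurableTypeR R * measurableTypeR R => p.1%:C).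
  by apply: cmeasurable_real; exact: measurable_fst.
have mp2 : cmeasurable setT (fun p : measurableTypeR R * measurableTypeR R => cis p.2).
  have [c1 c2] := @ccontinuous_measurable R _ setT measurableT (@cis_continuous R).
  by split; [exact: measurableT_comp c1 measurable_snd|exact: measurableT_comp c2 measurable_snd].
have mD1 : cmeasurable setT (fun p : measurableTypeR R * measurableTypeR R => 1 - p.1%:C * a).
  by apply: cmeasurableB => //; exact: cmeasurableM.
have mK : measurable_fun setT K.
  apply: measurable_funM; first exact: measurable_cst.
  apply: measurable_fun_pinv => [p _|]; first exact: cabs_ge0.
  apply: measurable_fun_cabs; apply: cmeasurableM => //; apply: cmeasurableB => //.
  by apply: cmeasurableM; [exact: cmeasurableB|exact: cmeasurableM].
have dz s : udisc (r%:C * cis s) by exact: circle_in_disc.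
have dm s : udisc (mobius a (r%:C * cis s)) by exact: mobius_disc.
have mh : measurable_fun arc
    (fun s => cabs (G (mobius a (circle_point r s)) - G a)).
  apply: measurable_fun_cabs; apply: cmeasurableB; last exact: cmeasurable_cst.
  have -> : (fun s => G (mobius a (circle_point r s))) =
      G \o (fun s => mobius a (r%:C * cis s)).
    by apply/funext => s; rewrite circle_pointE.
  apply: (ccontinuous_measurable mA) => s.
  have cG : {for mobius a (r%:C * cis s), continuous G}.
    apply: derivable_continuous.
    by have [] := @cauchy_integral_derive R mu v idC iv (@cmeasurable_id R)
      (@cabs_unit_itv R) _ (dm s).
  exact: (continuous_comp (@mobius_circle_continuous a r s da hr) cG).
have tpos t : I t -> 0 < 1 - t * rho.
  by move=> /unit_itvP /andP[t0 t1]; nra.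
apply: (@minkowski_circle R mu W k K _ _ mW mk mK mh).
- by move=> t; rewrite mulr_ge0 ?powR_ge0 // ltW.
- by move=> t; rewrite !mulr_ge0 ?powR_ge0 ?invr_ge0 // ltW.
- move=> t It; have /andP[t0 t1] := unit_itvP It.
  rewrite !mulr_gt0 ?powR_gt0 ?subr_gt0 // invr_gt0 normr_gt0 gt_eqF //; exact: tpos.
- by move=> p; rewrite mulr_ge0 ?invr_ge0 ?cabs_ge0 // ltW.
- by move=> s; exact: cabs_ge0.
- by rewrite !mulr_gt0.
- have [ik hk] := hA hrho.
  (* In W k the powers of 1 - t combine to the Carleson kernel at rho, and the square root of
     [delta] in front cancels the one in its integral bound: the result does not depend on [a]. *)
  have -> : (\int[mu]_(t in I) (W t * k t)%:E =
     \int[mu]_(t in I) ((2 * B * Num.sqrt delta)%:E * (carleson_kernel alpha rho t)%:E))%E.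
    apply: eq_integral => t /set_mem It; have /andP[t0 t1] := unit_itvP It.
    have t1' : 0 < 1 - t by lra.
    rewrite -EFinM; congr EFin; rewrite /W /k gtr0_norm ?tpos //.
    rewrite powR_split // powRN powR12_sqrt ?(ltW t1') // /carleson_kernel.
    have x0 : Num.sqrt (1 - t) != 0 by rewrite gt_eqF // sqrtr_gt0.
    have y0 : 1 - t * rho != 0 by rewrite gt_eqF // tpos.
    by field; rewrite x0 y0.
  have e0 : 0 <= 2 * B * Num.sqrt delta by rewrite !mulr_ge0 // ltW.
  rewrite ge0_integralZl //; last 2 first.
  + by apply/measurable_EFinP; exact: measurable_carleson_kernel.
  + by move=> t It; rewrite lee_fin carleson_kernel_ge0.
  apply: (le_trans (lee_wpmul2l _ hk)); first by rewrite lee_fin.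
  rewrite -EFinM lee_fin le_eqVlt; apply/orP; left; apply/eqP.
  by field; rewrite gt_eqF.
- move=> t It; have ht := unit_itvP It; have /andP[t0 t1] := ht.
  have [n1 _ _] := mobius_kernel_diff da (dz 0) ht.
  (* On the circle, K(t, .)^2 is a constant times the Poisson-type kernel with parameter b r. The
     modulus of [b] is controlled by |1 - t a|^2 (1 - |b|^2) = (1 - |a|^2) (1 - t^2). *)
  pose b := (a^* - t%:C) / (1 - t%:C * a).
  have c10 : 0 < cabs (1 - t%:C * a) by rewrite lt_neqAle cabs_ge0 andbT eq_sym cabs_eq0.
  have den : 1 - t * rho <= cabs (1 - t%:C * a).
    by apply: le_trans (lerB_cabs1 _); rewrite cabsM cabs_real ger0_norm.
  have bid : cabs (1 - t%:C * a) ^+ 2 * (1 - cabs b ^+ 2) = num * (1 - t ^+ 2).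
    have -> : cabs b = cabs (a^* - t%:C) / cabs (1 - t%:C * a) by rewrite cabsM cabsV.
    have h := mobius_identity a t%:C; rewrite cabs_real ger0_norm // in h.
    have e1 : cabs (1 - a^* * t%:C) = cabs (1 - t%:C * a).
      by rewrite -[LHS]cabsJ rmorphB rmorph1 rmorphM [X in X * _]conjcK
        [X in _ * X]conjc_real mulrC.
    have e2 : cabs (a - t%:C) = cabs (a^* - t%:C).
      by rewrite -[LHS]cabsJ rmorphB [X in _ - X]conjc_real.
    rewrite e1 e2 in h; rewrite -h exprMn exprVn mulrBr mulr1 mulrCA mulfV ?mulr1 //.
    by rewrite expf_neq0 // gt_eqF.
  have b2 : 0 < 1 - cabs b ^+ 2.
    have h : 0 < cabs (1 - t%:C * a) ^+ 2 * (1 - cabs b ^+ 2).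
      by rewrite bid mulr_gt0 // subr_gt0 exprn_ilt1.
    by rewrite -(pmulr_rgt0 _ (exprn_gt0 2 c10)).
  have b1 : cabs b < 1.
    by rewrite -(@ltr_pXn2r _ 2) ?nnegrE ?cabs_ge0 // expr1n -subr_gt0.
  have q1 : cabs (b * r%:C) < 1.
    by rewrite cabsM cabs_real ger0_norm //; have := cabs_ge0 b; nra.
  have KE s : K (t, s) ^+ 2 = num ^+ 2 / cabs (1 - t%:C * a) ^+ 4 *
      (cabs (1 - b * r%:C * cis s) ^+ 2)^-1.
    have -> : K (t, s) = num / cabs (1 - t%:C * a) ^+ 2 * (cabs (1 - b * r%:C * cis s))^-1.
      rewrite /K /D /=.
      have -> : (1 - t%:C * a) - (a^* - t%:C) * (r%:C * cis s) =
          (1 - t%:C * a) * (1 - b * r%:C * cis s).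
        by rewrite /b; field.
      by rewrite !cabsM !invfM; ring.
    by rewrite exprMn exprMn !exprVn -exprM.
  have -> : (\int[leb]_(s in arc) (K (t, s) ^+ 2)%:E =
     \int[leb]_(s in arc) ((num ^+ 2 / cabs (1 - t%:C * a) ^+ 4)%:E *
        ((cabs (1 - b * r%:C * cis s) ^+ 2)^-1)%:E))%E.
    by apply: eq_integral => s _; rewrite KE EFinM.
  have [mP _] := integrableP _ _ _ (integrable_poisson q1).
  have c0 : 0 <= num ^+ 2 / cabs (1 - t%:C * a) ^+ 4.
    by rewrite divr_ge0 // exprn_ge0 // ?cabs_ge0 // ltW.
  rewrite ge0_integralZl ?lee_fin //; last first.
    by move=> s _; rewrite lee_fin invr_ge0 exprn_ge0 ?cabs_ge0.
  rewrite integral_poisson // -EFinM lee_fin.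
  (* Replacing b r by [b] only enlarges the Poisson integral and makes the bound uniform in [r]. *)
  have qb : cabs (b * r%:C) ^+ 2 <= cabs b ^+ 2.
    rewrite lerXn2r ?nnegrE ?cabs_ge0 // cabsM cabs_real ger0_norm //.
    by rewrite ler_piMr ?cabs_ge0 // ltW.
  have pi0 := @twopi_gt0 R.
  have e1 : num ^+ 2 / cabs (1 - t%:C * a) ^+ 4 / (1 - cabs b ^+ 2) =
      num / (cabs (1 - t%:C * a) ^+ 2 * (1 - t ^+ 2)).
    have -> : num / (cabs (1 - t%:C * a) ^+ 2 * (1 - t ^+ 2)) =
        num ^+ 2 / (cabs (1 - t%:C * a) ^+ 2 * (num * (1 - t ^+ 2))).
      have t2 : 1 - t ^+ 2 != 0 by rewrite gt_eqF // subr_gt0 exprn_ilt1.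
      by field; rewrite ?t2 ?(gt_eqF c10) ?(gt_eqF num0).
    by rewrite -bid; field; rewrite ?(gt_eqF b2) ?(gt_eqF c10).
  apply: (@le_trans _ _ (2 * pi * (num / (cabs (1 - t%:C * a) ^+ 2 * (1 - t ^+ 2))))).
    rewrite -e1 mulrCA ler_wpM2l ?(ltW pi0) // ler_wpM2l //.
    by rewrite lef_pV2 ?posrE //; lra.
  rewrite ler_wpM2l ?(ltW pi0) // /k gtr0_norm ?tpos //.
  have t1' : 0 < 1 - t by lra.
  have xt : ((1 - t) `^ (- 2^-1)) ^+ 2 = (1 - t)^-1.
    by rewrite powRN powR12_sqrt ?(ltW t1') // exprVn sqr_sqrtr // ltW.
  have xd : Num.sqrt delta ^+ 2 = delta by rewrite sqr_sqrtr // ltW.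
  rewrite !exprMn xt xd exprVn.
  have tp := tpos t It.
  have h1 : num <= 2 ^+ 2 * delta.
    by rewrite /num /delta; have := rho0; have := rho1; nra.
  have h2 : (1 - t * rho) ^+ 2 * (1 - t) <= cabs (1 - t%:C * a) ^+ 2 * (1 - t ^+ 2).
    apply: ler_pM; rewrite ?exprn_ge0 ?(ltW tp) ?(ltW t1') //; last by nra.
    by rewrite lerXn2r ?nnegrE ?cabs_ge0 // ltW.
  have h3 : 0 < (1 - t * rho) ^+ 2 * (1 - t) by rewrite mulr_gt0 ?exprn_gt0.
  have -> : 2 ^+ 2 * delta * (1 - t)^-1 * ((1 - t * rho) ^+ 2)^-1 =
      2 ^+ 2 * delta * ((1 - t * rho) ^+ 2 * (1 - t))^-1.
    by field; rewrite (gt_eqF t1') (gt_eqF tp).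
  apply: ler_pM; rewrite ?(ltW num0) ?invr_ge0 ?(le_trans (ltW h3)) //.
  by rewrite lef_pV2 ?posrE //; exact: lt_le_trans h3 h2.
- move=> s _; rewrite circle_pointE.
  have i1 := @cintegrable_cauchy R mu v idC iv (@cmeasurable_id R) (@cabs_unit_itv R) _ (dm s).
  have i2 := @cintegrable_cauchy R mu v idC iv (@cmeasurable_id R) (@cabs_unit_itv R) _ da.
  have i3 := cintegrableB mI i1 i2.
  have i4 := cintegrable_cabs mI i3.
  have h := cabs_cint mI i3; rewrite cintB // in h.
  apply: (@le_trans _ _ (\int[mu]_(t in I)
     (cabs (v t / (1 - idC t * mobius a (r%:C * cis s)) - v t / (1 - idC t * a)))%:E)%E).
    move: h; rewrite -lee_fin /Rintegral fineK //.
    exact: (integrable_fin_num mI i4).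
  apply: ge0_le_integral => //.
  + by move=> t _; rewrite lee_fin cabs_ge0.
  + apply/measurable_EFinP; apply: measurable_fun_cabs; exact: cintegrable_measurable i3.
  + apply/measurable_EFinP; apply: measurable_funM; first exact: measurable_funTS.
    have mp : measurable_fun setT (fun t : measurableTypeR R => (t, s : measurableTypeR R)).
      by apply: measurable_fun_pair; [exact: measurable_id|exact: measurable_cst].
    by apply: measurable_funTS; exact: measurableT_comp mK mp.
  + move=> t It; have ht := unit_itvP It; have /andP[t0 t1] := ht.
    rewrite lee_fin -mulrBr cabsM.
    have [n1 n2 ->] := mobius_kernel_diff da (dz s) ht.
    apply: ler_pM; rewrite ?cabs_ge0 //; first exact: hv.
    rewrite cabsN cabsM cabsV /K /D /= ler_wpM2r ?invr_ge0 ?cabs_ge0 //.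
    rewrite !cabsM cabs_cis mulr1 !cabs_real (ger0_norm t0) (ger0_norm r0).
    have -> : cabs (1 - (cabs a ^+ 2)%:C) = num.
      rewrite (_ : 1 - _ = num%:C); last by rewrite rmorphB rmorph1.
      by rewrite cabs_real gtr0_norm.
    by rewrite mulrAC ler_piMl ?(ltW num0) // mulr_ile1 // ltW.
Qed.

End carleson_upper.

(** * Sufficiency of the Carleson condition *)

Section carleson_sufficient.
Context {R : realType}.
Local Notation C := R[i].
Variable mu : {finite_measure set (measurableTypeR R) -> \bar R}.
Local Notation I := (@unit_itv R).
Let mI := @measurable_unit_itv R.

(** The circle is taken halfway between t and the boundary. The growth of [f] there costs the power
    1 - alpha of 1 - rho, the Dirichlet kernel the power -1/2. *)
Lemma bloch_partial_sum (alpha B : R) (f : C -> C) (a : nat -> C) N (t : R) :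
  1 < alpha -> 0 < B -> analytic f -> (bloch_norm alpha f <= B%:E)%E ->
  power_series_on_disc a f -> I t ->
  cabs (\sum_(0 <= k < N) a k * t%:C ^+ k) <=
  2 * (B * (1 + (alpha - 1)^-1)) * 2^-1 `^ (1 / 2 - alpha) * carleson_kernel alpha 0 t.
Proof.
move=> al1 B0 af fB haf It; have /andP[t0 t1] := unit_itvP It.
pose x := (1 - t) / 2; have x0 : 0 < x by rewrite /x; lra.
pose rho := (1 + t) / 2; have rho1 : rho < 1 by rewrite /rho; lra.
have trho : t < rho by rewrite /rho; lra.
have rho0 : 0 < rho by lra.
pose B1 := B * (1 + (alpha - 1)^-1).
have B10 : 0 < B1 by rewrite mulr_gt0 // addr_gt0 // invr_gt0; lra.
have hM (z : C) : cabs z = rho -> cabs (f z) <= B1 * x `^ (1 - alpha).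
  move=> zr; have dz : udisc z by rewrite /udisc /= zr.
  apply: le_trans (bloch_growth al1 af fB dz) _.
  by rewrite zr /B1 (_ : 1 - rho = x) // /rho /x; lra.
have htr : 0 <= t < rho by rewrite t0.
apply: le_trans (partial_sum_bound N af haf htr rho1 hM) _.
have q0 : 0 <= t / rho by rewrite divr_ge0 // ltW.
(* Because 1 - x = rho, the claim t / rho <= 1 - x says t <= rho^2, which is AM-GM for 1 and t. *)
have hq : x <= 1 - (t / rho) ^+ 2.
  have q1 : t / rho <= 1 - x.
    by rewrite ler_pdivrMr // /x /rho; nra.
  have x1 : x <= 1 by rewrite /x; lra.
  by nra.
have sx : 0 < Num.sqrt x by rewrite sqrtr_gt0.
have hs : (Num.sqrt (1 - (t / rho) ^+ 2))^-1 <= (Num.sqrt x)^-1.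
  have hss : Num.sqrt x <= Num.sqrt (1 - (t / rho) ^+ 2) by rewrite ler_wsqrtr.
  by rewrite lef_pV2 ?posrE //; exact: lt_le_trans sx hss.
apply: (@le_trans _ _ (2 * (B1 * x `^ (1 - alpha)) / Num.sqrt x)).
  by apply: ler_wpM2l => //; rewrite mulr_ge0 // mulr_ge0 ?powR_ge0 // ltW.
rewrite le_eqVlt; apply/orP; left; apply/eqP.
rewrite powR_split // /carleson_kernel mulr0 subr0 divr1.
have -> : x `^ (1 / 2 - alpha) = 2^-1 `^ (1 / 2 - alpha) * (1 - t) `^ (1 / 2 - alpha).
  by rewrite -powRM ?invr_ge0 ?subr_ge0 ?(ltW t1) // /x mulrC.
by rewrite -/B1; field; rewrite gt_eqF.
Qed.

Lemma carleson_estimates (alpha : R) : 1 < alpha -> carleson mu alpha ->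
  exists2 K : R, 0 < K & forall (f : C -> C) (a : nat -> C) (B : R),
    0 < B -> analytic f -> (bloch_norm alpha f <= B%:E)%E -> power_series_on_disc a f ->
    (exists2 g0 : measurableTypeR R -> R, mu.-integrable I (EFin \o g0) &
      forall N t, I t -> cabs (\sum_(0 <= k < N) a k * t%:C ^+ k) <= g0 t) /\
    (forall g, (forall z, udisc z -> g z = hankel_integral mu f z) ->
      (bloch_norm 1 g <= (K * B)%:E)%E /\ (bmoa_norm g <= (K * B)%:E)%E).
Proof.
move=> al1 /(carleson_Rintegral al1) [A A0 hA].
pose c := 1 + (alpha - 1)^-1.
have c0 : 0 < c by rewrite addr_gt0 // invr_gt0; lra.
(* For both norms one unit of c A B bounds the value at 0 and two units bound the seminorm. *)
exists (3 * c * A); first by rewrite !mulr_gt0.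
move=> f a B B0 af fB haf.
pose c2 := 2 * (B * c) * 2^-1 `^ (1 / 2 - alpha).
pose g0 (t : measurableTypeR R) : R := c2 * carleson_kernel alpha 0 t.
have h01 : 0 <= (0 : R) < 1 by rewrite lexx ltr01.
have ig0 : mu.-integrable I (EFin \o g0).
  by have [ik _] := hA 0 h01; have h := integrableZl mI c2 ik; apply: eq_integrable h.
have dom N t : I t -> cabs (\sum_(0 <= k < N) a k * t%:C ^+ k) <= g0 t.
  by move=> It; exact: (bloch_partial_sum N al1 B0 af fB haf It).
split; first by exists g0.
move=> g hg.
have iv := cintegrable_restriction haf ig0 dom.
have Bc0 : 0 < B * c by rewrite mulr_gt0.
have hv t : I t -> cabs (f t%:C) <= B * c * (1 - t) `^ (1 - alpha).
  move=> It; have /andP[t0 t1] := unit_itvP It.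
  apply: le_trans (bloch_growth al1 af fB (udisc_unit_itv It)) _.
  by rewrite cabs_real ger0_norm.
have d0 : udisc (0 : C) by rewrite /udisc /= cabs0.
have b0 : cabs (g 0) <= B * c * A.
  by rewrite hg //; exact: (cauchy_at0_bound Bc0 hA iv hv).
split.
  apply/bloch_normP; exists (2 * (B * c * A)); first by lra.
  move=> z dz.
  have aG := hankel_integral_analytic haf ig0 dom.
  have [_ ->] := @eq_on_disc_derive R _ g z (fun w dw => esym (hg w dw)) dz (aG z dz).
  have h := cauchy_deriv_bound Bc0 hA iv hv dz.
  have z1 : cabs z < 1 := dz; have z0 := cabs_ge0 z.
  have zz : 0 <= 1 - cabs z ^+ 2 by rewrite subr_ge0 exprn_ile1 // ltW.
  rewrite powRr1 //.
  apply: le_trans (ler_wpM2r zz h) _.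
  have -> : 1 - cabs z ^+ 2 = (1 - cabs z) * (1 + cabs z) by ring.
  have n1 : 1 - cabs z != 0 by rewrite gt_eqF // subr_gt0.
  rewrite [leLHS](_ : _ = B * c * A * (1 + cabs z)); last by field.
  rewrite [leRHS]mulrC ler_wpM2l ?mulr_ge0 ?(ltW B0) ?(ltW c0) ?(ltW A0) //; lra.
apply: (@le_trans _ _ ((B * c * A)%:E + (2 * A * (B * c))%:E)%E); last first.
  by rewrite -EFinD lee_fin le_eqVlt; apply/orP; left; apply/eqP; ring.
apply: leeD; first by rewrite lee_fin.
apply: ge_ereal_sup => _ [b db <-].
have -> : hardy2_norm (fun z => g (mobius b z) - g b) =
    hardy2_norm (fun z => hankel_integral mu f (mobius b z) - hankel_integral mu f b).
  congr ereal_sup; apply: eq_imagel => r; rewrite /= in_itv /= => hr.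
  congr ((_ * _) `^ _)%E; apply: eq_integral => s _.
  have ds : udisc (circle_point r s) by rewrite circle_pointE; exact: circle_in_disc.
  by rewrite !hg //; exact: mobius_disc.
exact: (cauchy_hardy_bound A0 Bc0 hA iv hv db).
Qed.

(** The target norm is abstract so that Bloch and BMOA share the argument. A finite Bloch norm
    bounds the derivative locally, which provides the expansion that [hankel_graph] asks for. *)
Lemma hankel_bounded_of_estimates (alpha K : R) (NY : (C -> C) -> \bar R) :
  1 < alpha -> 0 < K ->
  (forall (f : C -> C) (a : nat -> C) (B : R),
    0 < B -> analytic f -> (bloch_norm alpha f <= B%:E)%E -> power_series_on_disc a f ->
    (exists2 g0 : measurableTypeR R -> R, mu.-integrable I (EFin \o g0) &
      forall N t, I t -> cabs (\sum_(0 <= k < N) a k * t%:C ^+ k) <= g0 t) /\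
    (forall g, (forall z, udisc z -> g z = hankel_integral mu f z) ->
      (NY g <= (K * B)%:E)%E)) ->
  hankel_bounded mu (bloch_norm alpha) NY.
Proof.
move=> al1 K0 est.
have norm0 f : (0 <= bloch_norm alpha f)%E.
  rewrite adde_ge0 ?lee_fin ?cabs_ge0 //.
  apply: (@le_trans _ _ (cabs (derive1 f 0) * (1 - cabs (0:C) ^+ 2) `^ alpha)%:E).
    by rewrite lee_fin mulr_ge0 ?cabs_ge0 ?powR_ge0.
  apply: ereal_sup_ubound; exists (0 : C) => //.
  by rewrite /udisc /= cabs0.
have fin f : in_space (bloch_norm alpha) f -> bloch_norm alpha f \is a fin_num.
  by move=> [_ h]; rewrite ge0_fin_numE.
have le_fine f (e : R) : in_space (bloch_norm alpha) f -> 0 < e ->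
    0 < fine (bloch_norm alpha f) + e /\
    (bloch_norm alpha f <= (fine (bloch_norm alpha f) + e)%:E)%E.
  move=> hf e0; split; first by rewrite ltr_wpDl // fine_ge0.
  by rewrite EFinD fineK ?fin // leeDl // lee_fin ltW.
split.
- move=> f hf; have [B0 fB] := le_fine f 1 hf ltr01.
  have [af _] := hf.
  have [a haf] := analytic_power_series af (bloch_lbd (ltW (lt_trans ltr01 al1)) fB).
  have [[g0 ig0 dom] hg] := est f a _ B0 af fB haf.
  exists (hankel_integral mu f); first exact: (hankel_integral_graph haf ig0 dom).
  split; first exact: (hankel_integral_analytic haf ig0 dom).
  by apply: le_lt_trans (hg _ _) (ltry _).
- exists K => f g hf [a [haf _ hg ag]].
  have [af _] := hf; rewrite -(fineK (fin f hf)) -EFinM.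
  (* The estimates ask for B > 0, while the norm of [f] may be 0. Taking B larger than the norm by e
     / K costs exactly [e] after multiplication by [K]. *)
  apply/lee_addgt0Pr => e e0.
  have [B0 fB] := le_fine f (e / K) hf (divr_gt0 e0 K0).
  have [[g0 ig0 dom] h] := est f a _ B0 af fB haf.
  apply: le_trans (h g (hankel_integral_unique haf ig0 dom hg)) _.
  by rewrite -EFinD lee_fin mulrDr [K * (e / K)]mulrC divfK // gt_eqF.
Qed.

Lemma carleson_hankel_bounded (alpha : R) : 1 < alpha -> carleson mu alpha ->
  hankel_bounded mu (bloch_norm alpha) (bloch_norm 1) /\
  hankel_bounded mu (bloch_norm alpha) bmoa_norm.
Proof.
move=> al1 /(carleson_estimates al1) [K K0 est]; split.
- apply: (hankel_bounded_of_estimates al1 K0) => f a B B0 af fB haf.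
  by have [h1 h2] := est f a B B0 af fB haf; split => // g /h2 [].
- apply: (hankel_bounded_of_estimates al1 K0) => f a B B0 af fB haf.
  by have [h1 h2] := est f a B B0 af fB haf; split => // g /h2 [].
Qed.

End carleson_sufficient.

(** * Necessity of the Carleson condition *)

Section monomial_test.
Context {R : realType}.
Local Notation C := R[i].
Local Notation leb := (@lebesgue_measure R).

Lemma monomial_derive n (z : C) : derivable (fun w : C => w ^+ n.+1) z 1 /\
  derive1 (fun w : C => w ^+ n.+1) z = n.+1%:R * z ^+ n.
Proof. by split; [exact: exprn_derivable|exact: exp_derive1]. Qed.

(** The inequality u <= exp u at u = y / alpha, raised to the power alpha. *)
Lemma powR_le_expR (alpha y : R) : 0 < alpha -> 0 <= y ->
  y `^ alpha <= alpha `^ alpha * expR y.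
Proof.
move=> al0 y0.
have h : y / alpha <= expR (y / alpha) by have := expR_ge1Dx (y / alpha); lra.
have h0 : 0 <= y / alpha by rewrite divr_ge0 // ltW.
have := ge0_ler_powR (ltW al0) h0 (expR_ge0 (y / alpha)) h.
rewrite -expRM divfK ?gt_eqF // => h2.
have -> : y `^ alpha = alpha `^ alpha * (y / alpha) `^ alpha.
  by rewrite -powRM ?(ltW al0) // mulrC divfK // gt_eqF.
by rewrite ler_wpM2l ?powR_ge0.
Qed.

(** No maximum is computed. With M = n + 1, |z|^n is at most e exp(- M (1 - |z|)), while (M (1 -
    |z|))^alpha is at most alpha^alpha exp(M (1 - |z|)), and the exponentials cancel. The factor e
    pays for the exponent n in place of M. *)
Lemma bloch_norm_monomial (alpha : R) n : 0 < alpha ->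
  (bloch_norm alpha (fun w : C => w ^+ n.+1)%R <=
   (expR 1 * (2 * alpha) `^ alpha * n.+1%:R `^ (1 - alpha))%:E)%E.
Proof.
move=> al0; apply/bloch_normP; eexists; first by rewrite expr0n /= cabs0 add0r.
move=> z dz; have [_ ->] := monomial_derive n z.
have y0 := cabs_ge0 z; have y1 : cabs z < 1 := dz.
rewrite cabsM cabsX; move: (cabs z) y0 y1 => y y0 y1.
have -> : cabs (n.+1%:R : C) = n.+1%:R.
  by rewrite (_ : n.+1%:R = n.+1%:R%:C) ?cabs_real ?ger0_norm // rmorph_nat.
pose M : R := n.+1%:R; have M0 : 0 < M by rewrite ltr0n.
have h1 : (1 - y ^+ 2) `^ alpha <= (2 / M * (M * (1 - y))) `^ alpha.
  have -> : 2 / M * (M * (1 - y)) = 2 * (1 - y) by field; rewrite gt_eqF.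
  by apply: (ge0_ler_powR (ltW al0)); rewrite ?nnegrE; nra.
rewrite powRM ?divr_ge0 ?mulr_ge0 ?subr_ge0 ?(ltW M0) ?(ltW y1) // in h1.
have h2 : (M * (1 - y)) `^ alpha <= alpha `^ alpha * expR (M * (1 - y)).
  by apply: powR_le_expR => //; rewrite mulr_ge0 ?subr_ge0 ?(ltW M0) ?(ltW y1).
have h3 : y ^+ n <= expR 1 * expR (- (M * (1 - y))).
  have e1 : y <= expR (- (1 - y)) by have := expR_ge1Dx (- (1 - y)); lra.
  have e2 : y ^+ n <= expR (- (1 - y)) ^+ n by rewrite lerXn2r ?nnegrE ?expR_ge0.
  apply: (le_trans e2); rewrite -expRM_natl -expRD ler_expR /M -natr1; lra.
have h4 : (2 / M) `^ alpha = 2 `^ alpha * M `^ (- alpha).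
  by rewrite powRM ?invr_ge0 ?(ltW M0) // powRN -powR_inv1 ?(ltW M0) // -powRrM mulN1r powRN.
apply: (@le_trans _ _ (M * (expR 1 * expR (- (M * (1 - y)))) *
    ((2 / M) `^ alpha * (alpha `^ alpha * expR (M * (1 - y)))))).
  apply: ler_pM; rewrite ?mulr_ge0 ?exprn_ge0 ?powR_ge0 ?(ltW M0) //.
    by apply: ler_wpM2l => //; exact: ltW.
  by apply: (le_trans h1); apply: ler_wpM2l; rewrite ?powR_ge0.
rewrite h4 -/M powRM ?(ltW al0) //.
have -> : M `^ (1 - alpha) = M * M `^ (- alpha).
  by rewrite powRD ?powRr1 ?(ltW M0) // (gt_eqF M0) implybT.
rewrite le_eqVlt; apply/orP; left; apply/eqP.
have e0 : expR (- (M * (1 - y))) = (expR (M * (1 - y)))^-1 by rewrite expRN.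
by rewrite e0; field; rewrite gt_eqF // expR_gt0.
Qed.

(** [hankel_graph] supplies some expansion of the monomial, not a chosen one, so its coefficients
    have to be identified. *)
Lemma monomial_coefficient (a : nat -> C) n k :
  power_series_on_disc a (fun w : C => w ^+ n) -> a k = (k == n)%:R.
Proof.
move=> ha.
have hr : 0 <= (1 / 2 : R) < 1 by apply/andP; split; lra.
have h := @power_series_coefficient R a (fun w : C => w ^+ n) 1 (1 / 2) k ha hr.
have r0 : (1 / 2 : R)%:C != 0 by rewrite (inj_eq (@complexI R) _ 0) gt_eqF //; lra.
have rk : (1 / 2 : R)%:C ^+ k != 0 by rewrite expf_neq0.
apply: (mulIf rk); rewrite -h.
have E s : ((1 / 2 : R)%:C * cis s) ^+ n * (cis s)^* ^+ k =
    (1 / 2 : R)%:C ^+ n * (cis s ^+ n * (cis s)^* ^+ k) by rewrite exprMn mulrA.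
under eq_fun do rewrite E.
rewrite /cmean cintZl; first last.
- apply: (@cintegrable_arc_bounded R _ 1).
    apply: cmeasurableM; apply: cmeasurableX; first exact: cis_measurable.
    by apply: cmeasurableJ; exact: cis_measurable.
  by move=> s; rewrite cabsM !cabsX cabsJ cabs_cis !expr1n mulr1.
- exact: measurable_arc.
rewrite mulrCA; have := @cmean_orthogonal R n k; rewrite /cmean => ->.
by rewrite eq_sym; case: eqVneq => [->|_]; rewrite ?mulr1 ?mul1r ?mulr0 ?mul0r.
Qed.

Lemma monomial_partial_sum (a : nat -> C) n N (t : R) :
  power_series_on_disc a (fun w : C => w ^+ n) -> unit_itv t ->
  cabs (\sum_(0 <= k < N) a k * t%:C ^+ k) <= 1.
Proof.
move=> ha It; have c1 := cabs_unit_itv It.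
rewrite (eq_bigr (fun k => if k == n then t%:C ^+ n else 0)); last first.
  move=> k _; rewrite (monomial_coefficient k ha).
  by case: eqVneq => [->|_]; rewrite ?mul1r ?mul0r.
rewrite big_mkord -big_mkcond /=.
have [nN|Nn] := ltnP n N.
  rewrite (big_pred1 (Ordinal nN)) /=; last by move=> i.
  by rewrite cabsX exprn_ile1 ?cabs_ge0.
rewrite big_pred0 ?cabs0 // => i; apply/negbTE; rewrite neq_ltn.
by rewrite (leq_trans (ltn_ord i) Nn).
Qed.

Lemma bernoulli_inequality (x : R) n : 0 <= x <= 1 -> 1 - n%:R * x <= (1 - x) ^+ n.
Proof.
move=> /andP[x0 x1]; elim: n => [|n ih]; first by rewrite mul0r subr0 expr0.
have h : (1 - x) * (1 - n%:R * x) <= (1 - x) ^+ n.+1.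
  by rewrite exprS ler_wpM2l // subr_ge0.
apply: le_trans h; rewrite -natr1.
have n0 : 0 <= n%:R :> R by [].
by have := mulr_ge0 n0 (sqr_ge0 x); nra.
Qed.

End monomial_test.

(** * The Carleson condition from monomials, and the Bloch case *)

Section carleson_necessary.
Context {R : realType}.
Local Notation C := R[i].
Local Notation leb := (@lebesgue_measure R).
Variable mu : {finite_measure set (measurableTypeR R) -> \bar R}.
Local Notation I := (@unit_itv R).
Local Notation arc := (@arc R).
Let mI := @measurable_unit_itv R.
Let idC (t : measurableTypeR R) : C := t%:C.
Let mon n (t : measurableTypeR R) : C := t%:C ^+ n.

(** The derivative at [s] of the image of z^n, differentiated under the integral. *)
Definition test_derivative n (s : R) : C :=
  cint mu I (fun t : measurableTypeR R => t%:C ^+ n * t%:C / (1 - t%:C * s%:C) ^+ 2).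

(** The integrand is nonnegative, so the integral may be cut to [s, 1). There t^n >= 1/2 by
    Bernoulli, t >= 1/2, and 1 - t s <= 2 (1 - s), whence the constant 1/16. *)
Lemma test_derivative_ge n (s : R) : 1 / 2 <= s < 1 -> n%:R * (1 - s) <= 1 / 2 ->
  (fine (mu `[s, 1%R[%classic)) / (16 * (1 - s) ^+ 2) <= cabs (test_derivative n s).
Proof.
move=> /andP[s2 s1] hn; have x0 : 0 < 1 - s by lra.
have ds : udisc s%:C by rewrite /udisc /= cabs_real ger0_norm //; lra.
have ii := @cintegrable_cauchy_deriv R mu (mon n) idC (cintegrable_monomial mu n)
  (@cmeasurable_id R) (@cabs_unit_itv R) s%:C ds.
apply: le_trans (le_trans (ler_norm _) (ler_Re_cabs _)).
rewrite Re_cint; have [ir _] := ii.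
pose c := (16 * (1 - s) ^+ 2)^-1.
have c0 : 0 <= c by rewrite invr_ge0 mulr_ge0 // exprn_ge0 // ltW.
pose S : set (measurableTypeR R) := `[s, 1%R[%classic.
have mS : measurable S by exact: measurable_itv.
have SI : S `<=` I.
  by move=> t; rewrite /S /unit_itv /= !in_itv /= => /andP[st ->]; rewrite andbT; lra.
have iS : mu.-integrable I (EFin \o (\1_S : measurableTypeR R -> R)).
  apply: (@le_integrableR _ _ _ _ _ mI _ (cst 1)).
  - exact: measurable_indic.
  - by move=> t _; rewrite indicE ger0_norm // lern1 leq_b1.
  - exact: finite_measure_integrable_cst.
have -> : fine (mu S) / (16 * (1 - s) ^+ 2) = \int[mu]_(t in I) (c * \1_S t).
  by rewrite RintegralZl // /Rintegral integral_indic // (setIidl SI) mulrC.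
apply: le_Rintegral => //.
  by have h := integrableZl mI c iS; apply: eq_integrable h.
move=> t It; have /andP[t0 t1] := unit_itvP It.
have -> : complex.Re (t%:C ^+ n * t%:C / (1 - t%:C * s%:C) ^+ 2) =
    t ^+ n * t / (1 - t * s) ^+ 2.
  have -> : t%:C ^+ n * t%:C / (1 - t%:C * s%:C) ^+ 2 =
      (t ^+ n * t / (1 - t * s) ^+ 2)%:C.
    by rewrite !rmorphM fmorphV !rmorphXn rmorphB rmorph1 rmorphM.
  by [].
rewrite indicE; have [tS|_] := boolP (t \in S); last first.
  by rewrite mulr0 divr_ge0 ?mulr_ge0 ?exprn_ge0 //; nra.
have st : s <= t.
  by move/set_mem: tS; rewrite /S /= in_itv /= => /andP[].
rewrite mulr1.
have h1 : 1 / 2 <= t ^+ n.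
  apply: (@le_trans _ _ (s ^+ n)); last by rewrite lerXn2r ?nnegrE //; lra.
  have hx : 0 <= 1 - s <= 1 by apply/andP; split; lra.
  have := bernoulli_inequality n hx; rewrite subKr; lra.
have h2 : 0 < 1 - t * s by nra.
have h3 : 1 - t * s <= 2 * (1 - s) by nra.
have h4 : (1 - t * s) ^+ 2 <= 4 * (1 - s) ^+ 2.
  have -> : 4 * (1 - s) ^+ 2 = (2 * (1 - s)) ^+ 2 by ring.
  by rewrite lerXn2r ?nnegrE //; lra.
have -> : c = 1 / 4 * (4 * (1 - s) ^+ 2)^-1 by rewrite /c; field; rewrite gt_eqF.
apply: ler_pM; rewrite ?invr_ge0 ?mulr_ge0 ?exprn_ge0 ?(ltW x0) //.
  by have := h1; move: (t ^+ n) => y hy; nra.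
by rewrite lef_pV2 ?posrE ?mulr_gt0 ?exprn_gt0.
Qed.

(** Boundedness enters only through one lower bound on the target norm, common to Bloch and BMOA. It
    is confronted with the decay n^(1 - alpha) of the Bloch type norm of z^n. *)
Lemma carleson_of_test_bound (alpha : R) (NY : (C -> C) -> \bar R) : 1 < alpha ->
  (forall n (s : R) g, 0 <= s < 1 ->
    (forall z, udisc z -> g z = hankel_integral mu (fun w : C => w ^+ n.+1) z) ->
    (((1 - s ^+ 2) / 2 * cabs (test_derivative n.+1 s))%:E <= NY g)%E) ->
  hankel_bounded mu (bloch_norm alpha) NY -> carleson mu alpha.
Proof.
move=> al1 low [ex [K hK]].
have al0 : 0 < alpha by lra.
pose Ca := expR 1 * (2 * alpha) `^ alpha.
have Ca0 : 0 < Ca by rewrite mulr_gt0 ?expR_gt0 // powR_gt0 // mulr_gt0.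
have tests n (s : R) : 0 <= s < 1 ->
    (1 - s ^+ 2) / 2 * cabs (test_derivative n.+1 s) <= `|K| * (Ca * n.+1%:R `^ (1 - alpha)).
  move=> hs; pose f (w : C) := w ^+ n.+1.
  have nf := @bloch_norm_monomial R alpha n al0.
  have hf : in_space (bloch_norm alpha) f.
    split; first by move=> z _; have [] := monomial_derive n z.
    by apply: le_lt_trans nf (ltry _).
  have [g gr _] := ex f hf; have hg := hK f g hf gr.
  have [a [haf _ ag _]] := gr.
  have ig0 : mu.-integrable I (EFin \o (cst 1 : measurableTypeR R -> R)).
    exact: finite_measure_integrable_cst.
  have dom N t : I t -> cabs (\sum_(0 <= k < N) a k * t%:C ^+ k) <= cst 1 t.
    exact: (@monomial_partial_sum R a n.+1 N t haf).
  have hgz := hankel_integral_unique haf ig0 dom ag.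
  have h := le_trans (low n s g hs hgz) hg.
  have norm0 : (0 <= bloch_norm alpha f)%E.
    rewrite adde_ge0 ?lee_fin ?cabs_ge0 //.
    apply: (@le_trans _ _ (cabs (derive1 f 0) * (1 - cabs (0:C) ^+ 2) `^ alpha)%:E).
      by rewrite lee_fin mulr_ge0 ?cabs_ge0 ?powR_ge0.
    by apply: ereal_sup_ubound; exists (0 : C) => //; rewrite /udisc /= cabs0.
  rewrite -lee_fin; apply: (le_trans h).
  (* The constant of boundedness comes with no sign; its absolute value makes the product monotone
     in the norm of [f]. *)
  apply: (@le_trans _ _ (`|K|%:E * bloch_norm alpha f)%E).
    by apply: lee_wpmul2r => //; rewrite lee_fin ler_norm.
  by rewrite EFinM; apply: lee_wpmul2l => //; rewrite lee_fin.
have fmu (S : set (measurableTypeR R)) : measurable S -> mu S \is a fin_num.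
  by move=> mS; exact: fin_num_measure.
pose M0 := fine (mu I); have M00 : 0 <= M0 by rewrite fine_ge0.
pose K1 := 64 * `|K| * Ca * 4 `^ alpha; have K10 : 0 <= K1.
  by rewrite !mulr_ge0 ?powR_ge0 // ltW.
pose K2 := M0 * 2 `^ alpha; have K20 : 0 <= K2 by rewrite mulr_ge0 ?powR_ge0.
(* [K2] handles t < 1/2 by the total mass, [K1] the other t; the summand 1 ensures positivity. *)
exists (K1 + K2 + 1); first by lra.
move=> t ht; have /andP[t0 t1] := ht.
pose S : set (measurableTypeR R) := `[t, 1%R[%classic.
have mS : measurable S by exact: measurable_itv.
rewrite -/S -(fineK (fmu S mS)) lee_fin.
pose x := 1 - t; have x0 : 0 < x by rewrite subr_gt0.
rewrite -/x; have xa : 0 <= x `^ alpha by rewrite powR_ge0.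
have mS0 : 0 <= fine (mu S) by rewrite fine_ge0.
have [t2|t2] := ltP t (1 / 2).
  have SI : fine (mu S) <= M0.
    rewrite fine_le ?fmu // le_measure ?inE // => s.
    by rewrite /S /unit_itv /= !in_itv /= => /andP[ts ->]; rewrite andbT; lra.
  have h : 1 <= 2 `^ alpha * x `^ alpha.
    rewrite -powRM ?(ltW x0) // -[leLHS](_ : 1 `^ alpha = 1); last by rewrite powR1.
    by apply: (ge0_ler_powR (ltW al0)); rewrite ?nnegrE /x; lra.
  have h2 : M0 * 1 <= M0 * (2 `^ alpha * x `^ alpha) by rewrite ler_wpM2l.
  have h3 : 0 <= K1 * x `^ alpha by rewrite mulr_ge0.
  by rewrite /K2 !mulrDl mul1r; lra.
(* The degree n + 1 is the integer part of y = 1 / (2 (1 - t)), which is at least 1 as t >= 1/2. It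
   satisfies the condition of [test_derivative_ge], and being at least y / 2 it makes the norm of
   the monomial as small as needed. *)
pose y := (2 * x)^-1; have y1 : 1 <= y.
  by rewrite -[leLHS]invr1 lef_pV2 ?posrE ?mulr_gt0 // /x; lra.
have [n hn1 hn2] : exists2 n, n.+1%:R <= y & y < n.+2%:R.
  have [m /andP[h1 h2]] : exists m, m%:R <= y < m.+1%:R.
    by exists (Num.truncn y); apply: truncn_itv; lra.
  case: m h1 h2 => [|m] h1 h2; last by exists m.
  by move: h2; lra.
have N1 : 1 <= n.+1%:R :> R by rewrite ler1n.
have xy : x * y = 1 / 2 by rewrite /y; field; rewrite gt_eqF.
have nx : n.+1%:R * (1 - t) <= 1 / 2.
  by rewrite -/x -xy mulrC ler_wpM2l // ltW.
have n4 : (4 * x)^-1 <= n.+1%:R.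
  have : (4 * x)^-1 = y / 2 by rewrite /y; field; rewrite gt_eqF.
  by move=> ->; move: hn2; rewrite -natr1; lra.
have ht' : 1 / 2 <= t < 1 by rewrite t2.
have h1 := test_derivative_ge ht' nx.
have h2 := tests n t ht.
have h3 : n.+1%:R `^ (1 - alpha) <= (4 * x) `^ (alpha - 1).
  have -> : (4 * x) `^ (alpha - 1) = ((4 * x)^-1) `^ (1 - alpha).
    rewrite -powR_inv1 ?mulr_ge0 ?(ltW x0) // -powRrM; congr (_ `^ _); ring.
  have -> : 1 - alpha = - (alpha - 1) by ring.
  rewrite !powRN lef_pV2 ?posrE ?powR_gt0 ?invr_gt0 ?mulr_gt0 //.
  have am : 0 <= alpha - 1 by lra.
  by apply: (ge0_ler_powR am); rewrite ?nnegrE ?invr_ge0 ?mulr_ge0 ?(ltW x0).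
have h4 : (4 * x) `^ (alpha - 1) * x <= 4 `^ alpha * x `^ alpha.
  have -> : 4 `^ alpha * x `^ alpha = (4 * x) `^ alpha by rewrite powRM // ltW.
  have -> : (4 * x) `^ alpha = (4 * x) `^ (alpha - 1) * (4 * x).
    rewrite -{3}[4 * x]powRr1 ?mulr_ge0 ?(ltW x0) // -powRD ?subrK //.
    by rewrite (gt_eqF (mulr_gt0 _ x0)) ?implybT.
  by rewrite ler_wpM2l ?powR_ge0 //; lra.
set T := cabs (test_derivative n.+1 t) in h1 h2.
have T0 : 0 <= T by rewrite cabs_ge0.
(* Boundedness makes x T of order x^(alpha - 1), and the mass of [t, 1) is at most of order x^2 T:
   together, x^alpha. *)
have h5 : x / 2 * T <= `|K| * (Ca * (4 * x) `^ (alpha - 1)).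
  apply: (@le_trans _ _ (`|K| * (Ca * n.+1%:R `^ (1 - alpha)))).
    by apply: le_trans h2; rewrite ler_wpM2r // /x; nra.
  by rewrite !ler_wpM2l // ltW.
have h6 : fine (mu S) <= T * (16 * x ^+ 2).
  by rewrite -ler_pdivrMr // mulr_gt0 // exprn_gt0.
have h7 : T * (16 * x ^+ 2) = 32 * x * (x / 2 * T) by field.
have h8 : 32 * x * (x / 2 * T) <= 32 * x * (`|K| * (Ca * (4 * x) `^ (alpha - 1))).
  by apply: ler_wpM2l => //; rewrite mulr_ge0 // ltW.
have h9 : 32 * x * (`|K| * (Ca * (4 * x) `^ (alpha - 1))) <= K1 * x `^ alpha.
  have -> : 32 * x * (`|K| * (Ca * (4 * x) `^ (alpha - 1))) =
     32 * `|K| * Ca * ((4 * x) `^ (alpha - 1) * x) by ring.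
  have -> : K1 * x `^ alpha = 64 * `|K| * Ca * (4 `^ alpha * x `^ alpha).
    by rewrite /K1; ring.
  apply: ler_pM => //; rewrite ?mulr_ge0 ?powR_ge0 ?(ltW x0) ?(ltW Ca0) //.
  by rewrite !ler_wpM2r ?(ltW Ca0) // ler_nat.
have h10 : 0 <= K2 * x `^ alpha by rewrite mulr_ge0.
by rewrite !mulrDl mul1r; lra.
Qed.

(** The supremum is evaluated at the single point [s]. The factor 1/2 is slack here, kept to match
    the form of the bound for BMOA. *)
Lemma bloch_test_bound n (s : R) g : 0 <= s < 1 ->
  (forall z, udisc z -> g z = hankel_integral mu (fun w : C => w ^+ n) z) ->
  (((1 - s ^+ 2) / 2 * cabs (test_derivative n s))%:E <= bloch_norm 1 g)%E.
Proof.
move=> /andP[s0 s1] hg.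
have ds : udisc s%:C by rewrite /udisc /= cabs_real ger0_norm.
have [dG dGE] := @cauchy_integral_derive R mu (mon n) idC (cintegrable_monomial mu n)
  (@cmeasurable_id R) (@cabs_unit_itv R) s%:C ds.
have [_ dg] := @eq_on_disc_derive R _ g s%:C (fun w dw => esym (hg w dw)) ds dG.
have hs : 0 <= 1 - s ^+ 2 by rewrite subr_ge0 exprn_ile1 // ltW.
apply: (@le_trans _ _ (bloch_seminorm 1 g)); last first.
  by rewrite /bloch_norm leeDr // lee_fin cabs_ge0.
apply: (@le_trans _ _ (cabs (derive1 g s%:C) * (1 - cabs s%:C ^+ 2) `^ 1)%:E).
  rewrite dg dGE cabs_real ger0_norm // powRr1 // lee_fin.
  rewrite mulrC ler_wpM2l ?cabs_ge0 //; lra.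
by apply: ereal_sup_ubound; exists s%:C.
Qed.

End carleson_necessary.

(** * The BMOA case of necessity *)

Section bmoa_necessary.
Context {R : realType}.
Local Notation C := R[i].
Local Notation leb := (@lebesgue_measure R).
Variable mu : {finite_measure set (measurableTypeR R) -> \bar R}.
Local Notation I := (@unit_itv R).
Local Notation arc := (@arc R).
Let mI := @measurable_unit_itv R.
Let mA := @measurable_arc R.
Let idC (t : measurableTypeR R) : C := t%:C.
Let mon n (t : measurableTypeR R) : C := t%:C ^+ n.

(** The L^1 mean is below the L^2 mean because the variance of [u] is nonnegative; only one circle
    of the supremum is used. *)
Lemma rmean_le_hardy2_norm (h : C -> C) (r M : R) : 0 <= r < 1 ->
  measurable_fun arc (fun s => cabs (h (r%:C * cis s))) ->
  (forall s, cabs (h (r%:C * cis s)) <= M) ->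
  ((rmean (fun s => cabs (h (r%:C * cis s))))%:E <= hardy2_norm h)%E.
Proof.
move=> hr mh hM.
pose u (s : R) := cabs (h (r%:C * cis s)); pose m := rmean u.
have u0 s : 0 <= u s by rewrite cabs_ge0.
have iu : leb.-integrable arc (EFin \o u).
  apply: (@integrable_arc_bounded R u M); first exact: mh.
  by move=> s; rewrite ger0_norm; [exact: hM|exact: u0].
have iu2 : leb.-integrable arc (EFin \o (fun s => u s ^+ 2)).
  apply: (@integrable_arc_bounded R _ (M ^+ 2)); first exact: (measurable_funX 2 mh).
  move=> s; rewrite ger0_norm ?exprn_ge0 ?u0 //.
  by apply: lerXn2r; rewrite ?nnegrE ?u0 ?(le_trans (u0 s) (hM s)) ?hM.
have pi0 : 0 <= (2 * pi)^-1 :> R by rewrite invr_ge0 (ltW (@twopi_gt0 R)).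
have m0 : 0 <= m by rewrite /m /rmean mulr_ge0 // Rintegral_ge0.
have mm : m ^+ 2 <= rmean (fun s => u s ^+ 2).
  have i1 : leb.-integrable arc (EFin \o (fun s => 2 * m * u s)).
    by have k := integrableZl mA (2 * m) iu; apply: eq_integrable k.
  have ic := @integrable_arc_cst R (m ^+ 2).
  have i2 : leb.-integrable arc (EFin \o (fun s => u s ^+ 2 + m ^+ 2)).
    by have k := integrableD mA iu2 ic; apply: eq_integrable k.
  have k : rmean (fun s => 2 * m * u s) <= rmean (fun s => u s ^+ 2 + m ^+ 2).
    by apply: rmean_le => // s; have := sqr_ge0 (u s - m); nra.
  have e1 : rmean (fun s => 2 * m * u s) = 2 * m * m.
    by rewrite /rmean RintegralZl // mulrCA.
  have e2 : rmean (fun s => u s ^+ 2 + m ^+ 2) = rmean (fun s => u s ^+ 2) + m ^+ 2.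
    rewrite {1}/rmean RintegralD // mulrDr; congr (_ + _).
    exact: rmean_cst.
  by rewrite e1 e2 in k; nra.
apply: (@le_trans _ _ (((2 * pi)^-1%:E * \int[leb]_(s in arc) (u s ^+ 2)%:E) `^ (2^-1))%E).
  rewrite -[X in (_ * X)%E]fineK; last exact: (integrable_fin_num mA iu2).
  rewrite -EFinM poweR_EFin lee_fin.
  have mm0 : 0 <= rmean (fun s => u s ^+ 2) by apply: le_trans mm; rewrite exprn_ge0.
  rewrite powR12_sqrt // -/m -(ger0_norm m0) -sqrtr_sqr ler_wsqrtr //.
apply: ereal_sup_ubound; exists r; first by rewrite /= in_itv.
by congr ((_ * _) `^ _)%E; apply: eq_integral => s _; rewrite circle_pointE.
Qed.

Lemma bmoa_test_bound n (s : R) g : 0 <= s < 1 ->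
  (forall z, udisc z -> g z = hankel_integral mu (fun w : C => w ^+ n) z) ->
  (((1 - s ^+ 2) / 2 * cabs (test_derivative mu n s))%:E <= bmoa_norm g)%E.
Proof.
move=> hs hg; have /andP[s0 s1] := hs.
have ds : udisc s%:C by rewrite /udisc /= cabs_real ger0_norm.
pose v (t : measurableTypeR R) : C := mon n t * idC t / (1 - idC t * s%:C) ^+ 2.
(* [psi t] is the Moebius image of t. With a = s the denominator in [mobius_kernel_diff] factors as
   (1 - t s)^2 (1 - psi(t) z), so the cofactor of z is again a Cauchy integral, with density [v]. *)
pose psi (t : measurableTypeR R) : C := (s%:C - t%:C) / (1 - t%:C * s%:C).
have iv : cintegrable mu I v := @cintegrable_cauchy_deriv R mu (mon n) idC
  (cintegrable_monomial mu n) (@cmeasurable_id R) (@cabs_unit_itv R) s%:C ds.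
have mpsi : cmeasurable I psi.
  apply: cmeasurableM; first by apply: cmeasurableB; [exact: cmeasurable_cst|exact: cmeasurable_id].
  apply: cmeasurableV; apply: cmeasurableB; first exact: cmeasurable_cst.
  by apply: cmeasurableM; [exact: cmeasurable_id|exact: cmeasurable_cst].
have psi1 t : I t -> cabs (psi t) <= 1.
  move=> It; have /andP[t0 t1] := unit_itvP It.
  have d0 : 0 < 1 - t * s by nra.
  rewrite /psi -rmorphB -rmorphM /= -(rmorph1 (real_complex R)) -rmorphB /=.
  rewrite cabsM cabsV !cabs_real (gtr0_norm d0) ler_pdivrMr // mul1r ler_norml.
  by apply/andP; split; nra.
pose q := cauchy_integral mu v psi.
have aq : analytic q := cauchy_integral_analytic iv mpsi psi1.
have lq : locally_bounded_derivative q := cauchy_integral_lbd iv mpsi psi1.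
have hr : 0 <= (1 / 2 : R) < 1 by apply/andP; split; lra.
have hr' : 0 < (1 / 2 : R) < 1 by apply/andP; split; lra.
have q0 : q 0 = test_derivative mu n s.
  by apply: eq_cint => t _; rewrite mulr0 subr0 divr1.
have dz t : udisc ((1 / 2 : R)%:C * cis t) by exact: circle_in_disc.
have hq z : udisc z -> g (mobius s%:C z) - g s%:C = - ((1 - s ^+ 2)%:C * z) * q z.
  move=> uz; have dm := mobius_disc ds uz.
  have i1 := @cintegrable_cauchy R mu (mon n) idC (cintegrable_monomial mu n)
    (@cmeasurable_id R) (@cabs_unit_itv R) _ dm.
  have i2 := @cintegrable_cauchy R mu (mon n) idC (cintegrable_monomial mu n)
    (@cmeasurable_id R) (@cabs_unit_itv R) _ ds.
  have i3 := cintegrable_cauchy iv mpsi psi1 uz.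
  rewrite !hg // /hankel_integral /q /cauchy_integral -cintB // -cintZl //.
  apply: eq_cint => t It; rewrite -mulrBr.
  have [n1 n2 ->] := mobius_kernel_diff ds uz (unit_itvP It).
  have cs : Num.conj (s%:C : C) = s%:C by exact: conjc_real.
  rewrite cs in n2; rewrite cs; rewrite cabs_real (ger0_norm s0) /v /psi /mon /idC.
  rewrite rmorphB rmorph1; field.
  by apply/andP; split; [exact: n1|exact: n2].
(* On the circle of radius 1/2 the factor z has constant modulus: this is the 1/2 in the
   statement. *)
have E t : cabs (g (mobius s%:C ((1 / 2 : R)%:C * cis t)) - g s%:C) =
    (1 - s ^+ 2) / 2 * cabs (q ((1 / 2 : R)%:C * cis t)).
  rewrite hq // !cabsM cabsN !cabsM cabs_cis !cabs_real mulr1 ger0_norm; last first.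
    by rewrite subr_ge0 exprn_ile1 // ltW.
  by rewrite ger0_norm; lra.
have c0 : 0 <= (1 - s ^+ 2) / 2 by rewrite divr_ge0 // subr_ge0 exprn_ile1 // ltW.
have [M hM] := bounded_circle aq lq (proj2 (andP hr)).
have cq : continuous (fun t => q ((1 / 2 : R)%:C * cis t)) := circle_continuous aq hr.
have iq := ccontinuous_cintegrable cq.
pose h z := g (mobius s%:C z) - g s%:C.
have hardy : ((rmean (fun t => cabs (h ((1 / 2 : R)%:C * cis t))))%:E <= hardy2_norm h)%E.
  apply: (@rmean_le_hardy2_norm h (1 / 2) ((1 - s ^+ 2) / 2 * M)) => //.
  - rewrite (funext E); apply: measurable_funM; first exact: measurable_cst.
    by apply: measurable_fun_cabs; exact: ccontinuous_measurable mA cq.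
  - move=> t; rewrite /h E ler_wpM2l // hM //.
    by rewrite cabsM cabs_cis mulr1 cabs_real ger0_norm //; lra.
apply: (@le_trans _ _ (bmoa_seminorm g)); last first.
  by rewrite /bmoa_norm leeDr // lee_fin cabs_ge0.
apply: (@le_trans _ _ (hardy2_norm h)); last first.
  by apply: ereal_sup_ubound; exists s%:C.
apply: le_trans hardy; rewrite lee_fin /h (funext E) -q0.
rewrite /rmean RintegralZl //; last exact: cintegrable_cabs.
rewrite mulrCA ler_wpM2l // -(mean_value_circle aq lq hr').
exact: cabs_cmean.
Qed.

End bmoa_necessary.

Local Close Scope complex_scope.

Theorem theorem3p5 (R : realType)
    (mu : {finite_measure set (measurableTypeR R) -> \bar R})
    (mu_supp : mu (~` [set` `[0%R, 1%R[]) = 0%E)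
    (alpha : R) (alpha_gt1 : 1 < alpha) :
  (carleson mu alpha <->
   hankel_bounded mu (bloch_norm alpha) (bloch_norm 1)) /\
  (hankel_bounded mu (bloch_norm alpha) (bloch_norm 1) <->
   hankel_bounded mu (bloch_norm alpha) bmoa_norm).
Proof.
have nec1 : hankel_bounded mu (bloch_norm alpha) (bloch_norm 1) -> carleson mu alpha.
  apply: (carleson_of_test_bound alpha_gt1) => n s g hs hg.
  exact: (bloch_test_bound hs hg).
have nec2 : hankel_bounded mu (bloch_norm alpha) bmoa_norm -> carleson mu alpha.
  apply: (carleson_of_test_bound alpha_gt1) => n s g hs hg.
  exact: (bmoa_test_bound hs hg).
have suf := carleson_hankel_bounded alpha_gt1.
split; split.
- by move=> /suf[].
- exact: nec1.
- by move=> /nec1 /suf[].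
- by move=> /nec2 /suf[].
Qed.
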